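(* For every integer $n\ge1$, the number of maximal chains in the lattice $(\mathrm{NCCP}(n),\le)$ of noncommutative crossing partitions of $[n]$ is $((n-1)!)^2$.
   Context: **Noncommutative crossing partitions.** Let $[n]=\{1,\dots,n\}$. A noncommutative crossing partition of $[n]$ is a finite sequence $\pi=(\pi_1,\dots,\pi_l)$, written $\pi_1/\cdots/\pi_l$, of nonempty blocks such that each $p\in[n]$ appears exactly once in $\pi$, each block is written as an increasing sequence, and $\max(\pi_i)>\min(\pi_{i+1})$ for $1\le i\le l-1$. $\mathrm{NCCP}(n)$ is the set of these. Concatenating the blocks gives a permutation of $[n]$ in one-line notation, which determines $\pi$ (slashes sit exactly at the descents); $\pi$ is identified with this permutation. **Labeled binary trees.** A labeled binary tree with $n$ nodes is a rooted tree in which each node has at most one left child and at most one right child, with nodes labeled bijectively by $[n]$ so that labels increase from the root to the leaves. Let $\phi(L)$ be the permutation (element of $\mathrm{NCCP}(n)$) obtained by reading the labels of $L$ in in-order (left subtree, root, right subtree). The map $\phi$ is a bijection from labeled binary trees with $n$ nodes to $\mathrm{NCCP}(n)$. **Rotation and cover relation.** Let $L$ be a labeled binary tree and let $\mathfrak n$ be a node that is the left child of its parent $\mathfrak n_0$. For a node $\mathfrak m$ let $p(\mathfrak m)$ be the set of nodes on the path from $\mathfrak m$ to the root, both included. Let $LS(\mathfrak n)$ be the set of nodes $\mathfrak m\in p(\mathfrak n)$, $\mathfrak m\neq\mathfrak n$, such that the child of $\mathfrak m$ lying on $p(\mathfrak n)$ is the left child of $\mathfrak m$. A node $\mathfrak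 n'$ with label smaller than that of $\mathfrak n$ is ''right to'' $\mathfrak n$ if there is a node $\mathfrak c$ with $\mathfrak n'$ in the right subtree of $\mathfrak c$ and $\mathfrak n$ in the left subtree of $\mathfrak c$. *Choice of $\mathfrak n_a$.* If no node with label smaller than that of $\mathfrak n$ is right to $\mathfrak n$, $\mathfrak n_a$ is any element of $LS(\mathfrak n)$. Otherwise let $\mathfrak n'_l$ be the left-most (in in-order) of the nodes of smaller label right to $\mathfrak n$, let $\mathfrak n_c$ be the node of maximal label in $p(\mathfrak n)\cap p(\mathfrak n'_l)$, and let $\mathfrak n_a$ be any element of $LS(\mathfrak n)\setminus(p(\mathfrak n_c)\setminus\{\mathfrak n_c\})$. *Choice of $S$.* Let $\mathfrak m_0=\mathfrak n$ and let $\mathfrak m_i$ be the left child of $\mathfrak m_{i-1}$ for $1\le i\le p$, with $p$ maximal. Let $S\subseteq\{1,\dots,p\}$ be any subset and $\mathfrak m(S)=\{\mathfrak m_i:i\in S\}$. *Two trees.* $T_1$: link the nodes of $\{\mathfrak n\}\cup\mathfrak m(S)$ by left edges in increasing label order (root $\mathfrak n$), each keeping its right subtree from $L$. $T_2$: link the nodes $\mathfrak n_0$ and $\mathfrak m_i$ ($1\le i\le p$, $i\notin S$) by left edges in increasing label order (root $\mathfrak n_0$), each keeping its right subtree from $L$, and replace in $L$ the subtree rooted at $\mathfrak n_0$ by this tree. *Gluing.* For a node $x$ let $\vec q(x)$ be the maximal chain $x$, right child of $x$, right child of that, etc. Take all nodes of $\vec q(\mathfrak n)$ in $T_1$ and of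 $\vec q(\mathfrak n_a)$ in $T_2$, sort them by increasing label (so $\mathfrak n_a$ is first), and link them successively by right edges; each of these nodes keeps its left subtree from $T_1$ or $T_2$. Replace the chain $\vec q(\mathfrak n_a)$ in $T_2$ by this chain, leaving the rest of $T_2$ unchanged. The resulting labeled binary tree $L'$ on $[n]$ is the rotation of $L$ with respect to the triplet $(\mathfrak n,\mathfrak n_a,\mathfrak m(S))$. For $\pi,\pi'\in\mathrm{NCCP}(n)$, $\pi\lessdot\pi'$ means that $\phi^{-1}(\pi')$ is a rotation of $\phi^{-1}(\pi)$ for some triplet, and $\pi\le\pi'$ means that there is a sequence $\pi=\pi_0\lessdot\pi_1\lessdot\cdots\lessdot\pi_m=\pi'$ with $m\ge0$. *)

(* Defs.v *)
From HB Require Import structures.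
From mathcomp Require Import all_boot.

Set Implicit Arguments.
Unset Strict Implicit.
Unset Printing Implicit Defensive.

(* The set [n] = {1, ..., n} is encoded by 'I_n = {0, ..., n-1}; only the order
   of the labels matters. For A : {set 'I_n}, [enum A] lists A increasingly. *)

(** * Noncommutative crossing partitions *)

Section Blocks.
Variable n : nat.
Implicit Types (b c : seq 'I_n) (s : seq (seq 'I_n)) (w : seq 'I_n).

Definition block_max b : nat := \max_(p <- b) p.
(* n is larger than all labels, hence neutral for minn *)
Definition block_min b : nat := \big[minn/n]_(p <- b) p.

Definition lt_lab : rel 'I_n := fun p q => p < q.

Definition is_nccp s : bool :=
  [&& all (fun b => b != [::]) s,
      [forall p : 'I_n, count_mem p (flatten s) == 1],
      all (sorted lt_lab) s
    & sorted (fun b c => block_min c < block_max b) s].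

(* The word w cut at its descents. *)
Fixpoint cut_descents w : seq (seq 'I_n) :=
  if w is p :: w' then
    match cut_descents w' with
    | (q :: b) :: s => if p < q then (p :: q :: b) :: s else [:: p] :: (q :: b) :: s
    | s => [:: p] :: s
    end
  else [::].

Lemma flatten_cut w : flatten (cut_descents w) = w.
Proof.
elim: w => //= p w; case: (cut_descents w) => [|[|q b] s] /= <- //.
by case: ifP.
Qed.

Lemma cut_nonempty w : all (fun b => b != [::]) (cut_descents w).
Proof.
elim: w => //= p w; case: (cut_descents w) => [|[|q b] s] //=.
by case: ifP.
Qed.

Lemma block_max_sorted p b : sorted lt_lab (p :: b) ->
  block_max (p :: b) = last p b.
Proof.
rewrite /block_max; elim: b p => [|q b IH] p; first by rewrite big_seq1.
rewrite /= => /andP[pq qb]; rewrite big_cons IH //.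
apply/maxn_idPr; elim: b q pq qb {IH} => [|r b IH] q pq /=; first by rewrite ltnW.
by case/andP=> qr /IH; apply; apply: ltn_trans qr.
Qed.

Lemma block_min_sorted p b : sorted lt_lab (p :: b) -> block_min (p :: b) = p.
Proof.
rewrite /block_min; elim: b p => [|q b IH] p.
  by rewrite big_cons big_nil; move/minn_idPl: (ltnW (ltn_ord p)).
by rewrite /= => /andP[pq qb]; rewrite big_cons IH //; apply/minn_idPl/ltnW.
Qed.

Lemma cut_sorted w : uniq w -> all (sorted lt_lab) (cut_descents w) /\
  sorted (fun b c => block_min c < block_max b) (cut_descents w).
Proof.
elim: w => //= p w IH /andP[pw uw]; have {IH uw} := IH uw.
have := cut_nonempty w; have := flatten_cut w.
case: (cut_descents w) => [|[|q b] s] //= wE ne [/andP[sb ss] ps].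
have pq : p != q by apply: contra pw => /eqP->; rewrite -wE mem_head.
have [ltpq|leqp] := ltnP p q.
  split; first by rewrite /= /lt_lab ltpq sb.
  have e1 : block_max (q :: b) = last q b by apply: block_max_sorted.
  have e2 : block_max [:: p, q & b] = last q b.
    by apply: block_max_sorted; rewrite /= /lt_lab ltpq.
  by case: s ps {wE ne ss} => //= c s; rewrite e1 e2.
split; first by rewrite /= sb.
rewrite /= ps andbT block_min_sorted // /block_max big_seq1.
by rewrite ltn_neqAle leqp andbT eq_sym.
Qed.

Lemma cut_flatten s : is_nccp s -> cut_descents (flatten s) = s.
Proof.
case/and4P=> ne _; elim: s ne => //= b s IH /andP[b0 ne] /andP[sb ss] ps.
have {IH} := IH ne ss (path_sorted ps).
elim: b b0 sb ps => //= p b IH _ sb ps.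
case: b IH sb ps => [|q b] IH sb ps sE.
  rewrite /= sE; case: s ps ne ss {IH sE} => //= [[//|q c]] s /andP[+ _] _ /andP[sc _].
  rewrite /block_max big_seq1 block_min_sorted // => qp.
  by rewrite ltnNge (ltnW qp).
case/andP: (sb) => pq qb; rewrite -cat1s -catA cat1s /=.
have qs : path (fun b c => block_min c < block_max b) (q :: b) s.
  case: s ps {sE ne ss IH} => //= c s /andP[+ ->]; rewrite andbT.
  by rewrite !block_max_sorted.
by have /= -> := IH isT qb qs sE; move: pq; rewrite /lt_lab => ->.
Qed.

End Blocks.

Record NCCP (n : nat) := MkNCCP {
  blocks :> seq (seq 'I_n);
  blocksP : is_nccp blocks }.

HB.instance Definition _ n := [isSub for @blocks n].
HB.instance Definition _ n := [Countable of NCCP n by <:].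

(** * Labeled binary trees *)

(* Leaf is the empty tree: a missing child is the child Leaf. *)
Inductive btree (T : Type) :=
  | Leaf
  | Node of btree T & T & btree T.
Arguments Leaf {T}.

Section TreeCount.
Variable T : countType.

Fixpoint btree_code (t : btree T) : GenTree.tree T :=
  if t is Node l x r then
    GenTree.Node 1 [:: btree_code l; GenTree.Leaf x; btree_code r]
  else GenTree.Node 0 [::].

Fixpoint btree_decode (c : GenTree.tree T) : btree T :=
  if c is GenTree.Node 1 [:: cl; GenTree.Leaf x; cr] then
    Node (btree_decode cl) x (btree_decode cr)
  else Leaf.

Lemma btree_codeK : cancel btree_code btree_decode.
Proof. by elim=> //= l -> x r ->. Qed.

HB.instance Definition _ := Countable.copy (btree T) (can_type btree_codeK).
End TreeCount.

Fixpoint inorder {T} (t : btree T) : seq T :=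
  if t is Node l x r then inorder l ++ x :: inorder r else [::].

Section Increasing.
Variable n : nat.
Implicit Types (t : btree 'I_n) (w : seq 'I_n).

Fixpoint increasing t : bool :=
  if t is Node l x r then
    [&& all (lt_lab x) (inorder l), all (lt_lab x) (inorder r),
        increasing l & increasing r]
  else true.

Definition is_ltree t : bool :=
  [forall p : 'I_n, count_mem p (inorder t) == 1] && increasing t.

(* The increasing tree with in-order word w. *)
Fixpoint insert_first p t : btree 'I_n :=
  if t is Node l x r then
    if x < p then Node (insert_first p l) x r else Node Leaf p t
  else Node Leaf p Leaf.

Definition tree_of_word w : btree 'I_n := foldr insert_first Leaf w.

Lemma inorder_insert p t : inorder (insert_first p t) = p :: inorder t.
Proof. by elim: t => //= l IH x r _; case: ifP => //= _; rewrite IH. Qed.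

Lemma inorder_tree_of_word w : inorder (tree_of_word w) = w.
Proof. by elim: w => //= p w IH; rewrite inorder_insert IH. Qed.

Lemma increasing_insert p t : p \notin inorder t -> increasing t ->
  increasing (insert_first p t).
Proof.
elim: t => //= l IHl x r _; rewrite mem_cat inE !negb_or.
case/and3P=> pl px pr /and4P[xl xr il ir].
have [xp|lepx] := ltnP x p.
  by rewrite /= inorder_insert /= [lt_lab _ _]xp xl xr ir IHl.
have ltpx : p < x by rewrite ltn_neqAle px.
rewrite /= all_cat /= xl xr il ir [lt_lab p x]ltpx !andbT /=.
by rewrite !(sub_all _ xl, sub_all _ xr) // => y; apply: ltn_trans.
Qed.

Lemma increasing_tree_of_word w : uniq w -> increasing (tree_of_word w).
Proof.
elim: w => //= p w IH /andP[pw uw].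
by apply: increasing_insert; rewrite ?inorder_tree_of_word // IH.
Qed.

Lemma cat_pivot_inj (T : eqType) (x : T) s1 s2 s1' s2' :
  x \notin s1 -> x \notin s1' -> s1 ++ x :: s2 = s1' ++ x :: s2' ->
  s1 = s1' /\ s2 = s2'.
Proof.
elim: s1 s1' => [|y s1 IH] [|y' s1'] //=; rewrite ?inE ?negb_or.
- by move=> _ _ [->].
- by move=> _ /andP[xy _] [yx _]; rewrite yx eqxx in xy.
- by move=> /andP[xy _] _ [yx _]; rewrite yx eqxx in xy.
- by move=> /andP[_ h] /andP[_ h'] [-> /(IH _ h h')[-> ->]].
Qed.

Lemma inorder_inj t t' : increasing t -> increasing t' ->
  inorder t = inorder t' -> t = t'.
Proof.
have root_min l x r : increasing (Node l x r) ->
    (forall y, y \in inorder (Node l x r) -> x <= y) /\ x \notin inorder l.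
  case/and4P=> /allP xl /allP xr _ _; split; last first.
    by apply/negP => /xl; rewrite /lt_lab ltnn.
  move=> y; rewrite mem_cat inE => /or3P[/xl|/eqP->|/xr] //; exact: ltnW.
elim: t t' => [|l IHl x r IHr] [|l' x' r'] //.
- by move=> _ _ /=; case: (inorder l').
- by move=> _ _ /=; case: (inorder l).
move=> it it' e; have [m nx] := root_min _ _ _ it.
have [m' nx'] := root_min _ _ _ it'.
have xx : x = x'.
  have root_mem u y v : y \in inorder (Node u y v) by rewrite /= mem_cat mem_head orbT.
  by apply/val_inj/anti_leq; rewrite m ?m' // -?e ?root_mem // e root_mem.
subst x'; have [el er] := cat_pivot_inj nx nx' e.
case/and4P: it it' => _ _ il ir /and4P[_ _ il' ir'].
by rewrite (IHl l') // (IHr r').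
Qed.

Lemma count_mem1_uniq w : [forall p : 'I_n, count_mem p w == 1] -> uniq w.
Proof.
move=> /forallP h; apply/(@count_mem_uniq _ w) => p.
by rewrite (eqP (h p)) -has_pred1 has_count (eqP (h p)).
Qed.

Lemma tree_of_inorder t : is_ltree t -> tree_of_word (inorder t) = t.
Proof.
case/andP=> /count_mem1_uniq u i; apply: inorder_inj => //.
  exact: increasing_tree_of_word.
exact: inorder_tree_of_word.
Qed.

End Increasing.

Record ltree (n : nat) := MkLtree {
  ltree_val :> btree 'I_n;
  ltreeP : is_ltree ltree_val }.

HB.instance Definition _ n := [isSub for @ltree_val n].
HB.instance Definition _ n := [Countable of ltree n by <:].

Section Phi.
Variable n : nat.
Implicit Types (L : ltree n) (pi : NCCP n).

Lemma phi_subproof L : is_nccp (cut_descents (inorder L)).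
Proof.
case/andP: (ltreeP L) => c _; have u := count_mem1_uniq c.
have [? ?] := cut_sorted u.
by apply/and4P; split; rewrite ?cut_nonempty ?flatten_cut.
Qed.

Definition phi L : NCCP n := MkNCCP (phi_subproof L).

Lemma phi_inv_subproof pi : is_ltree (tree_of_word (flatten pi)).
Proof.
case/and4P: (blocksP pi) => _ c _ _; rewrite /is_ltree inorder_tree_of_word c.
exact/increasing_tree_of_word/count_mem1_uniq.
Qed.

Definition phi_inv pi : ltree n := MkLtree (phi_inv_subproof pi).

Lemma phiK : cancel phi phi_inv.
Proof. by move=> L; apply/val_inj; rewrite /= flatten_cut tree_of_inorder ?ltreeP. Qed.

Lemma phi_invK : cancel phi_inv phi.
Proof.
by move=> pi; apply/val_inj; rewrite /= inorder_tree_of_word cut_flatten ?blocksP.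
Qed.

Lemma word_size pi : size (flatten pi) == n.
Proof.
case/and4P: (blocksP pi) => _ c _ _; have u := count_mem1_uniq c.
rewrite -[X in _ == X]card_ord -(card_uniqP u); apply/eqP/eq_card => p.
by rewrite inE -has_pred1 has_count (eqP (forallP c p)).
Qed.

Definition word pi : n.-tuple 'I_n := Tuple (word_size pi).
Definition of_word (w : n.-tuple 'I_n) : option (NCCP n) := insub (cut_descents w).

Lemma wordK : pcancel word of_word.
Proof. by move=> pi; rewrite /of_word /= cut_flatten ?blocksP // valK. Qed.

HB.instance Definition _ := isFinite.Build (NCCP n) (pcan_enumP wordK).
HB.instance Definition _ := isFinite.Build (ltree n) (pcan_enumP (can_pcan phiK)).

End Phi.

(** * Rotations *)

(* A node of a labeled binary tree is identified with its label. *)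

Section Nodes.
Variable T : eqType.
Implicit Types (t u : btree T) (x y : T).

Definition root t : option T := if t is Node _ x _ then Some x else None.

Fixpoint subtree t x : btree T :=
  if t is Node l y r then
    if x == y then t else if x \in inorder l then subtree l x else subtree r x
  else Leaf.

Definition left_subtree t x : btree T :=
  if subtree t x is Node l _ _ then l else Leaf.
Definition right_subtree t x : btree T :=
  if subtree t x is Node _ _ r then r else Leaf.

Definition left_child t x : option T := root (left_subtree t x).

(* p(x) *)
Fixpoint root_path t x : seq T :=
  if t is Node l y r then
    if x == y then [:: y]
    else if x \in inorder l then y :: root_path l x
    else if x \in inorder r then y :: root_path r x
    else [::]
  else [::].

Fixpoint left_spine t : seq T :=
  if t is Node l x _ then x :: left_spine l else [::].
Fixpoint right_spine t : seq T :=
  if t is Node _ x r then x :: right_spine r else [::].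

(* m_1, ..., m_p for m_0 = x *)
Definition left_chain t x : seq T := left_spine (left_subtree t x).
(* the chain q(x) of successive right children starting at x *)
Definition right_chain t x : seq T := right_spine (subtree t x).

(* t with the subtree rooted at x replaced by u *)
Fixpoint graft t x u : btree T :=
  if t is Node l y r then
    if x == y then u else Node (graft l x u) y (graft r x u)
  else Leaf.

(* The nodes of s linked by left (resp. right) edges, the node y having the
   right (resp. left) subtree f y. *)
Definition link_left (f : T -> btree T) (s : seq T) : btree T :=
  foldr (fun y acc => Node acc y (f y)) Leaf s.
Definition link_right (f : T -> btree T) (s : seq T) : btree T :=
  foldr (fun y acc => Node (f y) y acc) Leaf s.

End Nodes.

Section Rotation.
Variable n : nat.
Implicit Types (t : btree 'I_n) (x y a : 'I_n) (M : {set 'I_n}).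

Definition path_set t x : {set 'I_n} := [set m in root_path t x].

(* LS(x) *)
Definition left_ancestors t x : {set 'I_n} :=
  [set m in path_set t x :\ x | [exists c in path_set t x, left_child t m == Some c]].

Definition right_to t y x : bool :=
  [exists c, (y \in inorder (right_subtree t c))
          && (x \in inorder (left_subtree t c))].

Definition smaller_right_to t x : seq 'I_n :=
  [seq y : 'I_n <- inorder t | (y < x) && right_to t y x].

(* a is an admissible choice of n_a for the node x; in the second case y is
   n'_l and c is n_c. *)
Definition valid_na t x a : bool :=
  if smaller_right_to t x is y :: _ then
    [exists c in path_set t x :&: path_set t y,
       [forall d in path_set t x :&: path_set t y, d <= c]
       && (a \in left_ancestors t x :\: (path_set t c :\ c))]
  else a \in left_ancestors t x.

Definition rot_T1 t x M : btree 'I_n :=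
  link_left (right_subtree t) (enum (x |: M)).

Definition rot_T2 t x x0 M : btree 'I_n :=
  graft t x0
    (link_left (right_subtree t)
       (enum (x0 |: ([set m in left_chain t x] :\: M)))).

Definition rotate t x x0 a M : btree 'I_n :=
  let T1 := rot_T1 t x M in
  let T2 := rot_T2 t x x0 M in
  graft T2 a
    (link_right
       (fun y => if y \in inorder T1 then left_subtree T1 y else left_subtree T2 y)
       (enum ([set m in right_chain T1 x] :|: [set m in right_chain T2 a]))).

(* L' is the rotation of L with respect to some triplet (x, a, M), where x is
   the left child of x0. *)
Definition is_rotation (L L' : ltree n) : bool :=
  [exists x : 'I_n, exists x0 : 'I_n, exists a : 'I_n, exists M : {set 'I_n},
    [&& left_child L x0 == Some x,
        valid_na L x a,
        M \subset left_chain L x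
      & ltree_val L' == rotate L x x0 a M]].

Definition nccp_cover : rel (NCCP n) :=
  fun pi pi' => is_rotation (phi_inv pi) (phi_inv pi').

Definition nccp_le : rel (NCCP n) := connect nccp_cover.

Definition is_chain (C : {set NCCP n}) : bool :=
  [forall pi in C, forall pi' in C, nccp_le pi pi' || nccp_le pi' pi].

Definition is_maximal_chain (C : {set NCCP n}) : bool := maxset is_chain C.

End Rotation.

(* Main.v *)
(** An increasing tree is encoded by its edges (parent, side, child).  In this
    encoding a rotation splits the left chain of [n_0] in two, merges the right
    chains of [n] and [n_a], and changes nothing else ([rotate_edges]); so it
    raises the number of right edges by one, and maximal chains are the
    saturated paths from the all-left tree to the all-right tree.

    These paths are counted by removing the largest label [N], which is always
    a leaf.  If [N] is a left leaf of [L'], removing it is a bijection from the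
    lower covers of [L'] to those of [L' - N]; if [N] is a right leaf of [L],
    it is a bijection from the upper covers of [L] to those of [L - N].  A
    saturated path on [N + 1] labels thus projects to one on [N] labels that
    stops once, at the step where [N] passes from left to right.  For a fixed
    tree [t] on [N] labels there are exactly [N] such steps, one for each node
    [a = n_a] of [t], and the path visits [N] trees; hence
    [paths (N + 1) = N ^ 2 * paths N]. *)

(* Trees with distinct labels are determined by their root and edges, and on a fixed label set the
   root is forced to be the smallest label. Equalities between grafted trees therefore become
   additive identities between counts of edges, for an arbitrary predicate on edges.

   Each of the two bijections works in one direction only. When a left chain is split, a largest
   label at its end may go to either part, so a left [N] has no unique lift upwards; read downwards,
   its earlier place is forced, namely the end of the left chain. Dually, when two right chains
   merge, [N] ends the merged chain, but read backwards it may come from either of them. This is why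
   the part of a path before the crossing is counted from its last tree downwards, and the part
   after it from its first tree upwards.

   A crossing over [t] is indexed by [a] because the rule for [n_a] amounts to this: [N] lies in the
   left subtree of [a], and inside that subtree no smaller label is right to [N]. This fixes one
   place for [N] before the step; its place after the step is the end of the right chain of [a]. *)
Require Import Defs.
From mathcomp Require Import all_boot.
From mathcomp Require Import zify_ssreflect.
(* [root] must be the root of a tree, not the one of fingraph. *)
Import Defs.

Set Implicit Arguments.
Unset Strict Implicit.
Unset Printing Implicit Defensive.

(* Syntactically different but convertible instances of [eqType] on ['I_n] hide
   equal atoms from lia. *)
Ltac count_lia :=
  change (nat_of_bool true) with 1; change (nat_of_bool false) with 0;
  repeat match goal with
  | |- context [@count ?A ?p ?s] =>
      let c := fresh "c" in set c := (@count A p s); clearbody c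
  | |- context [@bigop.body ?A ?I ?i ?r ?f] =>
      let c := fresh "c" in set c := (@bigop.body A I i r f); clearbody c
  | |- context [nat_of_bool ?b] =>
      let c := fresh "c" in set c := (nat_of_bool b); clearbody c
  end; clear; lia.

(** * Trees as multisets of edges *)

Section Edges.
Variable T : eqType.
Implicit Types (t u l r : btree T) (x y z : T) (s : seq T) (b : bool).
Implicit Types (P : pred (T * bool * T)).

(** An edge is a triple of parent, side and child, the side [true] being left. The stem is the edge
    entering [u] from [y], absent when [u] is empty. *)
Definition stem y b u : seq (T * bool * T) :=
  if u is Node _ z _ then [:: (y, b, z)] else [::].

Fixpoint edges t : seq (T * bool * T) :=
  if t is Node l y r then stem y true l ++ stem y false r ++ edges l ++ edges r
  else [::].

Fixpoint links b s : seq (T * bool * T) :=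
  if s is y :: s' then
    (if s' is z :: _ then [:: (y, b, z)] else [::]) ++ links b s'
  else [::].

Definition side_subtree b t y := if b then left_subtree t y else right_subtree t y.
Definition side_child b t y := root (side_subtree b t y).
Definition side_spine b t := if b then left_spine t else right_spine t.

Lemma links_rcons b y s z : links b (rcons (y :: s) z) = rcons (links b (y :: s)) (last y s, b, z).
Proof. by elim: s y => //= w s IH y; rewrite IH. Qed.

Lemma links_cat b s1 y s2 : links b (s1 ++ y :: s2) = links b (rcons s1 y) ++ links b (y :: s2).
Proof. by elim: s1 => // w s1 IH; rewrite /= IH; case: s1 {IH}. Qed.

Lemma size_links b s : size (links b s) = (size s).-1.
Proof. by elim: s => // y [|z s] //= ->. Qed.

Lemma links_side b s e : e \in links b s -> e.1.2 = b.
Proof. by elim: s => // y [|z s] IH //=; rewrite inE => /orP[/eqP->|/IH]. Qed.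

Lemma edges_link_left f s P : count P (edges (link_left f s)) =
  count P (links true s)
  + \sum_(y <- s) (count P (stem y false (f y)) + count P (edges (f y))).
Proof.
elim: s => [|y s IH]; first by rewrite big_nil.
rewrite big_cons /= !count_cat IH; case: s {IH} => [|z s] /=; lia.
Qed.

Lemma edges_link_right f s P : count P (edges (link_right f s)) =
  count P (links false s)
  + \sum_(y <- s) (count P (stem y true (f y)) + count P (edges (f y))).
Proof.
elim: s => [|y s IH]; first by rewrite big_nil.
rewrite big_cons /= !count_cat IH; case: s {IH} => [|z s] /=; lia.
Qed.

Lemma uniq_node l y r : uniq (inorder (Node l y r)) ->
  [/\ y \notin inorder l, y \notin inorder r, uniq (inorder l), uniq (inorder r)
    & forall z, z \in inorder l -> z \notin inorder r].
Proof.
rewrite /= cat_uniq /= negb_or => /and4P[ul /andP[yl h] yr ur].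
split=> // z zl; apply: contra h => zr; apply/hasP; exists z => //.
Qed.

Lemma subtree_notin t y : y \notin inorder t -> subtree t y = Leaf.
Proof.
elim: t => //= l IHl z r IHr; rewrite mem_cat inE !negb_or => /and3P[yl /negbTE-> yr].
by rewrite (negbTE yl) IHr.
Qed.

Lemma mem_subtree t y z : z \in inorder (subtree t y) -> z \in inorder t.
Proof.
elim: t => //= l IHl w r IHr; rewrite mem_cat inE; case: (y == w).
  by rewrite /= mem_cat inE.
by case: ifP => _ => [/IHl->|/IHr->] //; rewrite !orbT.
Qed.

Lemma root_subtree t y : y \in inorder t -> root (subtree t y) = Some y.
Proof.
elim: t => //= l IHl w r IHr; rewrite mem_cat inE.
by case: eqP => [->|_] //=; case: ifP => [yl _|_]; [apply: IHl | apply: IHr].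
Qed.

Lemma subtree_node t y : y \in inorder t ->
  subtree t y = Node (left_subtree t y) y (right_subtree t y).
Proof.
move/root_subtree; rewrite /left_subtree /right_subtree.
by case: (subtree t y) => //= l z r [->].
Qed.

Lemma subtree_uniq t y : uniq (inorder t) -> uniq (inorder (subtree t y)).
Proof.
elim: t => //= l IHl w r IHr U; have [_ _ ul ur _] := uniq_node U.
by case: eqP => // _; case: ifP => _; [apply: IHl | apply: IHr].
Qed.

Lemma subtree_subtree t y z : uniq (inorder t) -> z \in inorder (subtree t y) ->
  subtree (subtree t y) z = subtree t z.
Proof.
elim: t => //= l IHl w r IHr U; have [wl wr ul ur lr] := uniq_node U.
case: eqP => // _; case: ifP => yl' zi.
  have zl := mem_subtree zi; rewrite IHl // zl.
  by case: eqP => // zw; rewrite zw (negbTE wl) in zl.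
have zr := mem_subtree zi; rewrite IHr //.
case: eqP => [zw|_]; first by rewrite zw (negbTE wr) in zr.
by case: ifP => // zl; have := lr _ zl; rewrite zr.
Qed.

Lemma side_subtree_notin b t y : y \notin inorder t -> side_subtree b t y = Leaf.
Proof.
by move=> h; rewrite /side_subtree /left_subtree /right_subtree subtree_notin //; case: b.
Qed.

Lemma mem_side_subtree b t y z : z \in inorder (side_subtree b t y) ->
  z \in inorder (subtree t y).
Proof.
rewrite /side_subtree /left_subtree /right_subtree.
by case: (subtree t y) => [|l w r]; case: b; rewrite //= mem_cat inE => ->; rewrite ?orbT.
Qed.

Lemma side_subtree_root b l y r : side_subtree b (Node l y r) y = if b then l else r.
Proof. by rewrite /side_subtree /left_subtree /right_subtree /= eqxx; case: b. Qed.

Lemma side_subtree_l b l y r z : uniq (inorder (Node l y r)) -> z \in inorder l ->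
  side_subtree b (Node l y r) z = side_subtree b l z.
Proof.
move=> /uniq_node[yl _ _ _ _] zl; rewrite /side_subtree /left_subtree /right_subtree /= zl.
by case: eqP => // zy; rewrite zy (negbTE yl) in zl.
Qed.

Lemma side_subtree_r b l y r z : uniq (inorder (Node l y r)) -> z \in inorder r ->
  side_subtree b (Node l y r) z = side_subtree b r z.
Proof.
move=> /uniq_node[_ yr _ _ lr] zr.
have zl : (z \in inorder l) = false by apply/negP => zl; have := lr _ zl; rewrite zr.
rewrite /side_subtree /left_subtree /right_subtree /= zl.
by case: eqP => // zy; rewrite zy (negbTE yr) in zr.
Qed.

Lemma side_subtree_sub b t y z : uniq (inorder t) -> z \in inorder (subtree t y) ->
  side_subtree b (subtree t y) z = side_subtree b t z.
Proof.
by move=> U h; rewrite /side_subtree /left_subtree /right_subtree subtree_subtree.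
Qed.

(** Each edge is charged to its parent. Since labels are distinct, the multiplicity of a given edge
    or slot then involves a single node. *)
Lemma edges_sum t P : uniq (inorder t) -> count P (edges t) =
  \sum_(y <- inorder t) (count P (stem y true (left_subtree t y))
                       + count P (stem y false (right_subtree t y))).
Proof.
elim: t => [|l IHl y r IHr] U; first by rewrite big_nil.
have [_ _ ul ur _] := uniq_node U.
rewrite /= big_cat big_cons /= !count_cat IHl // IHr //.
have := side_subtree_root true l y r; have := side_subtree_root false l y r.
rewrite /side_subtree => -> ->.
have -> : \sum_(i <- inorder l) (count P (stem i true (left_subtree (Node l y r) i))
                       + count P (stem i false (right_subtree (Node l y r) i))) =
  \sum_(i <- inorder l) (count P (stem i true (left_subtree l i))
                       + count P (stem i false (right_subtree l i))).
  apply: eq_big_seq => z zl.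
  have := side_subtree_l true U zl; have := side_subtree_l false U zl.
  by rewrite /side_subtree => -> ->.
have -> : \sum_(i <- inorder r) (count P (stem i true (left_subtree (Node l y r) i))
                       + count P (stem i false (right_subtree (Node l y r) i))) =
  \sum_(i <- inorder r) (count P (stem i true (left_subtree r i))
                       + count P (stem i false (right_subtree r i))).
  apply: eq_big_seq => z zr.
  have := side_subtree_r true U zr; have := side_subtree_r false U zr.
  by rewrite /side_subtree => -> ->.
lia.
Qed.

Lemma edges_mem t y b z : (y, b, z) \in edges t -> (y \in inorder t) && (z \in inorder t).
Proof.
elim: t => //= l IHl w r IHr; rewrite !mem_cat !inE.
case/or4P.
- by case: l {IHl} => //= ? ? ?; rewrite inE => /eqP[-> _ ->]; rewrite !(mem_cat, inE) !eqxx !orbT.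
- by case: r {IHr} => //= ? ? ?; rewrite inE => /eqP[-> _ ->]; rewrite !(mem_cat, inE) !eqxx !orbT.
- by move/IHl => /andP[-> ->].
- by move/IHr => /andP[-> ->]; rewrite !orbT.
Qed.

Lemma edgesE t y b z : uniq (inorder t) ->
  ((y, b, z) \in edges t) = (side_child b t y == Some z).
Proof.
move=> U; case: (boolP (y \in inorder t)) => [yt|yt]; last first.
  rewrite /side_child side_subtree_notin //=; apply/negbTE/negP => /edges_mem.
  by rewrite (negbTE yt).
rewrite -has_pred1 has_count edges_sum // (big_rem y) //=.
rewrite big1_seq ?addn0; last first.
  move=> w /= wr; have /eqP wy : w != y.
    by move: wr; rewrite mem_rem_uniq // inE => /andP[].
  have st b' u : count (pred1 (y, b, z)) (stem w b' u) = 0.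
    by case: u => //= _ v _; rewrite addn0; case: eqP => // -[/wy].
  by rewrite !st.
have st b' u : count (pred1 (y, b, z)) (stem y b' u) = ((b' == b) && (root u == Some z)).
  by case: u => [|? w ?] /=; rewrite ?andbF // addn0 !xpair_eqE eqxx.
rewrite !st /side_child /side_subtree; case: b {st} => /=; rewrite ?addn0 ?add0n.
  by case: (root _ == _).
by case: (root _ == _).
Qed.

Lemma edges_slot t y b : uniq (inorder t) ->
  count (fun e => e.1 == (y, b)) (edges t) = (side_child b t y != None).
Proof.
move=> U; case: (boolP (y \in inorder t)) => [yt|yt]; last first.
  rewrite /side_child side_subtree_notin //=; apply/eqP; rewrite -leqn0 leqNgt -has_count.
  apply/hasPn => -[[w b'] z] /edges_mem /andP[wt _] /=; apply: contra yt.
  by rewrite xpair_eqE => /andP[/eqP<-].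
rewrite edges_sum // (big_rem y) //=.
rewrite big1_seq ?addn0; last first.
  move=> w /= wr; have /eqP wy : w != y.
    by move: wr; rewrite mem_rem_uniq // inE => /andP[].
  have st b' u : count (fun e => e.1 == (y, b)) (stem w b' u) = 0.
    by case: u => //= _ v _; rewrite addn0; case: eqP => // -[/wy].
  by rewrite !st.
have st b' u : count (fun e => e.1 == (y, b)) (stem y b' u) = ((b' == b) && (root u != None)).
  by case: u => [|? w ?] /=; rewrite ?andbF ?andbT // addn0 !xpair_eqE eqxx.
rewrite !st /side_child /side_subtree; case: b {st} => /=; lia.
Qed.

(** Every node except the root is the lower end of exactly one edge. This turns identities between
    edges into identities between labels. *)
Lemma count_inorder t (Q : pred T) :
  count Q (inorder t) = count (fun e => Q e.2) (edges t) +
    (if root t is Some x then (Q x : nat) else 0).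
Proof.
elim: t => //= l IHl y r IHr; rewrite !count_cat /= IHl IHr.
case: l {IHl} => [|? ? ?]; case: r {IHr} => [|? ? ?] /=; lia.
Qed.

(** The root and the child functions rebuild a tree from the top. Restricting the hypothesis to
    common labels lets the induction pass to the subtrees. *)
Lemma tree_ext_child t t' : uniq (inorder t) -> uniq (inorder t') -> root t = root t' ->
  (forall b y, y \in inorder t -> y \in inorder t' -> side_child b t y = side_child b t' y) ->
  t = t'.
Proof.
elim: t t' => [|l IHl x r IHr] [|l' x' r'] // U U' [xx]; rewrite -{}xx in U' * => h.
have [_ _ ul ur _] := uniq_node U; have [_ _ ul' ur' _] := uniq_node U'.
have rootE b : root (if b then l else r) = root (if b then l' else r').
  rewrite -(side_subtree_root b l x r) -(side_subtree_root b l' x r').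
  by apply: h; rewrite /= mem_cat mem_head orbT.
congr Node; [apply: IHl => // | apply: IHr => //].
- exact: (rootE true).
- move=> b y yl yl'; have := h b y; rewrite /side_child !side_subtree_l //.
  by apply; rewrite /= mem_cat ?yl ?yl'.
- exact: (rootE false).
- move=> b y yl yl'; have := h b y; rewrite /side_child !side_subtree_r //.
  by apply; rewrite /= mem_cat inE ?yl ?yl' !orbT.
Qed.

Lemma tree_ext t t' : uniq (inorder t) -> uniq (inorder t') -> root t = root t' ->
  perm_eq (edges t) (edges t') -> t = t'.
Proof.
move=> U U' rt pe; apply: tree_ext_child => // b y _ _.
have h z : (side_child b t y == Some z) = (side_child b t' y == Some z).
  by rewrite -!edgesE // (perm_mem pe).
case e : (side_child b t y) => [z|]; first by apply/esym/eqP; rewrite -h e.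
by case e' : (side_child b t' y) => [z|] //; have := h z; rewrite e e' eqxx.
Qed.

Lemma graft_notin t a u : a \notin inorder t -> graft t a u = t.
Proof.
elim: t => //= l IHl y r IHr; rewrite mem_cat inE !negb_or => /and3P[al /negbTE-> ar].
by rewrite IHl ?IHr.
Qed.

Lemma root_graft t a u : root u = Some a -> root (graft t a u) = root t.
Proof. by case: t => //= l y r; case: eqP => [->|]. Qed.

Lemma stem_root y b u u' : root u = root u' -> stem y b u = stem y b u'.
Proof. by case: u u' => [|? ? ?] [|? ? ?] //= [->]. Qed.

(** As [u] has root [a], the edge entering [a] survives and only the edges below [a] are exchanged.
    Both sides are sums because subtraction on [nat] is truncated. *)
Lemma edges_graft t a u P : uniq (inorder t) -> a \in inorder t -> root u = Some a ->
  count P (edges (graft t a u)) + count P (edges (subtree t a)) =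
  count P (edges t) + count P (edges u).
Proof.
move=> U + ru; elim: t U => //= l IHl y r IHr U; have [yl yr ul ur lr] := uniq_node U.
rewrite mem_cat inE; case: eqP => [->|_] /= at_; first by rewrite addnC.
rewrite !(stem_root _ _ (root_graft _ ru)) !count_cat; move: at_.
case: ifP => [al _|_ /= ar].
  by rewrite (graft_notin u (lr _ al)); have := IHl ul al; lia.
rewrite (graft_notin u (t := l)); first by have := IHr ur ar; lia.
by apply/negP => /lr; rewrite ar.
Qed.

Lemma inorder_graft t a u (Q : pred T) : uniq (inorder t) -> a \in inorder t ->
  count Q (inorder (graft t a u)) + count Q (inorder (subtree t a)) =
  count Q (inorder t) + count Q (inorder u).
Proof.
elim: t => //= l IHl y r IHr U; have [yl yr ul ur lr] := uniq_node U.
rewrite mem_cat inE; case: eqP => [->|_] /= at_; first by rewrite addnC.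
rewrite !count_cat /=; move: at_.
case: ifP => [al _|_ /= ar].
  by rewrite (graft_notin u (lr _ al)); have := IHl ul al; lia.
rewrite (graft_notin u (t := l)); first by have := IHr ur ar; lia.
by apply/negP => /lr; rewrite ar.
Qed.

Lemma subtree_root u x : root u = Some x -> subtree u x = u.
Proof. by case: u => //= l y r [->]; rewrite eqxx. Qed.

Lemma subtree_graft_same t a u : uniq (inorder t) -> a \in inorder t ->
  root u = Some a -> subtree (graft t a u) a = u.
Proof.
move=> U + ru; elim: t U => //= l IHl y r IHr U; have [yl yr ul ur lr] := uniq_node U.
rewrite mem_cat inE; case: (a =P y) => [_|/eqP ay] /=; first by rewrite subtree_root.
rewrite (negbTE ay).
have h v : a \in inorder v -> uniq (inorder v) -> a \in inorder (graft v a u).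
  move=> av uv; have := inorder_graft u (pred1 a) uv av.
  have au : 0 < count (pred1 a) (inorder u).
    rewrite -has_count has_pred1.
    by case: (u) ru => //= ? ? ? [->]; rewrite mem_cat inE eqxx orbT.
  rewrite (count_uniq_mem a uv) (count_uniq_mem a (subtree_uniq a uv)) av.
  rewrite -[in X in _ -> X]has_pred1 has_count => e.
  by case: (a \in inorder (subtree v a)) e; lia.
case: (boolP (a \in inorder l)) => [al _|al /= ar]; first by rewrite h // IHl.
by rewrite graft_notin // (negbTE al) IHr.
Qed.

(** [subtree] searches by membership of [a] in in-order words, so the grafted tree must not bring in
    the label [a]; the inclusion of the labels of [u] ensures this. *)
Lemma subtree_graft t x u a : uniq (inorder t) -> x \in inorder t -> a \in inorder t ->
  a \notin inorder (subtree t x) -> {subset inorder u <= inorder (subtree t x)} ->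
  subtree (graft t x u) a = graft (subtree t a) x u.
Proof.
elim: t => //= l IHl y r IHr U; have [yl yr ul ur lr] := uniq_node U.
rewrite !mem_cat !inE; case: eqP => [->|/eqP xy] /=.
  by move=> _ at_ /negP[]; rewrite mem_cat inE.
case: (boolP (x \in inorder l)) => [xl _|xl /= xr] at_ an us.
  have xr := lr _ xl; rewrite (graft_notin u xr).
  case: (a =P y) at_ => /= [->|ay]; first by rewrite (negbTE xy) (graft_notin u xr).
  have -> : (a \in inorder (graft l x u)) = (a \in inorder l).
    have := inorder_graft u (pred1 a) ul xl.
    have /count_memPn -> := an; have /count_memPn -> : a \notin inorder u by apply/negP => /us; rewrite (negbTE an).
    by rewrite !addn0 -!has_pred1 !has_count => ->.
  case: (boolP (a \in inorder l)) => [al _|_ /= ar]; first exact: IHl.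
  rewrite [RHS]graft_notin //; apply/negP => /mem_subtree; exact/negP.
rewrite (graft_notin u xl).
case: (a =P y) at_ => /= [->|ay]; first by rewrite (negbTE xy) (graft_notin u xl).
case: (boolP (a \in inorder l)) => [al _|_ /= ar].
  rewrite [RHS]graft_notin //; apply/negP => /mem_subtree; exact/negP.
exact: IHr.
Qed.

Lemma eq_link_left f g s : {in s, f =1 g} -> link_left f s = link_left g s.
Proof.
elim: s => //= y s IH h; rewrite IH => [|z zs]; last by apply: h; rewrite inE zs orbT.
by rewrite h ?mem_head.
Qed.

Lemma eq_link_right f g s : {in s, f =1 g} -> link_right f s = link_right g s.
Proof.
elim: s => //= y s IH h; rewrite IH => [|z zs]; last by apply: h; rewrite inE zs orbT.
by rewrite h ?mem_head.
Qed.

Lemma spine_inorder b u : {subset side_spine b u <= inorder u}.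
Proof.
rewrite /side_spine; case: b; elim: u => //= l IHl y r IHr z; rewrite inE mem_cat inE.
  by case/orP => [->|/IHl->] //; rewrite orbT.
by case/orP => [->|/IHr->] //; rewrite !orbT.
Qed.

(** Writes an existing tree in the form that a rotation produces, so that [edges_link_left] counts
    its edges along the left chain. *)
Lemma link_left_spine u : uniq (inorder u) ->
  link_left (right_subtree u) (left_spine u) = u.
Proof.
elim: u => //= l IHl y r IHr U; have [yl yr ul ur lr] := uniq_node U.
rewrite -[in RHS](IHl ul); congr Node; last exact: (side_subtree_root false).
apply: eq_link_left => z /(@spine_inorder true) zl.
exact: (side_subtree_l false U zl).
Qed.

Lemma link_right_spine u : uniq (inorder u) ->
  link_right (left_subtree u) (right_spine u) = u.
Proof.
elim: u => //= l IHl y r IHr U; have [yl yr ul ur lr] := uniq_node U.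
rewrite -[in RHS](IHr ur); congr Node; first exact: (side_subtree_root true).
apply: eq_link_right => z /(@spine_inorder false) zl.
exact: (side_subtree_r true U zl).
Qed.

Lemma link_left_subtree t y : uniq (inorder t) ->
  link_left (right_subtree t) (left_spine (subtree t y)) = subtree t y.
Proof.
move=> U; rewrite -[in RHS](link_left_spine (subtree_uniq y U)).
apply: eq_link_left => z /(@spine_inorder true) zs; exact/esym/(side_subtree_sub false U zs).
Qed.

Lemma link_right_subtree t y : uniq (inorder t) ->
  link_right (left_subtree t) (right_spine (subtree t y)) = subtree t y.
Proof.
move=> U; rewrite -[in RHS](link_right_spine (subtree_uniq y U)).
apply: eq_link_right => z /(@spine_inorder false) zs; exact/esym/(side_subtree_sub true U zs).
Qed.

Lemma edges_subtree t y : {subset edges (subtree t y) <= edges t}.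
Proof.
elim: t => //= l IHl w r IHr e; case: ifP => //= _.
by case: ifP => _ => [/IHl|/IHr] h; rewrite !mem_cat h !orbT.
Qed.

Lemma links_spine b u : {subset links b (side_spine b u) <= edges u}.
Proof.
rewrite /side_spine; case: b; elim: u => //= l IHl y r IHr e; rewrite !mem_cat.
  by case/orP => [|/IHl->]; [case: (l) => //= ? ? ? -> | rewrite !orbT].
by case/orP => [|/IHr->]; [case: (r) => //= ? ? ? -> | ]; rewrite !orbT.
Qed.

Lemma spine_step b t y z w : uniq (inorder t) -> z \in side_spine b (subtree t y) ->
  (z, b, w) \in edges t -> w \in side_spine b (subtree t y).
Proof.
move=> U zs; have zi := spine_inorder zs.
rewrite edgesE // /side_child -(side_subtree_sub b U zi) -/(side_child b _ z) -edgesE ?subtree_uniq //.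
have := subtree_uniq y U; move: zs; move: (subtree t y) => u {U zi} zs U; move: U zs.
rewrite /side_spine.
case: b; elim: u => //= l IHl x r IHr U; have [xl xr ul ur lr] := uniq_node U;
  rewrite !inE => zs; rewrite !mem_cat => e.
  apply/orP; right; case/orP: zs => [/eqP zx|zl].
    move: e; rewrite -zx in xl xr *.
    case/or4P => [|/=||].
    + by case: (l) => //= ? ? ?; rewrite mem_seq1 => /eqP[->]; rewrite mem_head.
    + by case: (r) => //= ? ? ?; rewrite mem_seq1 => /eqP.
    + by move/edges_mem => /andP[]; rewrite (negbTE xl).
    + by move/edges_mem => /andP[]; rewrite (negbTE xr).
  have zl' := @spine_inorder true _ _ zl.
  apply: IHl => //; case/or4P: e => //.
  + by case: (l) zl' xl => //= ? ? ? zl' xl; rewrite mem_seq1 => /eqP[zx]; rewrite -zx zl' in xl.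
  + by case: (r) => //= ? ? ?; rewrite mem_seq1 => /eqP.
  + by move/edges_mem => /andP[zr]; rewrite (negbTE (lr _ zl')) in zr.
apply/orP; right; case/orP: zs => [/eqP zx|zr].
  move: e; rewrite -zx in xl xr *.
  case/or4P => [|/=||].
  + by case: (l) => //= ? ? ?; rewrite mem_seq1 => /eqP.
  + by case: (r) => //= ? ? ?; rewrite mem_seq1 => /eqP[->]; rewrite mem_head.
  + by move/edges_mem => /andP[]; rewrite (negbTE xl).
  + by move/edges_mem => /andP[]; rewrite (negbTE xr).
have zr' := @spine_inorder false _ _ zr.
apply: IHr => //; case/or4P: e => //.
+ by case: (l) => //= ? ? ?; rewrite mem_seq1 => /eqP.
+ by case: (r) zr' xr => //= ? ? ? zr' xr; rewrite mem_seq1 => /eqP[zx]; rewrite -zx zr' in xr.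
+ by move/edges_mem => /andP[zl]; rewrite (negbTE (lr _ zl)) in zr'.
Qed.

Lemma spine_last b u z d : (forall w, (z, b, w) \notin edges u) ->
  z \in side_spine b u -> z = last d (side_spine b u).
Proof.
move=> h zs; have: forall w, (z, b, w) \notin links b (side_spine b u).
  by move=> w; apply: contra (h w); apply: links_spine.
elim: (side_spine b u) d zs => // y s IH d; rewrite inE; case: s IH => [|w s] IH.
  by move=> /orP[/eqP|].
move=> zs lk; case: (z =P y) zs => [zy|_] /= zs.
  by have := lk w; rewrite /= zy inE eqxx.
by apply: IH => // v; apply: contra (lk v) => /=; rewrite inE => ->; rewrite orbT.
Qed.

(** Following edges on side [b] never leaves the chain of [y], and only the end of this chain lacks
    such an edge. The end of a chain can thus be located from a list of links known to be edges. *)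
Lemma spine_links b t y s : uniq (inorder t) -> y \in inorder t ->
  {subset links b (y :: s) <= edges t} ->
  (forall w, (last y s, b, w) \notin edges t) ->
  last y s = last y (side_spine b (subtree t y)).
Proof.
move=> U yt lk lst; apply: spine_last => [w|].
  by apply: contra (lst w); apply: edges_subtree.
have: y \in side_spine b (subtree t y).
  by rewrite subtree_node //; case: b {lk lst} => /=; rewrite mem_head.
have step z w := @spine_step b t y z w U.
move: (side_spine _ _) step => S step ys; elim: s y yt lk ys {lst} => //= z s IH y yt lk ys.
have e : (y, b, z) \in edges t by apply: lk; rewrite mem_head.
apply: IH; [by case/andP: (edges_mem e) | | exact: step ys e].
by move=> e' es; apply: lk; rewrite inE es orbT.
Qed.

Lemma count_le1_inj (S : eqType) (p : pred S) (s : seq S) (a b : S) : count p s <= 1 ->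
  a \in s -> b \in s -> p a -> p b -> a = b.
Proof.
move=> c as_ bs pa pb; have : a \in filter p s by rewrite mem_filter pa.
have : b \in filter p s by rewrite mem_filter pb.
by move: c; rewrite -size_filter; case: (filter p s) => [|z [|]] //= _; rewrite !inE => /eqP-> /eqP->.
Qed.

Lemma uniq_count_le1 (s : seq T) : (forall z, count_mem z s <= 1) -> uniq s.
Proof.
elim: s => //= y s IH h; rewrite IH => [|z]; last by have := h z; lia.
rewrite andbT -has_pred1 has_count; have := h y; rewrite eqxx; lia.
Qed.

Lemma edges_parent_inj t e e' : uniq (inorder t) -> e \in edges t -> e' \in edges t ->
  e.2 = e'.2 -> e = e'.
Proof.
move=> U et et' ee; apply: (count_le1_inj (p := fun f => e.2 == f.2) _ et et') => //;
  last by apply/eqP.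
apply: leq_trans (_ : count_mem e.2 (inorder t) <= 1); last first.
  by rewrite count_uniq_mem //; case: (_ \in _).
rewrite count_inorder [X in _ <= X + _](eq_count (a2 := fun f => e.2 == f.2)) ?leq_addr //.
Qed.

Lemma edges_slot_inj t e e' : uniq (inorder t) -> e \in edges t -> e' \in edges t ->
  e.1 = e'.1 -> e = e'.
Proof.
move=> U; case: e e' => [[y b] z] [[y' b'] z'] /= + + [yy bb].
by rewrite -yy -bb !edgesE // => /eqP-> /eqP[->].
Qed.

Lemma subtree_side b t y z : uniq (inorder t) -> z \in inorder (side_subtree b t y) ->
  subtree (side_subtree b t y) z = subtree t z.
Proof.
move=> U zs; have zi := mem_side_subtree zs.
have yt : y \in inorder t.
  by apply: contraLR zs => yt; rewrite side_subtree_notin.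
rewrite -(subtree_subtree U zi).
have := subtree_uniq y U; rewrite (subtree_node yt) => U'.
have [xl xr _ _ lr] := uniq_node U'; move: zs; rewrite /side_subtree /=.
case: eqP => [->|_]; first by case: (b); rewrite ?(negbTE xl) ?(negbTE xr).
case: b => zs; first by rewrite zs.
by case: ifP => // zl; have := lr _ zl; rewrite zs.
Qed.

Lemma side_child_subtree b t y z : uniq (inorder t) -> side_child b t y = Some z ->
  side_subtree b t y = subtree t z.
Proof.
move=> U h; rewrite -(subtree_side (b := b) (y := y)) ?subtree_root //.
by move: h; rewrite /side_child; case: side_subtree => //= ? ? ? [->]; rewrite mem_cat mem_head orbT.
Qed.

Lemma side_child_mem b t y z : uniq (inorder t) -> side_child b t y = Some z ->
  (y \in inorder t) && (z \in inorder t).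
Proof. by move=> U /eqP; rewrite -edgesE // => /edges_mem. Qed.

(** Below its root, the side subtree contains the parent edge of each of its nodes, and a node has
    only one parent edge in [t]. *)
Lemma edges_parent_in b t y z p b' : uniq (inorder t) ->
  z \in inorder (side_subtree b t y) -> (p, b', z) \in edges t ->
  (p = y /\ b' = b) \/ p \in inorder (side_subtree b t y).
Proof.
move=> U zs e; case: (side_child b t y =P Some z) => [h|h].
  left; have e' : (y, b, z) \in edges t by rewrite edgesE // h.
  by have [-> ->] := edges_parent_inj U e e' erefl.
right; have : has (fun f => f.2 == z) (edges (side_subtree b t y)).
  move: zs; rewrite has_count -has_pred1 has_count count_inorder.
  move: h; rewrite /side_child; case: root => [w|]; rewrite ?addn0 //=.
  by case: (w =P z) => [->//|]; rewrite addn0.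
case/hasP => -[[p' b2] z'] e2 /= /eqP zz; rewrite {}zz {z'} in e2.
have [p'i _] := andP (edges_mem e2).
have e3 : (p', b2, z) \in edges t.
  have yt : y \in inorder t by apply: contraLR zs => yt; rewrite side_subtree_notin.
  apply: (edges_subtree (y := y)); rewrite subtree_node //= !mem_cat.
  by case: (b) e2; rewrite /side_subtree => ->; rewrite !orbT.
by have [-> _] := edges_parent_inj U e e3 erefl.
Qed.

Lemma count_inorder_link_left (f : T -> btree T) s (Q : pred T) :
  count Q (inorder (link_left f s)) = \sum_(y <- s) (Q y + count Q (inorder (f y))).
Proof.
by elim: s => [|y s IH]; rewrite ?big_nil // big_cons /= count_cat /= IH; lia.
Qed.

Lemma count_links (Q : pred T) b y s : count (fun e => Q e.2) (links b (y :: s)) = count Q s.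
Proof. by elim: s y => //= z s IH y; rewrite -(IH z). Qed.

End Edges.

(** * Rotations in terms of edges *)

Section Labels.
Variable n : nat.
Notation T := 'I_n.
Implicit Types (t u l r : btree T) (x y z a : T) (s : seq T) (b : bool) (M : {set T}).
Implicit Types (P : pred (T * bool * T)).

Lemma lt_lab_trans : transitive (@lt_lab n).
Proof. by move=> y x z; apply: ltn_trans. Qed.

Lemma lt_lab_irr : irreflexive (@lt_lab n).
Proof. by move=> x; apply: ltnn. Qed.

Lemma enum_set_sorted (A : {set T}) : sorted (@lt_lab n) (enum A).
Proof.
rewrite {1}/enum_mem -enumT; apply: sorted_filter; first exact: lt_lab_trans.
have := iota_ltn_sorted 0 n; by rewrite -val_enum_ord sorted_map.
Qed.

Lemma enum_sorted_eq s (A : {set T}) : sorted (@lt_lab n) s -> s =i A -> enum A = s.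
Proof.
move=> ss sA; apply: irr_sorted_eq lt_lab_trans lt_lab_irr _ _ _ _ _ => // [|z].
  exact: enum_set_sorted.
by rewrite mem_enum sA.
Qed.

Lemma enum_setU1_min a (A : {set T}) : (forall z, z \in A -> a < z) ->
  enum (a |: A) = a :: enum A.
Proof.
move=> h; apply: enum_sorted_eq => [|z]; last by rewrite !inE mem_enum.
rewrite /= path_sortedE; last exact: lt_lab_trans.
by rewrite enum_set_sorted andbT; apply/allP => z; rewrite mem_enum => /h.
Qed.

Lemma enum_setU1_max a (A : {set T}) : (forall z, z \in A -> z < a) ->
  enum (a |: A) = rcons (enum A) a.
Proof.
move=> h; apply: enum_sorted_eq => [|z]; last by rewrite mem_rcons !inE mem_enum.
rewrite -cats1; have := enum_set_sorted A; case e : (enum A) => [|y s] //= ys.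
rewrite cat_path ys /= andbT; apply: h; by rewrite -mem_enum e mem_last.
Qed.

(** The order condition is local to the edges, so it can be checked on the edge multiset of a
    rotated tree. *)
Lemma increasing_edges t : (forall e, e \in edges t -> e.1.1 < e.2) -> increasing t.
Proof.
elim: t => //= l IHl y r IHr h.
have il : increasing l by apply: IHl => e el; apply: h; rewrite !mem_cat el !orbT.
have ir : increasing r by apply: IHr => e er; apply: h; rewrite !mem_cat er !orbT.
have rt u b : increasing u -> (forall e, e \in stem y b u -> e.1.1 < e.2) ->
    all (lt_lab y) (inorder u).
  case: u => //= l' z r' /and4P[zl zr _ _] /(_ (y, b, z)); rewrite mem_head /= => /(_ isT) yz.
  rewrite all_cat /= /lt_lab yz; apply/andP; split.
    by apply: sub_all zl => w; apply: ltn_trans.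
  by apply: sub_all zr => w; apply: ltn_trans.
rewrite il ir (rt l true) ?(rt r false) // => e es; apply: h; rewrite !mem_cat es ?orbT //.
Qed.

Lemma edges_increasing t e : increasing t -> e \in edges t -> e.1.1 < e.2.
Proof.
elim: t => //= l IHl y r IHr /and4P[yl yr il ir]; rewrite !mem_cat.
case/or4P => [||/IHl->|/IHr->] //.
  case: (l) yl => //= ? ? ?; rewrite all_cat /= => /and3P[_ h _].
  by rewrite mem_seq1 => /eqP->.
case: (r) yr => //= ? ? ?; rewrite all_cat /= => /and3P[_ h _].
by rewrite mem_seq1 => /eqP->.
Qed.

Lemma increasing_subtree t y : increasing t -> increasing (subtree t y).
Proof.
elim: t => //= l IHl w r IHr h; case/and4P: (h) => _ _ il ir.
by case: eqP => // _; case: ifP => _; [apply: IHl | apply: IHr].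
Qed.

Lemma increasing_side b t y : increasing t -> increasing (side_subtree b t y).
Proof.
move=> /(increasing_subtree y); rewrite /side_subtree /left_subtree /right_subtree.
by case: subtree => [|l w r]; case: b => //= /and4P[].
Qed.

Lemma side_subtree_lt b t y z : increasing t -> z \in inorder (side_subtree b t y) -> y < z.
Proof.
move=> i zs; have yt : y \in inorder t.
  by apply: contraLR zs => yt; rewrite side_subtree_notin.
have := increasing_subtree y i; rewrite subtree_node //= => /and4P[/allP yl /allP yr _ _].
by case: b zs => [/yl|/yr].
Qed.

Lemma subtree_le t y z : increasing t -> y \in inorder t -> z \in inorder (subtree t y) -> y <= z.
Proof.
move=> i yt; rewrite subtree_node //= mem_cat inE => /or3P[zs|/eqP->|zs] //.
  by apply: ltnW; apply: (@side_subtree_lt true t).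
by apply: ltnW; apply: (@side_subtree_lt false t).
Qed.

Lemma spine_sorted b t : increasing t -> sorted (@lt_lab n) (side_spine b t).
Proof.
rewrite /side_spine; case: b; elim: t => //= l IHl y r IHr /and4P[/allP yl /allP yr il ir];
  rewrite path_sortedE ?IHl ?IHr ?andbT //; try exact: lt_lab_trans.
  by apply/allP => z /(@spine_inorder _ true); apply: yl.
by apply/allP => z /(@spine_inorder _ false); apply: yr.
Qed.

Lemma sorted_uniq_lab s : sorted (@lt_lab n) s -> uniq s.
Proof. by apply: sorted_uniq; [apply: lt_lab_trans | apply: lt_lab_irr]. Qed.

(** * The edges of a rotated tree *)

Section Rotate.
Variables (t : btree T) (x x0 a : T) (M : {set T}).
Hypotheses (U : uniq (inorder t)) (I : increasing t).
(** The admissibility of [n_a] enters the computation of the edges through its consequence [ha],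
    which [valid_na_sub] supplies. *)
Hypotheses (hx : left_child t x0 = Some x) (ha : x \in inorder (left_subtree t a)).
Hypothesis (hM : M \subset left_chain t x).

Local Notation C := (left_chain t x).
Local Notation Qx := (right_chain t x).
Local Notation Qa := (right_chain t a).

Lemma rot_nodes : [/\ x0 \in inorder t, x \in inorder t & a \in inorder t].
Proof.
have /andP[-> ->] := side_child_mem (b := true) U hx; split=> //.
by apply: contraLR ha => at_; have -> : left_subtree t a = Leaf := side_subtree_notin true at_.
Qed.

Lemma rot_left_spine : left_spine (subtree t x0) = [:: x0, x & C].
Proof.
have [x0t xt at_] := rot_nodes.
have e : left_subtree t x0 = subtree t x := side_child_subtree (b := true) U hx.
rewrite (subtree_node x0t) /= e.
by rewrite (subtree_node xt).
Qed.

Lemma rot_sorted : sorted (@lt_lab n) [:: x0, x & C].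
Proof. by rewrite -rot_left_spine; apply: (spine_sorted true); apply: increasing_subtree. Qed.

Lemma rot_chain_gt z : z \in C -> x0 < x < z.
Proof.
have /= /andP[x0x] := rot_sorted; rewrite path_sortedE; last exact: lt_lab_trans.
by case/andP => /allP h _ /h xz; apply/andP.
Qed.

Lemma enum_rot_T1 : enum (x |: M) = x :: enum M.
Proof.
apply: enum_setU1_min => z zM; have := subsetP hM _ zM.
by case/rot_chain_gt/andP.
Qed.

Lemma enum_rot_T2 : enum (x0 |: ([set m in C] :\: M)) = x0 :: enum ([set m in C] :\: M).
Proof.
apply: enum_setU1_min => z; rewrite !inE => /andP[_ /rot_chain_gt/andP[h1 h2]].
exact: ltn_trans h2.
Qed.

Lemma perm_rot_split : perm_eq (enum M ++ enum ([set m in C] :\: M)) C.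
Proof.
apply: uniq_perm.
- rewrite cat_uniq !enum_uniq andbT; apply/hasPn => z; rewrite !mem_enum !inE.
  by case/andP.
- by have /sorted_uniq_lab /= /and3P[] := rot_sorted.
move=> z; rewrite mem_cat !mem_enum !inE; case: (boolP (z \in M)) => //= zM.
by rewrite (subsetP hM).
Qed.

Lemma rot_na_cases : a = x0 \/ a != x0 /\ x0 \in inorder (left_subtree t a).
Proof.
have := @edges_parent_in _ true t a x x0 true U ha.
rewrite edgesE // /side_child /= -/(left_child t x0) hx eqxx => /(_ isT)[[->]|h]; first by left.
case: (a =P x0) => [->|]; by [left | right].
Qed.

Lemma rot_na_lt : a < x. Proof. exact: (side_subtree_lt (b := true) I ha). Qed.

Local Notation T1 := (rot_T1 t x M).
Local Notation T2 := (rot_T2 t x x0 M).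
Local Notation U2 :=
  (link_left (right_subtree t) (enum (x0 |: ([set m in C] :\: M)))).

Lemma rot_T1E : exists l, T1 = Node l x (right_subtree t x).
Proof. by rewrite /rot_T1 enum_rot_T1; eexists. Qed.

Lemma rot_T2_graftE : exists l, U2 = Node l x0 (right_subtree t x0).
Proof. by rewrite enum_rot_T2; eexists. Qed.

Lemma rot_T2_graft_root : root U2 = Some x0. Proof. by have [l ->] := rot_T2_graftE. Qed.

(** The two linked lists split the left chain starting at [x0], and every node of it keeps its right
    subtree. That [T1] and [T2] have distinct and disjoint labels is read off from this identity. *)
Lemma rot_T12_inorder Q : count Q (inorder T1) + count Q (inorder T2) = count Q (inorder t).
Proof.
have [x0t xt at_] := rot_nodes.
have := inorder_graft U2 Q U x0t; rewrite -/T2.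
rewrite -{1}(link_left_subtree x0 U) rot_left_spine /rot_T1.
rewrite !count_inorder_link_left enum_rot_T1 enum_rot_T2 !big_cons.
rewrite -(perm_big _ perm_rot_split) big_cat /=; lia.
Qed.

Lemma rot_T1_uniq : uniq (inorder T1).
Proof.
apply: uniq_count_le1 => z; have := rot_T12_inorder (pred1 z).
by have := count_uniq_mem z U; case: (z \in inorder t) => /=; lia.
Qed.

Lemma rot_T2_uniq : uniq (inorder T2).
Proof.
apply: uniq_count_le1 => z; have := rot_T12_inorder (pred1 z).
by have := count_uniq_mem z U; case: (z \in inorder t) => /=; lia.
Qed.

Lemma rot_T12_disjoint z : z \in inorder T2 -> z \notin inorder T1.
Proof.
rewrite -!has_pred1 !has_count; have := rot_T12_inorder (pred1 z).
by have := count_uniq_mem z U; case: (z \in inorder t) => /=; lia.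
Qed.

Lemma rot_T1_right_chain : right_chain T1 x = Qx.
Proof.
have [x0t xt at_] := rot_nodes; rewrite /right_chain (subtree_node xt).
by have [l ->] := rot_T1E; rewrite subtree_root.
Qed.

Lemma rot_T2_graft_sub : {subset inorder U2 <= inorder (subtree t x0)}.
Proof.
move=> z; rewrite -{1}(link_left_subtree x0 U) rot_left_spine -!has_pred1 !has_count.
rewrite !count_inorder_link_left enum_rot_T2 !big_cons.
rewrite -(perm_big _ perm_rot_split) big_cat /=; lia.
Qed.

(** Grafting at [x0] does not touch the right chain of [a]: either [a] is [x0], whose right subtree
    is kept, or the graft takes place inside the left subtree of [a]. *)
Lemma rot_T2_right_chain : a \in inorder T2 /\ right_spine (subtree T2 a) = Qa.
Proof.
have [x0t xt at_] := rot_nodes; rewrite /right_chain (subtree_node at_) /rot_T2 /=.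
case: rot_na_cases => [->|[ax0 x0l]].
  have e := subtree_graft_same U x0t rot_T2_graft_root.
  split; last by rewrite e; have [l ->] := rot_T2_graftE.
  apply: contraTT isT => h; move: e; rewrite (subtree_notin h).
  by have [l ->] := rot_T2_graftE.
have lt : a < x0 by apply: (side_subtree_lt (b := true) I).
have an : a \notin inorder (subtree t x0).
  by apply/negP => /(subtree_le I x0t); rewrite leqNgt lt.
have e := subtree_graft U x0t at_ an rot_T2_graft_sub.
have eN : subtree (graft t x0 U2) a =
    Node (graft (left_subtree t a) x0 U2) a (right_subtree t a).
  rewrite e (subtree_node at_) /= eq_sym (negbTE ax0); congr Node.
  apply: graft_notin; have := subtree_uniq a U; rewrite subtree_node //.
  by case/uniq_node => _ _ _ _; apply.
split; last by rewrite eN.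
by apply: contraTT isT => h; move: eN; rewrite (subtree_notin h).
Qed.

Local Notation W := (enum ([set m in Qx] :|: [set m in Qa])).

Lemma right_chain_node_le z : z \in Qx -> x <= z.
Proof.
have [x0t xt at_] := rot_nodes.
by move=> h; apply: (subtree_le I xt); apply: (@spine_inorder _ false).
Qed.

Lemma right_chain_na_le z : z \in Qa -> a <= z.
Proof.
have [x0t xt at_] := rot_nodes.
by move=> h; apply: (subtree_le I at_); apply: (@spine_inorder _ false).
Qed.

Lemma right_chain_head u y : y \in inorder u -> right_chain u y = y :: behead (right_chain u y).
Proof. by rewrite /right_chain => /subtree_node->. Qed.

(** Both chains increase and [a < x], so [a] is the smallest node of the merged chain; hence this
    chain can be grafted at [a] without disturbing the edge above. *)
Lemma rot_merged_head : W = a :: behead W.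
Proof.
have [x0t xt at_] := rot_nodes.
have aW : a \in W by rewrite mem_enum !inE (right_chain_head at_) mem_head orbT.
have : all (fun z : T => a <= z) W.
  apply/allP => z; rewrite mem_enum !inE => /orP[/right_chain_node_le|/right_chain_na_le] //.
  by apply: leq_trans; apply: ltnW rot_na_lt.
have := enum_set_sorted ([set m in Qx] :|: [set m in Qa]).
case: W aW => //= z s; rewrite inE => /orP[/eqP->//|zs].
rewrite path_sortedE; last exact: lt_lab_trans.
case/andP => /allP/(_ _ zs) za _ /andP[az _]; move: za; rewrite /lt_lab.
by rewrite ltnNge az.
Qed.

Lemma right_chain_in_T1 z : z \in Qx -> z \in inorder T1.
Proof. by rewrite -rot_T1_right_chain => /(@spine_inorder _ false)/mem_subtree. Qed.

Lemma right_chain_in_T2 z : z \in Qa -> z \in inorder T2.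
Proof. by have [_ <-] := rot_T2_right_chain => /(@spine_inorder _ false)/mem_subtree. Qed.

Lemma perm_rot_merged : perm_eq W (Qx ++ Qa).
Proof.
have uc u y : increasing u -> uniq (right_chain u y).
  by move=> i; apply: sorted_uniq_lab; apply: (spine_sorted false); apply: increasing_subtree.
apply: uniq_perm; first exact: enum_uniq.
  rewrite cat_uniq !uc //= andbT; apply/hasPn => z /right_chain_in_T2/rot_T12_disjoint.
  by apply: contra => /right_chain_in_T1.
by move=> z; rewrite mem_enum mem_cat !inE.
Qed.

Lemma rotate_root : root (rotate t x x0 a M) = root t.
Proof.
rewrite /rotate rot_T1_right_chain {2}/right_chain; have [_ ->] := rot_T2_right_chain.
rewrite root_graft; last by rewrite rot_merged_head.
by rewrite /rot_T2 root_graft // rot_T2_graft_root.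
Qed.

(** The lost links stand on the left and the gained ones on the right, which avoids subtraction. All
    subtrees hanging off the chains are kept, so their contributions cancel. As [P] is arbitrary,
    this is an equality of multisets. *)
Lemma rotate_edges P :
  count P (edges (rotate t x x0 a M)) + count P (links true [:: x0, x & C])
    + count P (links false Qx) + count P (links false Qa)
  = count P (edges t) + count P (links true (x :: enum M))
    + count P (links true (x0 :: enum ([set m in C] :\: M)))
    + count P (links false W).
Proof.
have [x0t xt at_] := rot_nodes; have [a2 sp2] := rot_T2_right_chain.
set k1 := count P (links true _); set k2 := count P (links true _).
set k3 := count P (links true _).
rewrite /rotate rot_T1_right_chain {2}/right_chain sp2.
set F := fun y => if _ then _ else _.
have rU : root (link_right F W) = Some a by rewrite rot_merged_head.
have := edges_graft P rot_T2_uniq a2 rU.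
rewrite -(link_right_subtree a rot_T2_uniq) sp2 !edges_link_right.
rewrite (perm_big _ perm_rot_merged) big_cat /=.
have e1 : \sum_(y <- Qx) (count P (stem y true (F y)) + count P (edges (F y))) =
   \sum_(y <- Qx) (count P (stem y true (left_subtree T1 y)) + count P (edges (left_subtree T1 y))).
  by apply: eq_big_seq => z /right_chain_in_T1 zT; rewrite /F zT.
have e2 : \sum_(y <- Qa) (count P (stem y true (F y)) + count P (edges (F y))) =
   \sum_(y <- Qa) (count P (stem y true (left_subtree T2 y)) + count P (edges (left_subtree T2 y))).
  by apply: eq_big_seq => z /right_chain_in_T2/rot_T12_disjoint zT; rewrite /F (negbTE zT).
(* [T1] has root [x], so it is the right chain of [x] with its left subtrees attached. *)
have e3 : count P (edges T1) = count P (links false Qx) +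
   \sum_(y <- Qx) (count P (stem y true (left_subtree T1 y)) + count P (edges (left_subtree T1 y))).
  rewrite -edges_link_right -rot_T1_right_chain (link_right_subtree x rot_T1_uniq).
  by have [l ->] := rot_T1E; rewrite subtree_root.
have := edges_graft P U x0t rot_T2_graft_root; rewrite -/T2.
rewrite -{1}(link_left_subtree x0 U) rot_left_spine.
move: e3; rewrite e1 e2 {e1 e2}; set S1 := bigop.body _ _ _; set S2 := bigop.body _ (right_chain t a) _.
move: S1 S2 => S1 S2; rewrite /rot_T1 !edges_link_left enum_rot_T1 enum_rot_T2 !big_cons.
rewrite -(perm_big _ perm_rot_split) big_cat -/k1 -/k2 -/k3 /=.
move: k1 k2 k3 => k1 k2 k3; count_lia.
Qed.

(** The root is unchanged, and the lower ends of the links of a chain are all its nodes but the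
    first. Splitting and merging preserve these nodes: [x] is an end lost from the split left chain
    and gained in the merged right chain. *)
Lemma rotate_inorder : perm_eq (inorder (rotate t x x0 a M)) (inorder t).
Proof.
have [x0t xt at_] := rot_nodes.
apply/permP => Q; rewrite !count_inorder rotate_root; congr addn.
have := rotate_edges (fun e => Q e.2); have /permP/(_ Q) := perm_rot_merged.
rewrite rot_merged_head (right_chain_head xt) (right_chain_head at_) !count_links /= !count_cat /=.
have /permP/(_ Q) := perm_rot_split; rewrite count_cat; count_lia.
Qed.

Lemma rotate_uniq : uniq (inorder (rotate t x x0 a M)).
Proof. by rewrite (perm_uniq rotate_inorder). Qed.

Lemma links_sorted b s e : sorted (@lt_lab n) s -> e \in links b s -> e.1.1 < e.2.
Proof.
elim: s => //= y [|z s] IH //= /andP[yz zs]; rewrite inE => /orP[/eqP->//|]; exact: IH.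
Qed.

(** Each edge of the rotated tree is an edge of [t] or a link of one of the three new lists, which
    are sorted. *)
Lemma rotate_increasing : increasing (rotate t x x0 a M).
Proof.
apply: increasing_edges => e er.
have := rotate_edges (pred1 e).
have : 0 < count (pred1 e) (edges (rotate t x x0 a M)) by rewrite -has_count has_pred1.
case: (posnP (count (pred1 e) (edges t))) => [->|]; last first.
  by rewrite -has_count has_pred1 => /(edges_increasing I).
have lk b s : sorted (@lt_lab n) s -> ~~ (e.1.1 < e.2) -> count (pred1 e) (links b s) = 0.
  move=> ss h; apply/eqP; rewrite -leqn0 leqNgt -has_count has_pred1; apply: contra h.
  exact: links_sorted.
case: (boolP (e.1.1 < e.2)) => // h.
rewrite (lk _ (x :: _)) //; last by rewrite -enum_rot_T1 enum_set_sorted.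
rewrite (lk _ (x0 :: enum _)) //; last by rewrite -enum_rot_T2 enum_set_sorted.
rewrite (lk _ W) //; last exact: enum_set_sorted.
count_lia.
Qed.

End Rotate.
End Labels.

(** * Paths to the root *)

Section Paths.
Variable T : eqType.
Implicit Types (t u l r : btree T) (x y z : T).

Lemma root_path_inorder t x : {subset root_path t x <= inorder t}.
Proof.
elim: t => //= l IHl y r IHr z; rewrite mem_cat inE.
case: ifP => _; first by rewrite inE => ->; rewrite orbT.
case: ifP => _; first by rewrite inE => /orP[->|/IHl->] //; rewrite orbT.
by case: ifP => _; rewrite // inE => /orP[->|/IHr->]; rewrite !orbT.
Qed.

Lemma root_path_node_l l y r x : uniq (inorder (Node l y r)) -> x \in inorder l ->
  root_path (Node l y r) x = y :: root_path l x.
Proof.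
move=> /uniq_node[yl _ _ _ _] xl /=; rewrite xl.
by case: eqP => // xy; rewrite xy (negbTE yl) in xl.
Qed.

Lemma root_path_node_r l y r x : uniq (inorder (Node l y r)) -> x \in inorder r ->
  root_path (Node l y r) x = y :: root_path r x.
Proof.
move=> /uniq_node[_ yr _ _ lr] xr /=; rewrite xr.
case: eqP => [xy|_]; first by rewrite xy (negbTE yr) in xr.
by case: ifP => // xl; have := lr _ xl; rewrite xr.
Qed.

Lemma root_path_subtree t c x : uniq (inorder t) -> c \in root_path t x ->
  x \in inorder (subtree t c).
Proof.
elim: t => // l IHl y r IHr U; have [yl yr ul ur lr] := uniq_node U.
case: (c =P y) => [->|/eqP cy] cp.
  rewrite /= eqxx; move: cp => /=; rewrite mem_cat inE; case: (x =P y) => // _; rewrite ?orbT //.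
  by case: ifP => // _; case: ifP => //; rewrite orbT.
move: cp; rewrite /= (negbTE cy); case: (x =P y) => _; first by rewrite inE (negbTE cy).
case: ifP => [xl|_].
  by rewrite inE (negbTE cy) /= => cl; rewrite (root_path_inorder cl); apply: IHl.
case: ifP => // xr; rewrite inE (negbTE cy) /= => cl.
case: ifP => [cl'|_]; last exact: IHr.
by have := lr _ cl'; rewrite (root_path_inorder cl).
Qed.

Lemma root_in t x : root t = Some x -> x \in inorder t.
Proof. by case: t => //= l y r [->]; rewrite mem_cat mem_head orbT. Qed.

Lemma root_path_root t x z : root t = Some z -> x \in inorder t -> z \in root_path t x.
Proof.
case: t => //= l y r [->]; rewrite mem_cat inE.
case: eqP => _; first by rewrite mem_head.
by case: ifP => _; rewrite ?mem_head //= => ->; rewrite mem_head.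
Qed.

End Paths.

(** * Covers between trees on an initial set of labels *)

Section Cover.
Variable n : nat.
Notation T := 'I_n.
Implicit Types (t u l r L : btree T) (x y z a : T) (s : seq T) (b : bool) (M : {set T}).

(** A labeled tree on the [k] smallest labels. It stays in [btree 'I_n], so that removing the
    largest label does not change the type. *)
Definition good k t : bool :=
  [&& increasing t, uniq (inorder t) & [forall p : T, (p \in inorder t) == (p < k)]].

(** This is [is_rotation] on raw trees, which also applies to trees with fewer than [n] labels. *)
Definition cover t t' : bool :=
  [exists x : T, exists x0 : T, exists a : T, exists M : {set T},
    [&& left_child t x0 == Some x, valid_na t x a, M \subset left_chain t x
      & t' == rotate t x x0 a M]].

Lemma coverP t t' : reflect
  (exists x x0 a M, [/\ left_child t x0 = Some x, valid_na t x a,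
     M \subset left_chain t x & t' = rotate t x x0 a M]) (cover t t').
Proof.
apply: (iffP existsP) => [[x /existsP[x0 /existsP[a /existsP[M /and4P[]]]]]|[x [x0 [a [M []]]]]].
  by move=> /eqP h1 h2 h3 /eqP h4; exists x, x0, a, M.
move=> h1 h2 h3 h4; exists x; apply/existsP; exists x0; apply/existsP; exists a.
by apply/existsP; exists M; rewrite h1 h2 h3 h4 !eqxx.
Qed.

Lemma goodP k t : reflect
  [/\ increasing t, uniq (inorder t) & forall p : T, (p \in inorder t) = (p < k)]
  (good k t).
Proof.
apply: (iffP and3P) => -[i u h]; split=> //; first by move=> p; apply/eqP/(forallP h).
by apply/forallP => p; rewrite h.
Qed.

Lemma left_ancestorsE t x m : (m \in left_ancestors t x) =
  [&& m \in root_path t x, m != x & [exists c in path_set t x, left_child t m == Some c]].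
Proof. by rewrite /left_ancestors !inE; case: (m == x); rewrite ?andbF. Qed.

Lemma left_ancestor_sub t x a : uniq (inorder t) -> a \in left_ancestors t x ->
  x \in inorder (left_subtree t a).
Proof.
move=> U; rewrite left_ancestorsE => /and3P[_ _ /existsP[c /andP[cp /eqP h]]].
have -> : left_subtree t a = subtree t c := side_child_subtree (b := true) U h.
by apply: root_path_subtree => //; rewrite inE in cp.
Qed.

Lemma valid_na_ancestor t x a : valid_na t x a -> a \in left_ancestors t x.
Proof.
rewrite /valid_na; case: smaller_right_to => // y _ /existsP[c /and3P[_ _]].
by rewrite inE => /andP[].
Qed.

Lemma valid_na_sub t x a : uniq (inorder t) -> valid_na t x a ->
  x \in inorder (left_subtree t a).
Proof. by move=> U /valid_na_ancestor/(left_ancestor_sub U). Qed.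

Lemma rotate_good k t x x0 a M : good k t -> left_child t x0 = Some x ->
  x \in inorder (left_subtree t a) -> M \subset left_chain t x ->
  good k (rotate t x x0 a M).
Proof.
move=> /goodP[i u h] hx ha hM; apply/goodP; split.
- exact: rotate_increasing.
- exact: rotate_uniq.
by move=> p; rewrite (perm_mem (rotate_inorder u i hx ha hM)).
Qed.

Lemma cover_good k t t' : good k t -> cover t t' -> good k t'.
Proof.
move=> g /coverP[x [x0 [a [M [h1 h2 h3 ->]]]]].
by apply: (rotate_good g h1 _ h3); apply: valid_na_sub h2; case/goodP: g.
Qed.

Definition rank t := count (fun e => ~~ e.1.2) (edges t).

Lemma count_links_side b b' s :
  count (fun e => e.1.2 == b) (@links T b' s) = (b' == b) * (size s).-1.
Proof.
have [->|bb] := eqVneq b' b.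
  rewrite mul1n -(size_links b) -[RHS]count_predT; apply: eq_in_count => e.
  by move/links_side ->; rewrite eqxx.
rewrite mul0n; apply/eqP; rewrite -leqn0 leqNgt -has_count; apply/hasPn => e.
by move/links_side->.
Qed.

(** Two nonempty right chains with [p] and [q] nodes have [p + q - 2] links, and their merger has
    [p + q - 1]. Splitting the left chain affects left edges only. *)
Lemma cover_rank k t t' : good k t -> cover t t' -> rank t' = (rank t).+1.
Proof.
case/goodP => i u h /coverP[x [x0 [a [M [h1 h2 h3 ->]]]]].
have h2' := valid_na_sub u h2; have [x0t xt at_] := rot_nodes u h1 h2'.
have := rotate_edges u i h1 h2' h3 (fun e => e.1.2 == false).
rewrite !count_links_side /= !mul0n !mul1n (perm_size (perm_rot_merged u i h1 h2' h3)).
rewrite size_cat (right_chain_head xt) (right_chain_head at_) /= /rank.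
do 2!(rewrite [count (fun e => ~~ _) _](eq_count (a2 := fun e => e.1.2 == false));
  last by move=> e /=; case: (e.1.2)).
count_lia.
Qed.

(** The root carries the smallest label, so on a given label set the edges alone determine the
    tree. *)
Lemma good_root k t t' : good k t -> good k t' -> root t = root t'.
Proof.
move=> /goodP[i _ h] /goodP[i' _ h'].
have rm u : increasing u -> forall z, root u = Some z -> forall y, y \in inorder u -> z <= y.
  move=> iu z e y yu; apply: (subtree_le iu); first by apply: root_in.
  by rewrite subtree_root.
case e : (root t) => [z|]; case e' : (root t') => [z'|] //.
- congr Some; apply/val_inj/anti_leq.
  by rewrite (rm _ i _ e) ?(rm _ i' _ e') //; [rewrite h' -h root_in | rewrite h -h' root_in].
- have : z \in inorder t' by rewrite h' -h root_in.
  by case: (t') e'.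
have : z' \in inorder t by rewrite h -h' root_in.
by case: (t) e.
Qed.

Lemma good_ext k t t' : good k t -> good k t' -> perm_eq (edges t) (edges t') -> t = t'.
Proof.
move=> g g'; have r := good_root g g'; case/goodP: g => _ u _; case/goodP: g' => _ u' _.
exact: tree_ext.
Qed.

End Cover.

(** * Removing the largest label *)

Section Del.
Variable n : nat.
Notation T := 'I_n.
Variable N : T.
Implicit Types (t u l r L : btree T) (x y z a : T) (s : seq T) (b : bool) (M : {set T}).

(** The whole subtree at [N] is cut off; when [N] bounds the labels of an increasing tree it is a
    leaf, and only [N] disappears. *)
Fixpoint del t : btree T :=
  if t is Node l y r then if y == N then Leaf else Node (del l) y (del r) else Leaf.

(** [N] may be absent from [t], so the condition passes to subtrees. *)
Definition max_label t := increasing t && all (fun z : T => z <= N) (inorder t).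

Lemma max_label_node l y r : max_label (Node l y r) ->
  [/\ max_label l, max_label r & y = N -> l = Leaf /\ r = Leaf].
Proof.
rewrite /max_label /= all_cat /= => /andP[/and4P[/allP yl /allP yr -> ->] /and3P[al yN ar]].
rewrite al ar; split=> // e; subst y; split.
  case: (l) al yl => // l' z r' /= /allP hl /(_ z); rewrite mem_cat mem_head orbT => /(_ isT).
  by have := hl z; rewrite mem_cat mem_head orbT /lt_lab => /(_ isT); rewrite leqNgt => /negbTE->.
case: (r) ar yr => // l' z r' /= /allP hr /(_ z); rewrite mem_cat mem_head orbT => /(_ isT).
by have := hr z; rewrite mem_cat mem_head orbT /lt_lab => /(_ isT); rewrite leqNgt => /negbTE->.
Qed.

Lemma inorder_del t : max_label t -> inorder (del t) = filter (predC1 N) (inorder t).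
Proof.
elim: t => //= l IHl y r IHr /max_label_node[hl hr h].
rewrite filter_cat /= -IHl // -IHr //; case: eqP => [e|//].
by have [-> ->] := h e.
Qed.

Lemma mem_del t z : max_label t -> (z \in inorder (del t)) = (z != N) && (z \in inorder t).
Proof. by move=> h; rewrite inorder_del // mem_filter. Qed.

Lemma max_label_side b t y : max_label t -> max_label (side_subtree b t y).
Proof.
move=> h; have i : increasing (side_subtree b t y) by apply: increasing_side; case/andP: h.
rewrite /max_label i; case/andP: h => _ /allP h; apply/allP => z /mem_side_subtree/mem_subtree.
exact: h.
Qed.

Lemma side_subtree_max b t : max_label t -> side_subtree b t N = Leaf.
Proof.
move=> /andP[i /allP h]; case e : (side_subtree b t N) => [//|l z r].
have zs : z \in inorder (side_subtree b t N) by rewrite e /= mem_cat mem_head orbT.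
have := side_subtree_lt i zs; rewrite ltnNge h //.
exact: mem_subtree (mem_side_subtree zs).
Qed.

Lemma subtree_del t y : max_label t -> y != N -> subtree (del t) y = del (subtree t y).
Proof.
move=> + yN; elim: t => //= l IHl w r IHr /max_label_node[hl hr h].
case: (w =P N) => [wN|/eqP wN] /=.
  have [-> ->] := h wN; rewrite /= wN (negbTE yN) //.
case: (y =P w) => [yw|yw] /=; first by rewrite (negbTE wN).
by rewrite mem_del // yN /=; case: ifP => _; [apply: IHl | apply: IHr].
Qed.

Lemma side_subtree_del b t y : max_label t -> y != N ->
  side_subtree b (del t) y = del (side_subtree b t y).
Proof.
move=> h yN; rewrite /side_subtree /left_subtree /right_subtree subtree_del //.
case: (boolP (y \in inorder t)) => [yt|yt]; last by rewrite subtree_notin //; case: b.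
by rewrite (subtree_node yt) /= (negbTE yN); case: b.
Qed.

Lemma root_del t : root t != Some N -> root (del t) = root t.
Proof. by case: t => //= l y r; case: (y =P N) => [->|//]; rewrite eqxx. Qed.

Lemma side_child_del b t y z : max_label t -> y != N -> z != N ->
  (side_child b (del t) y == Some z) = (side_child b t y == Some z).
Proof.
move=> h yN zN; rewrite /side_child side_subtree_del //.
by case: side_subtree => //= l w r; case: (w =P N) => [->|//]; rewrite /= [RHS]eq_sym (inj_eq Some_inj) (negbTE zN).
Qed.

Lemma root_path_del t x : max_label t -> x != N -> root_path (del t) x = root_path t x.
Proof.
move=> + xN; elim: t => //= l IHl w r IHr /max_label_node[hl hr h].
case: (w =P N) => [wN|_] /=; first by have [-> ->] := h wN; rewrite wN (negbTE xN).
by rewrite IHl // IHr // !mem_del // xN.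
Qed.

Lemma spine_del b t : max_label t ->
  side_spine b (del t) = filter (predC1 N) (side_spine b t).
Proof.
rewrite /side_spine; case: b; elim: t => //= l IHl w r IHr /max_label_node[hl hr h].
  by case: (w =P N) => [wN|_] /=; [have [-> _] := h wN | rewrite IHl].
by case: (w =P N) => [wN|_] /=; [have [_ ->] := h wN | rewrite IHr].
Qed.

Lemma chain_del b t x : max_label t -> x != N ->
  side_spine b (subtree (del t) x) = filter (predC1 N) (side_spine b (subtree t x)).
Proof.
move=> h xN; rewrite subtree_del // spine_del //.
case/andP: h => i /allP h; rewrite /max_label increasing_subtree //.
by apply/allP => z /mem_subtree; apply: h.
Qed.

Lemma del_notin t : N \notin inorder t -> del t = t.
Proof.
elim: t => //= l IHl z r IHr; rewrite mem_cat inE !negb_or => /and3P[? Nz ?].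
by rewrite eq_sym (negbTE Nz) IHl // IHr.
Qed.

Lemma increasing_del t : max_label t -> increasing (del t).
Proof.
elim: t => //= l IHl w r IHr /[dup] m /max_label_node[hl hr h].
case: (w =P N) => //= _; rewrite IHl // IHr // !inorder_del // andbT.
case/andP: m => /and4P[wl wr _ _] _; rewrite !all_filter.
by rewrite (sub_all _ wl) ?(sub_all _ wr) // => z h' /=; rewrite h' implybT.
Qed.

(** A leaf carries only the edge from its parent; the root is excluded because it has none. *)
Lemma edges_del t : max_label t -> N \in inorder t -> uniq (inorder t) ->
  root t != Some N -> exists q b, perm_eq (edges t) ((q, b, N) :: edges (del t)).
Proof.
elim: t => // l IHl y r IHr m /= + U; have [hl hr h] := max_label_node m.
have [yl yr ul ur lr] := uniq_node U.
rewrite mem_cat inE => Nt yN; rewrite (_ : y == N = false); last by apply: contraNF yN => /eqP->.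
have /negbTE Ny : N != y by apply: contraNN yN => /eqP->.
rewrite Ny /= in Nt; case/orP: Nt => Nu.
  have rN := lr _ Nu; rewrite (del_notin rN).
  case: (root l =P Some N) => [rl|/eqP rl].
    exists y, true; case: (l) rl hl => //= l' z r' [->] /max_label_node[_ _ /(_ erefl)[-> ->]].
    by rewrite eqxx.
  have [q [b e]] := IHl hl Nu ul rl; exists q, b; apply/permP => P; have /permP/(_ P) := e.
  by rewrite /= !count_cat (stem_root _ _ (root_del rl)) /=; count_lia.
have lN : N \notin inorder l by apply/negP => /lr; rewrite Nu.
rewrite (del_notin lN); case: (root r =P Some N) => [rl|/eqP rl].
  exists y, false; case: (r) rl hr => //= l' z r' [->] /max_label_node[_ _ /(_ erefl)[-> ->]].
  rewrite eqxx /= !cats0; apply/permP => P; rewrite /= !count_cat /=; count_lia.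
have [q [b e]] := IHr hr Nu ur rl; exists q, b; apply/permP => P; have /permP/(_ P) := e.
by rewrite /= !count_cat (stem_root _ _ (root_del rl)) /=; count_lia.
Qed.

Lemma root_path_max t x : max_label t -> uniq (inorder t) -> x != N -> N \notin root_path t x.
Proof.
move=> h U xN; apply/negP => hp; have Nt := root_path_inorder hp.
have := root_path_subtree U hp; rewrite (subtree_node Nt).
rewrite -[left_subtree t N]/(side_subtree true t N) -[right_subtree t N]/(side_subtree false t N).
by rewrite !side_subtree_max //= inE (negbTE xN).
Qed.

Lemma left_ancestors_del t x : max_label t -> uniq (inorder t) -> x != N ->
  left_ancestors (del t) x = left_ancestors t x.
Proof.
move=> h U xN; apply/setP => m; rewrite !left_ancestorsE root_path_del //.
case: (boolP (m \in root_path t x)) => //= mp; congr andb; apply: eq_existsb => c.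
rewrite !inE root_path_del //; case: (boolP (c \in _)) => //= cp.
apply: (side_child_del true) => //.
  by apply: contraNneq (root_path_max h U xN) => <-.
by apply: contraNneq (root_path_max h U xN) => <-.
Qed.

Lemma right_to_del t y x : max_label t -> x != N -> y != N ->
  right_to (del t) y x = right_to t y x.
Proof.
move=> h xN yN; apply: eq_existsb => c.
rewrite -![right_subtree _ c]/(side_subtree false _ c) -![left_subtree _ c]/(side_subtree true _ c).
have [->|cN] := eqVneq c N.
  by rewrite (side_subtree_max _ h) side_subtree_notin // mem_del // eqxx.
by rewrite !side_subtree_del // !mem_del ?xN ?yN //; apply: max_label_side.
Qed.

Lemma smaller_right_to_del t x : max_label t -> x != N -> x \in inorder t ->
  smaller_right_to (del t) x = smaller_right_to t x.
Proof.
move=> h xN xt; rewrite /smaller_right_to inorder_del // -filter_predI; apply: eq_in_filter.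
move=> y yt /=; case: (boolP (y < x)) => //= yx.
have yN : y != N.
  by case/andP: h => _ /allP/(_ _ xt); apply: contraTneq => <-; rewrite -ltnNge.
by rewrite yN andbT right_to_del.
Qed.

(** The rule for [x] looks at the paths to the root of nodes other than [N] and at labels smaller
    than [x]. As a leaf with the largest label, [N] lies on none of these paths and is not among
    these labels. *)
Lemma valid_na_del t x a : max_label t -> uniq (inorder t) -> x != N -> x \in inorder t ->
  valid_na (del t) x a = valid_na t x a.
Proof.
move=> h U xN xt; rewrite /valid_na smaller_right_to_del // left_ancestors_del //.
case e : smaller_right_to => [//|y s].
have yN : y != N.
  have : y \in smaller_right_to t x by rewrite e mem_head.
  rewrite mem_filter => /andP[/andP[yx _] yt].
  by case/andP: h => _ /allP/(_ _ xt); apply: contraTneq => <-; rewrite -ltnNge.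
have pd z : z != N -> path_set (del t) z = path_set t z.
  by move=> zN; rewrite /path_set root_path_del.
apply: eq_existsb => c; rewrite (pd x xN) (pd y yN); case: (boolP (c \in path_set t x :&: path_set t y)) => //=.
rewrite in_setI inE => /andP[cp _]; rewrite pd //.
by apply: contraNneq (root_path_max h U xN) => <-.
Qed.

End Del.

(** * The place at which the largest label hangs *)

Section Attach.
Variable n : nat.
Notation T := 'I_n.
Variable N : T.
Hypothesis N0 : 0 < N.
Implicit Types (t u l r L : btree T) (x y z a q : T) (s : seq T) (b : bool) (M : {set T}).
Local Notation del := (del N).

Lemma good_max L : good N.+1 L -> max_label N L.
Proof. by case/goodP => i _ h; rewrite /max_label i; apply/allP => z; rewrite h ltnS. Qed.

Lemma good_del L : good N.+1 L -> good N (del L).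
Proof.
move=> g; have m := good_max g; case/goodP: g => i u h; apply/goodP; split.
- exact: increasing_del.
- by rewrite inorder_del // filter_uniq.
- by move=> p; rewrite mem_del // h ltnS [RHS]ltn_neqAle.
Qed.

(** A slot is a node together with a side. The tree [del L] and the slot of [N] serve as coordinates
    for [L]: [att_ext] says that they determine it, and [attachP] realizes every empty slot. *)
Definition attached L q b := perm_eq (edges L) ((q, b, N) :: edges (del L)).

Lemma good_mem L : good N.+1 L -> N \in inorder L.
Proof. by case/goodP => _ _ ->. Qed.

Lemma good_uniq k t : good k t -> uniq (inorder t).
Proof. by case/goodP. Qed.

Lemma good_inc k t : good k t -> increasing t.
Proof. by case/goodP. Qed.

Lemma good_root_max L : good N.+1 L -> root L != Some N.
Proof.
case/goodP=> i u h; apply/eqP => rL.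
have n0 : 0 < n by apply: leq_ltn_trans (ltn_ord N).
have zL : Ordinal n0 \in inorder L by rewrite h.
by have := @subtree_le n L N (Ordinal n0) i; rewrite subtree_root // root_in // => /(_ isT zL); rewrite leqNgt N0.
Qed.

Lemma good_att L : good N.+1 L -> exists q b, attached L q b.
Proof.
move=> g; apply: edges_del; [exact: good_max | exact: good_mem | exact: good_uniq g |].
exact: good_root_max.
Qed.

Lemma att_mem L q b : attached L q b -> (q, b, N) \in edges L.
Proof. by move/perm_mem->; rewrite mem_head. Qed.

Lemma att_inj L q b q' b' : good N.+1 L -> attached L q b -> attached L q' b' -> q = q' /\ b = b'.
Proof.
move=> /good_uniq u /att_mem h /att_mem h'.
by have [-> ->] := edges_parent_inj u h h' erefl.
Qed.

Lemma att_edge L q b p c : good N.+1 L -> attached L q b -> (p, c, N) \in edges L -> p = q /\ c = b.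
Proof. by move=> /good_uniq u /att_mem h h'; have [-> ->] := edges_parent_inj u h h' erefl. Qed.

Lemma att_of L t q b : good N.+1 L -> good N t ->
  perm_eq (edges L) ((q, b, N) :: edges t) -> del L = t /\ attached L q b.
Proof.
move=> g gt h; have [q' [b' h']] := good_att g.
have [e1 e2] : q = q' /\ b = b' by apply: (att_edge g h'); rewrite (perm_mem h) mem_head.
subst q' b'; split=> //; apply: (good_ext (good_del g) gt).
by rewrite -(perm_cons (q, b, N)) -(permPl h').
Qed.

Lemma att_ext L L' q b : good N.+1 L -> good N.+1 L' -> del L = del L' ->
  attached L q b -> attached L' q b -> L = L'.
Proof.
move=> g g' d h h'; apply: (good_ext g g').
by rewrite (permPl h) d perm_sym.
Qed.

Lemma att_free L q b w : good N.+1 L -> attached L q b -> (q, b, w) \notin edges (del L).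
Proof.
move=> g h; apply/negP => e.
have e' : (q, b, w) \in edges L by rewrite (perm_mem h) inE e orbT.
have [wN] := edges_slot_inj (good_uniq g) e' (att_mem h) erefl.
move: e; rewrite wN => /edges_mem/andP[_].
by rewrite mem_del ?eqxx //; apply: good_max.
Qed.

Lemma att_in L q b : good N.+1 L -> attached L q b -> q \in inorder (del L).
Proof.
move=> g /att_mem h; have m := good_max g; rewrite mem_del //.
have /andP[-> _] := edges_mem h; rewrite andbT.
have := edges_increasing (good_inc g) h; rewrite /= => qN.
by apply: contraTneq qN => ->; rewrite ltnn.
Qed.

Lemma free_leaf b t q : uniq (inorder t) -> (forall w, (q, b, w) \notin edges t) ->
  side_subtree b t q = Leaf.
Proof.
move=> u h; have := edgesE q b _ u; rewrite /side_child.
by case: side_subtree => // l z r /(_ z) /=; rewrite eqxx (negbTE (h z)).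
Qed.

(** Whatever hangs in the slot is overwritten; [attachP] therefore asks for an empty slot. *)
Definition attach b q t := graft t q
  (if b then Node (Node Leaf N Leaf) q (right_subtree t q)
   else Node (left_subtree t q) q (Node Leaf N Leaf)).

Lemma attachP t q b : good N t -> q \in inorder t -> side_subtree b t q = Leaf ->
  [/\ good N.+1 (attach b q t), del (attach b q t) = t & attached (attach b q t) q b].
Proof.
move=> g qt fr; have [i u h] := goodP _ _ g.
rewrite /attach; set v := (if b then _ else _); set L := graft t q v.
have rv : root v = Some q by rewrite /v; case: (b).
have eL : perm_eq (edges L) ((q, b, N) :: edges t).
  apply/permP => P; have := edges_graft P u qt rv; rewrite (subtree_node qt) /L /v.
  by move: fr; rewrite /side_subtree; case: (b) => -> /=; rewrite ?cats0 ?count_cat /=; count_lia.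
have rL : root L = root t by apply: root_graft.
have pL : perm_eq (inorder L) (N :: inorder t).
  by apply/permP => Q; rewrite count_inorder rL (permP eL) /= [in RHS]count_inorder /=; count_lia.
have gL : good N.+1 L.
  apply/goodP; split.
  - apply: increasing_edges => e; rewrite (perm_mem eL) inE => /orP[/eqP->|]; last exact: edges_increasing.
    by rewrite /= -h.
  - by rewrite (perm_uniq pL) /= u h ltnn.
  - by move=> p; rewrite (perm_mem pL) inE h ltnS [RHS]leq_eqVlt.
by have [] := att_of gL g eL.
Qed.

Lemma sorted_max s : sorted (@lt_lab n) s -> all (fun z : T => z <= N) s -> N \in s ->
  s = rcons (filter (predC1 N) s) N.
Proof.
move=> ss /allP sN Ns; have u := sorted_uniq_lab ss.
apply: (irr_sorted_eq (@lt_lab_trans n) (@lt_lab_irr n)) => //.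
  rewrite -cats1; case e : (filter _ _) => [|y s'] //=.
  rewrite cat_path /= andbT.
  have := sorted_filter (@lt_lab_trans n) (predC1 N) ss; rewrite e /= => -> /=.
  have : last y s' \in filter (predC1 N) s by rewrite e mem_last.
  by rewrite mem_filter /= => /andP[h /sN h']; rewrite /lt_lab ltn_neqAle h.
move=> z; rewrite mem_rcons inE mem_filter /=.
by case: (z =P N) => [->|].
Qed.

(** As a leaf, [N] can meet a chain only at its end, and the last node of that chain in [del L] is
    then its parent. So a chain of [L] is the chain of [del L], with at most one node added. *)
Lemma chain_att L q b c y : good N.+1 L -> attached L q b -> y \in inorder (del L) ->
  let S := side_spine c (subtree (del L) y) in
  let SL := side_spine c (subtree L y) in
  [/\ N \in SL, b = c, q = last y S & SL = rcons S N] \/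
  [/\ N \notin SL, SL = S & b = c -> q \notin S].
Proof.
move=> g h yt S SL; have m := good_max g; have u := good_uniq g.
have yN : y != N by move: yt; rewrite mem_del // => /andP[].
have yL : y \in inorder L by move: yt; rewrite mem_del // => /andP[].
have SE : S = filter (predC1 N) SL by rewrite /S chain_del.
case: (boolP (N \in SL)) => NS; [left | right].
  have eS : SL = rcons S N.
    rewrite SE; apply: sorted_max => //.
      by apply: spine_sorted; apply: increasing_subtree; apply: good_inc g.
    by apply/allP => z /spine_inorder/mem_subtree; case/goodP: g => _ _ ->; rewrite ltnS.
  have [S' S'E] : exists S', S = y :: S'.
    by rewrite /S (subtree_node yt) /side_spine; case: (c); eexists.
  have e : (last y S', c, N) \in edges L.
    apply: (edges_subtree (y := y)); apply: (links_spine (b := c)).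
    by rewrite -/SL eS S'E links_rcons mem_rcons mem_head.
  have [e1 e2] := att_edge g h e; split=> //.
  by rewrite S'E.
have eS : SL = S by rewrite SE (all_filterP _) //; apply/allP => z /=; apply: contraTneq => ->.
split => // bc; apply: contra NS; rewrite -eS => qS.
by apply: spine_step qS _; rewrite // -bc att_mem.
Qed.

(** * A rotation compared with the same rotation after removing the largest label *)

Section RotDel.
Variables (L : btree T) (q : T) (b : bool) (x x0 a : T) (M : {set T}).
Hypotheses (g : good N.+1 L) (hq : attached L q b) (xN : x != N).
Hypotheses (hx : left_child L x0 = Some x) (ha : x \in inorder (left_subtree L a)).
Hypothesis (hM : M \subset left_chain L x).
Local Notation t := (del L).

Let m := good_max g.
Let u := good_uniq g.
Let i := good_inc g.
Let gt := good_del g.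
Let ut := good_uniq gt.
Let it := good_inc gt.

Lemma side_subtree_neq_max y c z : z \in inorder (side_subtree c L y) -> y != N.
Proof. by apply: contraTneq => ->; rewrite (side_subtree_max _ m). Qed.

Lemma rot_parent_neq_max : x0 != N.
Proof.
apply: (@side_subtree_neq_max _ true x); move: hx; rewrite /left_child /side_subtree.
by case: left_subtree => //= l z r [->]; rewrite mem_cat mem_head orbT.
Qed.

Lemma rot_na_neq_max : a != N. Proof. exact: (@side_subtree_neq_max _ true x ha). Qed.

Lemma rot_left_child_del : left_child t x0 = Some x.
Proof. by apply/eqP; rewrite (side_child_del true m rot_parent_neq_max xN); apply/eqP. Qed.

Lemma rot_left_subtree_del : x \in inorder (left_subtree t a).
Proof.
rewrite -[left_subtree t a]/(side_subtree true t a) side_subtree_del ?rot_na_neq_max //.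
by rewrite mem_del ?xN //; apply: max_label_side.
Qed.

Lemma left_chainE v y : y \in inorder v -> left_spine (subtree v y) = y :: left_chain v y.
Proof. by move=> yv; rewrite /left_chain (subtree_node yv). Qed.

Lemma rot_node_mem_del : x \in inorder t.
Proof. by have [] := rot_nodes ut rot_left_child_del rot_left_subtree_del. Qed.

Lemma rot_na_mem_del : a \in inorder t.
Proof. by have [] := rot_nodes ut rot_left_child_del rot_left_subtree_del. Qed.

Lemma rot_node_mem : x \in inorder L.
Proof. by have [] := rot_nodes u hx ha. Qed.

Lemma rot_left_chain_cases : [/\ N \in left_chain L x, b = true, q = last x (left_chain t x)
    & left_chain L x = rcons (left_chain t x) N] \/
  [/\ N \notin left_chain L x, left_chain L x = left_chain t x
    & b = true -> q \notin x :: left_chain t x].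
Proof.
have := chain_att true g hq rot_node_mem_del; rewrite /= !left_chainE ?rot_node_mem_del ?rot_node_mem //=.
by case=> [[h1 h2 h3 [h4]]|[h1 [h2] h3]]; [left|right]; move: h1;
  rewrite inE eq_sym (negbTE xN).
Qed.

Lemma rot_sub_left_chain_del : M :\ N \subset left_chain t x.
Proof.
apply/subsetP => z; rewrite in_setD1 => /andP[zN /(subsetP hM)].
by case: rot_left_chain_cases => [[_ _ _ ->]|[_ -> _]] //; rewrite mem_rcons inE (negbTE zN).
Qed.

Let R := rotate L x x0 a M.
Let Rt := rotate t x x0 a (M :\ N).

Lemma good_rotate : good N.+1 R.
Proof. exact: rotate_good hM. Qed.

Lemma good_rotate_del : good N Rt.
Proof. exact: rotate_good rot_left_child_del rot_left_subtree_del rot_sub_left_chain_del. Qed.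

Lemma rotate_att_of q' c : perm_eq (edges R) ((q', c, N) :: edges Rt) -> del R = Rt /\ attached R q' c.
Proof.
exact: att_of good_rotate good_rotate_del.
Qed.

Lemma rd_ltN (A : {set T}) z : {subset A <= inorder t} -> z \in A -> z < N.
Proof. by move=> s /s; have [_ _ ->] := goodP _ _ gt. Qed.

Lemma left_chain_del_mem : {subset left_chain t x <= inorder t}.
Proof.
move=> z h; apply: (mem_subtree (y := x)); apply: (@spine_inorder _ true).
by rewrite /= left_chainE ?rot_node_mem_del // inE h orbT.
Qed.

(** A left leaf [N] lies on neither right chain, so only the splitting matters. If [N] is off the
    left chain it keeps its slot; otherwise it ends that chain and, being the largest label, ends
    the part into which [M] sends it. *)
Lemma rotate_del_left : b = true -> exists q',
  [/\ del R = Rt, attached R q' true &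
    [\/ N \notin left_chain L x /\ q' = q,
        [/\ N \in M, q = last x (left_chain t x) & q' = last x (enum (M :\ N))]
      | [/\ N \in left_chain L x, N \notin M, q = last x (left_chain t x)
          & q' = last x0 (enum ([set z in left_chain t x] :\: M))]]].
Proof.
move=> bT.
(* [N] hangs on the left, so no right chain starting at another node contains it. *)
have Qe y : y \in inorder t -> right_chain L y = right_chain t y.
  by move=> yt; have /= [[_ h]|[_ e _]] := chain_att false g hq yt; [rewrite bT in h | ].
have REL P := rotate_edges u i hx ha hM P.
have REt P := rotate_edges ut it rot_left_child_del rot_left_subtree_del rot_sub_left_chain_del P.
have cL P : count P (edges L) = P (q, true, N) + count P (edges t).
  by rewrite (permP hq) bT.
case: rot_left_chain_cases => [[NC _ qE CE]|[NC CE _]]; last first.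
  exists q; have MN : M :\ N = M.
    apply/setP => z; rewrite in_setD1; case: (z =P N) => //= ->.
    by apply/esym/negP => /(subsetP hM); apply/negP.
  have [|-> h] := rotate_att_of (q' := q) (c := true); last by split=> //; constructor 1.
  apply/permP => P; have := REL P; have := REt P; rewrite /R /Rt MN !Qe ?rot_node_mem_del ?rot_na_mem_del // CE cL /=.
  by count_lia.
have lk P : count P (links true [:: x0, x & left_chain L x]) =
    count P (links true [:: x0, x & left_chain t x]) + P (q, true, N).
  by rewrite CE -2!rcons_cons links_rcons -cats1 count_cat /= qE addn0.
case: (boolP (N \in M)) => NM.
  exists (last x (enum (M :\ N))).
  have eM : enum M = rcons (enum (M :\ N)) N.
    rewrite -{1}(setD1K NM); apply: enum_setU1_max => z zM; apply: (rd_ltN _ zM).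
    by move=> w /(subsetP rot_sub_left_chain_del)/left_chain_del_mem.
  have eD : [set z in left_chain L x] :\: M = [set z in left_chain t x] :\: (M :\ N).
    apply/setP => z; rewrite !inE CE mem_rcons inE.
    case: (z =P N) => [->|_] //=; rewrite NM /=.
    by apply/esym/negP => /left_chain_del_mem; have [_ _ ->] := goodP _ _ gt; rewrite ltnn.
  have [|-> h] := rotate_att_of (q' := last x (enum (M :\ N))) (c := true); last by split=> //; constructor 2.
  have lM P : count P (links true (x :: enum M)) =
      count P (links true (x :: enum (M :\ N))) + P (last x (enum (M :\ N)), true, N).
    by rewrite eM -rcons_cons links_rcons -cats1 count_cat /= addn0.
  apply/permP => P; have := REL P; have := REt P.
  rewrite /R /Rt !Qe ?rot_node_mem_del ?rot_na_mem_del // lk cL lM eD.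
  rewrite [count P (_ :: edges _)]/=; count_lia.
have MN : M :\ N = M.
  by apply/setP => z; rewrite in_setD1; case: (z =P N) => //= ->; rewrite (negbTE NM).
exists (last x0 (enum ([set z in left_chain t x] :\: M))).
have eD : enum ([set z in left_chain L x] :\: M) = rcons (enum ([set z in left_chain t x] :\: M)) N.
  rewrite -enum_setU1_max => [|z]; last first.
    by rewrite !inE => /andP[_ /left_chain_del_mem]; have [_ _ ->] := goodP _ _ gt.
  apply: (congr1 (fun A : {set T} => enum A)); apply/setP => z; rewrite !inE CE mem_rcons inE.
  by case: (z =P N) => [->|_] //=; rewrite NM.
have [|-> h] := rotate_att_of (q' := last x0 (enum ([set z in left_chain t x] :\: M))) (c := true);
  last by split=> //; constructor 3.
have lM P : count P (links true (x0 :: enum ([set z in left_chain L x] :\: M))) =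
    count P (links true (x0 :: enum ([set z in left_chain t x] :\: M)))
    + P (last x0 (enum ([set z in left_chain t x] :\: M)), true, N).
  by rewrite eD -rcons_cons links_rcons -cats1 count_cat /= addn0.
apply/permP => P; have := REL P; have := REt P.
rewrite /R /Rt MN !Qe ?rot_node_mem_del ?rot_na_mem_del // lk cL lM.
by rewrite [count P (_ :: edges _)]/=; count_lia.
Qed.

(** A right leaf [N] is not on the left chain, so only the merging matters. If its parent [q] lies
    on one of the two right chains, [N] ends that chain and, being the largest label, ends the
    merged one; otherwise it keeps its slot. *)
Lemma rotate_del_right : b = false -> exists q',
  [/\ del R = Rt, attached R q' false &
    (q \notin right_chain t x ++ right_chain t a /\ q' = q) \/
    (q \in right_chain t x ++ right_chain t a /\
     q' = last a (enum ([set z in right_chain t x] :|: [set z in right_chain t a])))].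
Proof.
move=> bF.
have [NC CE] : N \notin left_chain L x /\ left_chain L x = left_chain t x.
  by case: rot_left_chain_cases => [[_]|[]] //; rewrite bF.
have MN : M :\ N = M.
  apply/setP => z; rewrite in_setD1; case: (z =P N) => //= ->.
  by apply/esym/negP => /(subsetP hM); apply/negP.
have REL P := rotate_edges u i hx ha hM P.
have REt P := rotate_edges ut it rot_left_child_del rot_left_subtree_del rot_sub_left_chain_del P.
have cL P : count P (edges L) = P (q, false, N) + count P (edges t).
  by rewrite (permP hq) bF.
have Qc y : y \in inorder t -> [/\ N \in right_chain L y, q \in right_chain t y,
     right_chain L y = rcons (right_chain t y) N
    & forall P, count P (links false (right_chain L y)) =
       count P (links false (right_chain t y)) + P (q, false, N)] \/
   [/\ N \notin right_chain L y, right_chain L y = right_chain t y & q \notin right_chain t y].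
  move=> yt; have [[h1 _ h3 h4]|[h1 h2 h3]] := chain_att false g hq yt; [left|right].
    have qE : q = last y (behead (right_chain t y)).
      by rewrite h3 /= -/(right_chain t y) [in LHS](right_chain_head yt).
    split=> //; first by rewrite (right_chain_head yt) qE mem_last.
    move=> P; rewrite {1}/right_chain -/(side_spine false (subtree L y)) h4 /=.
    by rewrite -/(right_chain t y) (right_chain_head yt) links_rcons -cats1 count_cat /= -qE addn0.
  by split=> //; apply: h3.
pose W := enum ([set z in right_chain t x] :|: [set z in right_chain t a]).
pose WL := enum ([set z in right_chain L x] :|: [set z in right_chain L a]).
have WE := rot_merged_head ut it rot_left_child_del rot_left_subtree_del.
have rin y : y \in inorder t -> {subset right_chain t y <= inorder t}.
  by move=> yt z /(@spine_inorder _ false)/mem_subtree.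
have eW : N \in WL -> q \in right_chain t x ++ right_chain t a -> WL = rcons W N.
  move=> NW qW; rewrite /WL /W -enum_setU1_max.
    apply: (congr1 (fun A : {set T} => enum A)); apply/setP => z; rewrite !inE.
    move: NW; rewrite mem_enum !inE.
    case: (Qc x rot_node_mem_del) => [[N1 q1 -> _]|[/negbTE-> -> q1]];
    case: (Qc a rot_na_mem_del) => [[N2 q2 -> _]|[/negbTE-> -> q2]];
      rewrite ?mem_rcons ?inE; case: (z =P N); rewrite ?orbT ?orbF //=.
  move=> z; rewrite !inE => /orP[/(rin _ rot_node_mem_del)|/(rin _ rot_na_mem_del)];
    by have [_ _ ->] := goodP _ _ gt.
have lW P : N \in WL -> q \in right_chain t x ++ right_chain t a ->
    count P (links false WL) = count P (links false W) + P (last a W, false, N).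
  move=> NW /eW->//; rewrite /W WE links_rcons -cats1 count_cat /= addn0.
  by [].
have dj : uniq (right_chain t x ++ right_chain t a).
  by rewrite -(perm_uniq (perm_rot_merged ut it rot_left_child_del rot_left_subtree_del rot_sub_left_chain_del)) enum_uniq.
case: (Qc x rot_node_mem_del) => [[N1 q1 E1 l1]|[N1 E1 q1]];
  case: (Qc a rot_na_mem_del) => [[N2 q2 E2 l2]|[N2 E2 q2]].
(* [N] cannot end both chains: its parent would lie on both, and they are disjoint. *)
- by move: dj; rewrite cat_uniq => /and3P[_ /hasPn/(_ _ q2)]; rewrite /= q1.
- exists (last a W); have qW : q \in right_chain t x ++ right_chain t a by rewrite mem_cat q1.
  have NW : N \in WL by rewrite mem_enum !inE N1.
  have [|-> h] := rotate_att_of (q' := last a W) (c := false); last by split=> //; right.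
  apply/permP => P; have := REL P; have := REt P; rewrite -/WL -/W (lW P NW qW) l1 cL E2.
  rewrite MN CE /R /Rt MN /=; count_lia.
- exists (last a W); have qW : q \in right_chain t x ++ right_chain t a by rewrite mem_cat q2 orbT.
  have NW : N \in WL by rewrite mem_enum !inE N2 orbT.
  have [|-> h] := rotate_att_of (q' := last a W) (c := false); last by split=> //; right.
  apply/permP => P; have := REL P; have := REt P; rewrite -/WL -/W (lW P NW qW) l2 cL E1.
  rewrite MN CE /R /Rt MN /=; count_lia.
exists q; have [|-> h] := rotate_att_of (q' := q) (c := false); last first.
  by split=> //; left; rewrite mem_cat negb_or q1 q2.
apply/permP => P; have := REL P; have := REt P; rewrite cL E1 E2.
rewrite MN CE /R /Rt MN /=; count_lia.
Qed.

End RotDel.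
End Attach.

(** * Lifting covers *)

Section Lifts.
Variable n : nat.
Notation T := 'I_n.
Variable N : T.
Hypothesis N0 : 0 < N.
Implicit Types (t u l r L : btree T) (x y z a q : T) (s : seq T) (b : bool) (M : {set T}).
Local Notation del := (del N).
Local Notation attached := (attached N).

Lemma sorted_le_last y s z : sorted (@lt_lab n) (y :: s) -> z \in y :: s -> z <= last y s.
Proof.
elim: s y z => [|w s IH] y z; first by rewrite inE => _ /eqP->.
rewrite /= => /andP[yw ws]; rewrite inE => /orP[/eqP->|zs]; last exact: IH.
by apply: leq_trans (ltnW yw) _; apply: IH; rewrite ?mem_head.
Qed.

Lemma sorted_last_max y s z : sorted (@lt_lab n) (y :: s) -> z \in y :: s ->
  (forall w, w \in y :: s -> w <= z) -> z = last y s.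
Proof.
move=> ss zs h; apply/val_inj/anti_leq; rewrite sorted_le_last //=.
exact: h (mem_last _ _).
Qed.

(** Every node of a chain except the last is the parent of one link. The last node appears as a
    summand, to keep an equation in [nat]. *)
Lemma count_links_parent q b y s : uniq (y :: s) ->
  count (fun e => e.1 == (q, b)) (links b (y :: s)) + (q == last y s) = (q \in y :: s).
Proof.
elim: s y => [|z s IH] y; first by rewrite inE.
move=> /andP[yzs u]; have /= e := IH z u.
rewrite [in RHS]in_cons /= xpair_eqE eqxx andbT -addnA {}e eq_sym.
by case: (q =P y) => [->|_] /=; rewrite ?(negbTE yzs).
Qed.

Lemma spine_end_free b t y : uniq (inorder t) -> increasing t -> y \in inorder t ->
  side_subtree b t (last y (side_spine b (subtree t y))) = Leaf.
Proof.
move=> u i yt; apply: free_leaf => // w; apply/negP => e.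
have S : side_spine b (subtree t y) = y :: behead (side_spine b (subtree t y)).
  by rewrite (subtree_node yt); case: (b).
have lS : last y (side_spine b (subtree t y)) \in side_spine b (subtree t y).
  by rewrite S /= mem_last.
have ws := spine_step u lS e; have := edges_increasing i e; rewrite /= ltnNge.
have ss := spine_sorted b (increasing_subtree y i).
by move: ss ws; rewrite S /= => ss ws; rewrite sorted_le_last.
Qed.

Lemma graft_edges t a u : a \in inorder t -> {subset edges u <= edges (graft t a u)}.
Proof.
elim: t => //= l IHl y r IHr; rewrite mem_cat inE; case: (a =P y) => [_ _ e //|_ /= at_ e eu]; rewrite !mem_cat.
by case/orP: at_ => [/IHl|/IHr] h; rewrite (h e eu) !orbT.
Qed.

Lemma links_link_right (f : T -> btree T) s : {subset links false s <= edges (link_right f s)}.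
Proof.
elim: s => //= y s IH e; rewrite !mem_cat => /orP[|/IH->]; last by rewrite !orbT.
by case: s {IH} => //= z s ->; rewrite !orbT.
Qed.

Lemma rotate_links t x x0 a M : uniq (inorder t) -> increasing t ->
  left_child t x0 = Some x -> x \in inorder (left_subtree t a) -> M \subset left_chain t x ->
  {subset links false (enum ([set z in right_chain t x] :|: [set z in right_chain t a]))
     <= edges (rotate t x x0 a M)}.
Proof.
move=> u i hx ha hM e he; have [a2 sp2] := rot_T2_right_chain u i hx ha hM.
rewrite /rotate (rot_T1_right_chain u i hx ha hM) [right_chain (rot_T2 _ _ _ _) _]/right_chain sp2.
by apply: graft_edges => //; apply: links_link_right.
Qed.

Lemma cover_lift_data L x x0 a : good N.+1 L -> left_child (del L) x0 = Some x ->
  valid_na (del L) x a ->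
  [/\ x \in inorder (del L), x != N, left_child L x0 = Some x & valid_na L x a].
Proof.
move=> g hx hv; have m := good_max g; have gt := good_del g.
have /andP[x0t xt] := side_child_mem (b := true) (good_uniq gt) hx.
have [xN xL] : x != N /\ x \in inorder L by move: xt; rewrite mem_del // => /andP[].
have x0N : x0 != N by move: x0t; rewrite mem_del // => /andP[].
split=> //; last by rewrite -(valid_na_del a m (good_uniq g) xN xL).
by apply/eqP; rewrite -(side_child_del true m x0N xN); apply/eqP.
Qed.

Lemma left_chain_del L x : good N.+1 L -> x \in inorder (del L) ->
  left_chain (del L) x = filter (predC1 N) (left_chain L x).
Proof.
move=> g xt; have m := good_max g.
have [xN xL] : x != N /\ x \in inorder L by move: xt; rewrite mem_del // => /andP[].
have := chain_del true m xN; rewrite /= !left_chainE //= xN.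
by case.
Qed.

(** A rotation at [N] itself has an empty left chain and hence an empty [M]. [T1] is the single node
    [N], and merging it puts [N], as the largest label, at the end of the right chain of [a]. *)
Lemma rotate_max L x0 a M : good N.+1 L -> left_child L x0 = Some N ->
  N \in inorder (left_subtree L a) -> M \subset left_chain L N ->
  [/\ attached L x0 true, a \in inorder (del L), del (rotate L N x0 a M) = del L &
      attached (rotate L N x0 a M) (last a (right_chain (del L) a)) false].
Proof.
move=> g hx ha hM; have u := good_uniq g; have i := good_inc g; have m := good_max g.
have hq : attached L x0 true.
  have [q [b hq]] := good_att N0 g.
  have e : (x0, true, N) \in edges L.
    by rewrite edgesE // /side_child /= -/(left_child L x0) hx eqxx.
  by have [-> ->] := att_edge g hq e.
have e0 : left_chain L N = [::].
  by rewrite /left_chain -[left_subtree L N]/(side_subtree true L N) side_subtree_max.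
have M0 : M = set0 by apply/setP => z; rewrite inE; apply/negP => /(subsetP hM); rewrite e0.
have NL := good_mem g; have gt := good_del g.
have aL : a \in inorder L by have [] := rot_nodes u hx ha.
have aN : a != N by have := side_subtree_lt (b := true) i ha; apply: contraTneq => ->; rewrite ltnn.
have at_ : a \in inorder (del L) by rewrite mem_del ?aN.
have gR := rotate_good g hx ha hM.
suff e : perm_eq (edges (rotate L N x0 a M))
     ((last a (right_chain (del L) a), false, N) :: edges (del L)).
  by have [] := att_of N0 gR gt e.
have [[_ //]|[/= NQ QE _]] := chain_att false g hq at_.
have QN : right_chain L N = [:: N].
  by rewrite /right_chain (subtree_node NL) /= -[right_subtree L N]/(side_subtree false L N) side_subtree_max.
have QaE : right_chain L a = right_chain (del L) a by [].
have eW : enum ([set z in right_chain L N] :|: [set z in right_chain L a]) =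
    rcons (right_chain (del L) a) N.
  apply: enum_sorted_eq => [|z]; last first.
    by rewrite mem_rcons !inE QN !inE QaE.
  have := spine_sorted false (increasing_subtree a (good_inc gt)).
  rewrite /= -/(right_chain (del L) a) (right_chain_head at_) -cats1 /= cat_path => -> /=.
  rewrite andbT.
  have : last a (behead (right_chain (del L) a)) \in inorder (del L).
    apply: (mem_subtree (y := a)); apply: (@spine_inorder _ false) => /=.
    by rewrite -/(right_chain (del L) a) (right_chain_head at_) mem_last.
  by have [_ _ ->] := goodP _ _ gt.
apply/permP => P; have := rotate_edges u i hx ha hM P.
rewrite eW e0 QN QaE (right_chain_head at_) rcons_cons links_rcons M0.
have -> : [set m0 in [::]] :\: set0 = set0 :> {set T} by apply/setP => z; rewrite !inE.
rewrite enum_set0 -cats1 (permP hq) /= !count_cat /=; count_lia.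
Qed.

Lemma cover_max L q a : good N.+1 L -> attached L q true -> valid_na L N a ->
  exists L', [/\ cover L L', del L' = del L &
                 attached L' (last a (right_chain (del L) a)) false].
Proof.
move=> g hq hv; have u := good_uniq g; have ha := valid_na_sub u hv.
have hx : left_child L q = Some N.
  by apply/eqP; rewrite -[_ == _](edgesE q true N u) att_mem.
have hM : set0 \subset left_chain L N by apply/subsetP => z; rewrite inE.
have [_ _ d h] := rotate_max g hx ha hM.
exists (rotate L N q a set0); split=> //.
by apply/coverP; exists N, q, a, set0.
Qed.

(** The rotation data of [del L] are also data for [L], and [rotate_del_right] says that removing
    [N] commutes with the rotation. This makes [del] surjective on upper covers. *)
Lemma cover_lift_up L q t' : good N.+1 L -> attached L q false -> cover (del L) t' ->
  exists L', cover L L' /\ del L' = t'.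
Proof.
move=> g hq /coverP[x [x0 [a [M [hx hv hM ->]]]]].
have [xt xN hx' hv'] := cover_lift_data g hx hv.
have hM' : M \subset left_chain L x.
  by apply/subsetP => z /(subsetP hM); rewrite left_chain_del // mem_filter => /andP[].
have MN : M :\ N = M.
  apply/setP => z; rewrite in_setD1; case: (z =P N) => //= ->.
  by apply/esym/negP => /(subsetP hM); rewrite left_chain_del // mem_filter /= eqxx.
exists (rotate L x x0 a M); split; first by apply/coverP; exists x, x0, a, M.
have ha := valid_na_sub (good_uniq g) hv'.
by have [q' [-> _ _]] := rotate_del_right N0 g hq xN hx' ha hM' erefl; rewrite MN.
Qed.

(** The place of [N] before the step is recovered from its place [q'] after it: if [q'] ends one of
    the two parts of the split chain, [N] ended the whole left chain; otherwise [N] has not moved.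
    This makes [del] surjective on lower covers. *)
Lemma cover_lift_down L' q' t : good N.+1 L' -> attached L' q' true -> good N t ->
  cover t (del L') -> exists L q, [/\ good N.+1 L, attached L q true, del L = t & cover L L'].
Proof.
move=> g' hq' gt /coverP[x [x0 [a [M [hx hv hM dL']]]]].
have u := good_uniq gt; have i := good_inc gt; have ha := valid_na_sub u hv.
have [x0t xt at_] := rot_nodes u hx ha.
have Ct z : z \in left_chain t x -> z \in inorder t.
  move=> h; apply: (mem_subtree (y := x)); apply: (@spine_inorder _ true).
  by rewrite /= left_chainE // inE h orbT.
have NC : N \notin left_chain t x.
  by apply/negP => /Ct; have [_ _ ->] := goodP _ _ gt; rewrite ltnn.
have NM : N \notin M by apply: contra NC; apply: (subsetP hM).
have MN : M :\ N = M.
  by apply/setP => z; rewrite in_setD1; case: (z =P N) => //= ->; rewrite (negbTE NM).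
(* For a candidate slot [q] and subset [M'], it suffices that the rotation sends [N] to [q']: the
   rotated tree and [L'] then have the same coordinates. *)
have lt q M' : side_subtree true t q = Leaf -> q \in inorder t -> M' :\ N = M ->
    (forall L, good N.+1 L -> attached L q true -> del L = t -> M' \subset left_chain L x /\
      forall q'', [\/ N \notin left_chain L x /\ q'' = q,
        [/\ N \in M', q = last x (left_chain (del L) x) & q'' = last x (enum (M' :\ N))]
      | [/\ N \in left_chain L x, N \notin M', q = last x (left_chain (del L) x)
          & q'' = last x0 (enum ([set z in left_chain (del L) x] :\: M'))]] -> q'' = q') ->
    exists L q, [/\ good N.+1 L, attached L q true, del L = t & cover L L'].
  move=> fr qt M'N hyp; have [gL dL hq] := attachP N0 gt qt fr.
  move: (attach N true q t) gL dL hq => L gL dL hq; exists L, q; split=> //.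
  have [hM' hyp'] := hyp L gL hq dL.
  have [||xt1 xN hx1 hv1] := @cover_lift_data L x x0 a gL; rewrite ?dL //.
  have cv : cover L (rotate L x x0 a M') by apply/coverP; exists x, x0, a, M'.
  have ha' := valid_na_sub (good_uniq gL) hv1.
  have [q'' [dR hR cs]] := rotate_del_left N0 gL hq xN hx1 ha' hM' erefl.
  rewrite M'N dL -dL' in dR; rewrite (hyp' _ cs) in hR.
  by rewrite -(att_ext (cover_good gL cv) g' dR hR hq').
have endfree : side_subtree true t (last x (left_chain t x)) = Leaf.
  have := spine_end_free true u i xt; by rewrite /= left_chainE.
have endt : last x (left_chain t x) \in inorder t.
  have := mem_last x (left_chain t x); rewrite inE => /orP[/eqP->|/Ct] //.
have inC L : good N.+1 L -> attached L (last x (left_chain t x)) true -> del L = t ->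
    left_chain L x = rcons (left_chain t x) N.
  move=> gL hq dL; have xt' : x \in inorder (del L) by rewrite dL.
  have m := good_max gL; have xL : x \in inorder L by move: xt'; rewrite mem_del // => /andP[].
  have [[_ _ _]|[_ _ /(_ erefl)]] := chain_att true gL hq xt'.
    by rewrite dL /= !left_chainE //= => -[].
  by rewrite dL /= left_chainE // mem_last.
(* Here [q'] ends the part that goes with [x]: [N] was selected, so the subset is [N |: M]. *)
case: (q' =P last x (enum M)) => [q1|q1].
  apply: (lt (last x (left_chain t x)) (N |: M)) => //; first by rewrite setU1K.
  move=> L gL hq dL; rewrite (inC L) // dL; split.
    apply/subsetP => z; rewrite in_setU1 mem_rcons inE => /orP[->//|/(subsetP hM)->].
    by rewrite orbT.
  move=> q'' [[]|[_ _ ->]|[_]].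
  - by rewrite mem_rcons mem_head.
  - by rewrite setU1K.
  - by rewrite setU11.
(* Here [q'] ends the part that stays with [x0]: [N] ended the left chain but was not selected. *)
case: (q' =P last x0 (enum ([set z in left_chain t x] :\: M))) => [q2|q2].
  apply: (lt (last x (left_chain t x)) M) => //.
  move=> L gL hq dL; rewrite (inC L) // dL; split.
    by apply/subsetP => z /(subsetP hM); rewrite mem_rcons inE orbC => ->.
  move=> q'' [[]|[]|[_ _ _ ->]] //.
  - by rewrite mem_rcons mem_head.
  - by rewrite (negbTE NM).
have q'in : q' \in inorder t.
  by have := att_in g' hq'; have [_ _ ->] := goodP _ _ (good_del g'); have [_ _ ->] := goodP _ _ gt.
have st := rot_sorted u i hx ha.
have e1 := enum_rot_T1 u i hx ha hM; have e2 := enum_rot_T2 M u i hx ha.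
have splitC z : z \in [:: x0, x & left_chain t x] ->
    (z \in x :: enum M) || (z \in x0 :: enum ([set z in left_chain t x] :\: M)).
  rewrite !inE !mem_enum !inE; case: (z \in M); rewrite /= ?orbT //.
  by case/or3P=> ->; rewrite ?orbT.
have sM : sorted (@lt_lab n) (x :: enum M) by rewrite -e1 enum_set_sorted.
have sD : sorted (@lt_lab n) (x0 :: enum ([set z in left_chain t x] :\: M)).
  by rewrite -e2 enum_set_sorted.
(* In the remaining case [N] already hung at [q']. That left slot is empty in [t]: it is empty in
   [del L'], and the rotation empties left slots only at the ends of the two parts. *)
apply: (lt q' M) => //.
  case: (side_child true t q' =P None) => [|/eqP ne].
    by rewrite /side_child; case: side_subtree.
  exfalso; have := rotate_edges u i hx ha hM (fun e => e.1 == (q', true)).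
  have -> : count (fun e => e.1 == (q', true)) (edges t) = 1 by rewrite edges_slot // ne.
  rewrite -dL'.
  have -> : count (fun e => e.1 == (q', true)) (edges (del L')) = 0.
    rewrite edges_slot ?(good_uniq (good_del g')) //.
    by rewrite /side_child (free_leaf (good_uniq (good_del g'))) // => w; apply: att_free g' hq'.
  have lk0 s : count (fun e => e.1 == (q', true)) (links false s) = 0.
    apply/eqP; rewrite -leqn0 leqNgt -has_count; apply/hasPn => -[[y b] z] /links_side /= ->.
    by rewrite xpair_eqE andbF.
  rewrite !lk0 !addn0 add0n.
  have := count_links_parent q' true (sorted_uniq_lab st).
  have := count_links_parent q' true (sorted_uniq_lab sM).
  have := count_links_parent q' true (sorted_uniq_lab sD).
  rewrite (_ : (q' == last x _) = false); last by apply/eqP.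
  rewrite (_ : (q' == last x0 (enum _)) = false); last by apply/eqP.
  case: (boolP (q' \in [:: x0, x & left_chain t x])) => [/splitC/orP[]->|_].
  - by case: (q' \in x0 :: _); count_lia.
  - by case: (q' \in x :: _); count_lia.
  - by count_lia.
move=> L gL hq dL; have xt' : x \in inorder (del L) by rewrite dL.
have m := good_max gL; have xL : x \in inorder L by move: xt'; rewrite mem_del // => /andP[].
have [] := chain_att true gL hq xt'; rewrite dL /= !left_chainE //=; last first.
  case=> NL [CE] _; split; first by rewrite CE.
  move=> q'' [[]|[]|[]] //; first by rewrite (negbTE NM).
  by move=> NL'; move: NL; rewrite inE NL' orbT.
(* The end of the left chain is its largest node, hence also the end of the part containing it,
   which was excluded. *)
case=> _ _ qE _; exfalso.
have mx z : z \in [:: x0, x & left_chain t x] -> z <= q'.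
  by move=> zs; rewrite qE; exact: (@sorted_le_last x0 (x :: left_chain t x)).
have : q' \in [:: x0, x & left_chain t x] by rewrite qE inE mem_last orbT.
case/splitC/orP => q'i.
  apply: q1; apply: sorted_last_max => // w ws; apply: mx.
  by move: ws; rewrite !inE mem_enum => /orP[->|/(subsetP hM)->]; rewrite !orbT.
apply: q2; apply: sorted_last_max => // w ws; apply: mx.
by move: ws; rewrite !inE mem_enum !inE => /orP[->|/andP[_ ->]]; rewrite ?orbT.
Qed.

(** The two alternatives are a rotation at [N] and a rotation at another node. In the second, the
    last clause recovers one slot of [N] from the other: a left slot before the step from the slot
    after it, a right slot after the step from the slot before it. This makes [del] injective on
    lower covers and on upper covers, respectively. *)
Lemma cover_split L L' : good N.+1 L -> cover L L' ->
  (exists q a, [/\ attached L q true, valid_na L N a, del L' = del L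
     & attached L' (last a (right_chain (del L) a)) false]) \/
  (exists b q q', [/\ attached L q b, attached L' q' b, cover (del L) (del L') &
     if b then q = last q' (left_spine (subtree (del L) q'))
     else q' = last q (right_spine (subtree (del L') q))]).
Proof.
move=> g /[dup] cv /coverP[x [x0 [a [M [hx hv hM RE]]]]].
have u := good_uniq g; have i := good_inc g; have m := good_max g; have gt := good_del g.
have g' := cover_good g cv; have ut := good_uniq gt; have it := good_inc gt.
have ha := valid_na_sub u hv.
case: (x =P N) => [xN|/eqP xN].
  left; subst x L'; have [hq at_ d h] := rotate_max g hx ha hM.
  by exists x0, a.
right.
have hx' := rot_left_child_del g xN hx; have ha' := rot_left_subtree_del g xN ha.
have xt := rot_node_mem_del g xN hx ha; have at_ := rot_na_mem_del g xN hx ha.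
have [q [b hq]] := good_att N0 g.
have hM' := rot_sub_left_chain_del g hq xN hx ha hM.
have ct : del L' = rotate (del L) x x0 a (M :\ N) -> cover (del L) (del L').
  move=> dL; apply/coverP; exists x, x0, a, (M :\ N); split=> //.
  by rewrite valid_na_del // (rot_node_mem g hx ha).
case: b hq hM' => hq hM'.
  have [q' [dR hR cs]] := rotate_del_left N0 g hq xN hx ha hM erefl.
  rewrite -RE in dR hR; exists true, q, q'; split; [exact: hq | exact: hR | exact: ct |].
  have qfree (w : T) := att_free w g hq.
  have [x0t _ _] := rot_nodes ut hx' ha'; have st := rot_left_spine ut hx' ha'.
  have inC z : z \in [:: x0, x & left_chain (del L) x] -> z \in inorder (del L).
    by rewrite -st => /(@spine_inorder _ true)/mem_subtree.
  (* The links from [q'] to the end [q] of the left chain are edges of [del L], where the left slot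
     of [q] is empty, so [spine_links] applies. *)
  have qend : q = last x (left_chain (del L) x) -> q' \in [:: x0, x & left_chain (del L) x] ->
      q = last q' (left_spine (subtree (del L) q')).
    move=> qE q'i; have [s1 [s2 e]] : exists s1 s2, [:: x0, x & left_chain (del L) x] = s1 ++ q' :: s2.
      by case/splitPr: q'i => s1 s2; exists s1, s2.
    have lE : last q' s2 = q by have := congr1 (last x0) e; rewrite last_cat /= -qE.
    rewrite -lE in qfree *; apply: (spine_links (b := true)) qfree; rewrite ?inC //.
    move=> f fl; apply: (edges_subtree (y := x0)); apply: (links_spine (b := true)).
    by rewrite /= st e links_cat mem_cat fl orbT.
  case: cs => [[_ ->]|[_ qE q'E]|[_ _ qE q'E]].
  - have qt := att_in g hq; rewrite (subtree_node qt) /=.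
    by rewrite -[left_subtree _ q]/(side_subtree true (del L) q) (free_leaf ut).
  - apply: qend => //; rewrite q'E; have := mem_last x (enum (M :\ N)).
    rewrite in_cons mem_enum => /orP[/eqP->|/(subsetP hM') h].
      by rewrite !in_cons eqxx orbT.
    by rewrite !in_cons h !orbT.
  apply: qend => //; rewrite q'E.
  have := mem_last x0 (enum ([set z in left_chain (del L) x] :\: M)).
  rewrite in_cons mem_enum in_setD in_set !in_cons.
  by case/orP => [->//|/andP[_ ->]]; rewrite !orbT.
have [q' [dR hR cs]] := rotate_del_right N0 g hq xN hx ha hM erefl.
rewrite -RE in dR hR; exists false, q, q'; split; [exact: hq | exact: hR | exact: ct |].
have gt' := good_del g'; have ut' := good_uniq gt'.
have qt := att_in g hq.
have qt' : q \in inorder (del L').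
  by have [_ _ ->] := goodP _ _ gt'; have [_ _ <-] := goodP _ _ gt.
have q'free (w : T) := att_free w g' hR.
case: cs => [[_ qq]|[qi q'E]].
  rewrite qq in q'free *; rewrite (subtree_node qt') /=.
  by rewrite -[right_subtree _ q]/(side_subtree false (del L') q) (free_leaf ut').
set W := enum _ in q'E.
have qW : q \in W by rewrite mem_enum !inE -mem_cat.
have [s1 [s2 e]] : exists s1 s2, W = s1 ++ q :: s2.
  by case/splitPr: qW => s1 s2; exists s1, s2.
have lE : last q s2 = q' by rewrite q'E e last_cat.
rewrite -lE in q'free *; apply: (spine_links (b := false)) q'free => //.
move=> f fl; rewrite dR; apply: rotate_links => //.
by rewrite -/W e links_cat mem_cat fl orbT.
Qed.

End Lifts.

(** * The steps that move the largest label *)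

Section Slots.
Variable n : nat.
Notation T := 'I_n.
Variable N : T.
Implicit Types (t u l r L : btree T) (x y z a q d w : T) (s : seq T) (b : bool).
Local Notation del := (del N).

Lemma left_child_root l y r : left_child (Node l y r) y = root l.
Proof. by rewrite /left_child -[left_subtree _ _]/(side_subtree true _ _) side_subtree_root. Qed.

Lemma left_child_l l y r z : uniq (inorder (Node l y r)) -> z \in inorder l ->
  left_child (Node l y r) z = left_child l z.
Proof. by move=> U zl; have := side_subtree_l true U zl; rewrite /left_child /= => ->. Qed.

Lemma left_child_r l y r z : uniq (inorder (Node l y r)) -> z \in inorder r ->
  left_child (Node l y r) z = left_child r z.
Proof. by move=> U zl; have := side_subtree_r true U zl; rewrite /left_child /= => ->. Qed.

Lemma left_child_mem t y z : uniq (inorder t) -> left_child t y = Some z ->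
  (y \in inorder t) && (z \in inorder t).
Proof. exact: (@side_child_mem _ true). Qed.

Lemma side_subtree_mem b t y z : z \in inorder (side_subtree b t y) -> z \in inorder t.
Proof. by move/mem_side_subtree/mem_subtree. Qed.

Lemma right_to_mem t y x : right_to t y x -> (y \in inorder t) && (x \in inorder t).
Proof.
case/existsP=> c /andP[h1 h2].
by rewrite (@side_subtree_mem false t c y h1) (@side_subtree_mem true t c x h2).
Qed.

Lemma right_to_l l y r z x : uniq (inorder (Node l y r)) -> z \in inorder l ->
  right_to (Node l y r) z x = right_to l z x.
Proof.
move=> U zl; have [yl yr ul ur lr] := uniq_node U; apply: eq_existsb => c.
rewrite -![right_subtree _ c]/(side_subtree false _ c) -![left_subtree _ c]/(side_subtree true _ c).
case: (boolP (c \in inorder l)) => cl; first by rewrite !side_subtree_l.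
case: (boolP (z \in inorder (side_subtree false (Node l y r) c))) => zc; last first.
  by rewrite [in RHS]side_subtree_notin.
exfalso.
case: (boolP (c \in inorder (Node l y r))) => ct; last by rewrite side_subtree_notin in zc.
move: ct; rewrite /= mem_cat inE (negbTE cl) /= => /orP[/eqP cy|cr].
  by rewrite cy side_subtree_root in zc; have := lr _ zl; rewrite zc.
by rewrite side_subtree_r // in zc; have := lr _ zl; rewrite (side_subtree_mem zc).
Qed.

Lemma right_to_r l y r z x : uniq (inorder (Node l y r)) -> x \in inorder r ->
  right_to (Node l y r) z x = right_to r z x.
Proof.
move=> U xr; have [yl yr ul ur lr] := uniq_node U; apply: eq_existsb => c.
rewrite -![right_subtree _ c]/(side_subtree false _ c) -![left_subtree _ c]/(side_subtree true _ c).
case: (boolP (c \in inorder r)) => cr; first by rewrite !side_subtree_r.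
rewrite [side_subtree true r c]side_subtree_notin // [x \in inorder Leaf]/= andbF.
case: (boolP (x \in inorder (side_subtree true (Node l y r) c))) => xc; last by rewrite andbF.
exfalso; case: (boolP (c \in inorder (Node l y r))) => ct; last by rewrite side_subtree_notin in xc.
move: ct; rewrite /= mem_cat inE (negbTE cr) orbF => /orP[cl|/eqP cy].
  by rewrite side_subtree_l // in xc; have := lr _ (side_subtree_mem xc); rewrite xr.
by rewrite cy side_subtree_root in xc; have := lr _ xc; rewrite xr.
Qed.

Lemma right_to_root l y r x : uniq (inorder (Node l y r)) -> right_to (Node l y r) y x = false.
Proof.
move=> U; have [yl yr ul ur lr] := uniq_node U; apply/negbTE/existsPn => c.
rewrite -![right_subtree _ c]/(side_subtree false _ c).
apply/nandP; left; apply/negP => yc.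
case: (boolP (c \in inorder (Node l y r))) => ct; last by rewrite side_subtree_notin in yc.
move: ct; rewrite /= mem_cat inE => /or3P[cl|/eqP cy|cr].
- by rewrite side_subtree_l // in yc; rewrite (side_subtree_mem yc) in yl.
- by rewrite cy side_subtree_root (negbTE yr) in yc.
by rewrite side_subtree_r // in yc; rewrite (side_subtree_mem yc) in yr.
Qed.

(** With [N] in the left subtree, the root witnesses that every label of [r] is right to [N], and
    all are smaller. They follow those of [l] in in-order, so [n'_l] lies in [l] as soon as [l] has
    a candidate. *)
Lemma smaller_right_to_l l y r : uniq (inorder (Node l y r)) -> max_label N (Node l y r) ->
  N \in inorder l -> smaller_right_to (Node l y r) N = smaller_right_to l N ++ inorder r.
Proof.
move=> U m Nl; have [yl yr ul ur lr] := uniq_node U.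
rewrite /smaller_right_to /= filter_cat /= right_to_root // andbF; congr cat.
  by apply: eq_in_filter => z zl; rewrite right_to_l.
apply/all_filterP/allP => z zr; have zN : z != N.
  by apply: contraTneq zr => ->; apply: lr.
have zleN : z <= N.
  by case/andP: m => _ /allP; apply; rewrite /= mem_cat inE zr !orbT.
rewrite ltn_neqAle [_ != _]zN zleN /=; apply/existsP; exists y.
by have := side_subtree_root true l y r; have := side_subtree_root false l y r;
  rewrite /side_subtree => -> ->; rewrite zr.
Qed.

Lemma smaller_right_to_r l y r : uniq (inorder (Node l y r)) ->
  N \in inorder r -> smaller_right_to (Node l y r) N = smaller_right_to r N.
Proof.
move=> U Nr; have [yl yr ul ur lr] := uniq_node U.
rewrite /smaller_right_to /= filter_cat /= right_to_root // andbF.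
rewrite (_ : filter _ (inorder l) = [::]); last first.
  apply/eqP; rewrite -(negbK (_ == _)) -has_filter; apply/hasPn => z zl.
  apply/nandP; right; rewrite right_to_r //; apply/negP => /right_to_mem/andP[zr _].
  by have := lr _ zl; rewrite zr.
by apply: eq_in_filter => z zl; rewrite right_to_r.
Qed.

Lemma left_ancestors_l l y r a : uniq (inorder (Node l y r)) -> y != N ->
  N \in inorder l -> (a \in left_ancestors (Node l y r) N) =
    (a == y) || (a \in left_ancestors l N).
Proof.
move=> U yN Nl; have [yl yr ul ur lr] := uniq_node U.
rewrite !left_ancestorsE root_path_node_l // inE.
case: (a =P y) => [->|/eqP ay] /=.
  rewrite yN; apply/existsP; rewrite left_child_root.
  case: (l) Nl U => // l' z r' Nl U; exists z; rewrite eqxx andbT inE root_path_node_l // inE.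
  by rewrite (root_path_root (z := z)) ?orbT.
case: (boolP (a \in root_path l N)) => //= ap; congr andb.
have al := root_path_inorder ap; rewrite left_child_l //.
apply: eq_existsb => c; rewrite !inE root_path_node_l // inE.
case: (left_child l a =P Some c) => [h|]; rewrite ?andbF // !andbT.
case: (c =P y) => [cy|//]; have /andP[_] := left_child_mem ul h.
by rewrite cy (negbTE yl).
Qed.

Lemma left_ancestors_r l y r a : uniq (inorder (Node l y r)) -> y != N ->
  N \in inorder r -> (a \in left_ancestors (Node l y r) N) = (a \in left_ancestors r N).
Proof.
move=> U yN Nr; have [yl yr ul ur lr] := uniq_node U.
rewrite !left_ancestorsE root_path_node_r // inE.
case: (a =P y) => [->|/eqP ay] /=.
  have -> : y \in root_path r N = false.
    by apply/negP => /root_path_inorder; rewrite (negbTE yr).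
  rewrite yN /=; apply/negbTE/negP => /existsP[c]; rewrite left_child_root inE root_path_node_r // inE.
  case/andP => /orP[/eqP->|/root_path_inorder cr] /eqP h.
    by move: yl; rewrite (root_in h).
  by have := lr _ (root_in h); rewrite cr.
case: (boolP (a \in root_path r N)) => //= ap; congr andb.
have al := root_path_inorder ap; rewrite left_child_r //.
apply: eq_existsb => c; rewrite !inE root_path_node_r // inE.
case: (left_child r a =P Some c) => [h|]; rewrite ?andbF // !andbT.
case: (c =P y) => [cy|//]; have /andP[_] := left_child_mem ur h.
by rewrite cy (negbTE yr).
Qed.

Lemma path_setE t x z : (z \in path_set t x) = (z \in root_path t x).
Proof. by rewrite inE. Qed.

(** [u] is a child subtree of the node [y]. If it contains both [N] and [w], in the role of [n'_l],
    then [n_c] lies in [u] too, so [y] is a proper ancestor of [n_c] and is removed; the rule in [t]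
    is the rule in [u]. The flag [b] tells whether [u] is the left child. *)
Lemma valid_step t u y w a b : (forall z, z \in inorder u -> root_path t z = y :: root_path u z) ->
  (forall z, z \in inorder u -> y < z) -> N \in inorder u -> w \in inorder u ->
  (a \in left_ancestors t N) = (b && (a == y)) || (a \in left_ancestors u N) ->
  [exists c in path_set t N :&: path_set t w,
       [forall d in path_set t N :&: path_set t w, d <= c]
       && (a \in left_ancestors t N :\: (path_set t c :\ c))] =
  [exists c in path_set u N :&: path_set u w,
       [forall d in path_set u N :&: path_set u w, d <= c]
       && (a \in left_ancestors u N :\: (path_set u c :\ c))].
Proof.
move=> hp hy Nu wu hLS.
have yu : y \notin inorder u by apply/negP => /hy; rewrite ltnn.
have [z rz] : exists z, root u = Some z by case: (u) Nu => // l z r _; exists z.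
have zu := root_in rz.
apply: eq_existsb => c; rewrite !in_setI !in_setD !in_set1 !path_setE (hp _ Nu) (hp _ wu) !in_cons.
(* [y] is not the maximal common node: the root [z] of [u] is on both paths and has a larger
   label. *)
case: (c =P y) => [->|/eqP cy] /=.
  have -> : y \in root_path u N = false.
    by apply/negP => /root_path_inorder; rewrite (negbTE yu).
  apply/negbTE/nandP; left; apply/negP => /forallP/(_ z).
  by rewrite !inE (hp _ Nu) (hp _ wu) !inE !(root_path_root rz) // !orbT /= leqNgt hy.
case: (boolP (c \in root_path u N)) => //= cN; case: (boolP (c \in root_path u w)) => //= cw.
have cu := root_path_inorder cN; congr andb.
  apply: eq_forallb => d; rewrite !inE (hp _ Nu) (hp _ wu) !inE; case: (d =P y) => //= ->.
  by rewrite (ltnW (hy _ cu)) implybT.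
rewrite (hp _ cu) in_cons hLS; case: (a =P y) => [->|_]; last by rewrite andbF.
have -> : (y == c) = false by rewrite eq_sym (negbTE cy).
have -> : y \in left_ancestors u N = false.
  by rewrite left_ancestorsE; apply/negP => /andP[/root_path_inorder]; rewrite (negbTE yu).
by rewrite /= andbF.
Qed.

Lemma node_lt l y r : increasing (Node l y r) ->
  (forall z, z \in inorder l -> y < z) /\ (forall z, z \in inorder r -> y < z).
Proof. by case/and4P => /allP h1 /allP h2 _ _. Qed.

Lemma smaller_right_to_mem t w s : smaller_right_to t N = w :: s -> w \in inorder t.
Proof.
move=> e; have : w \in smaller_right_to t N by rewrite e mem_head.
by rewrite mem_filter => /andP[].
Qed.

(** If no label of [l] is right to [N], the root is admissible: either there is no candidate at all,
    or [n'_l] lies in [r], so that [n_c] is the root and nothing is removed from [LS]. If [l] has a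
    candidate, [valid_step] excludes the root. *)
Lemma valid_na_l l y r a : uniq (inorder (Node l y r)) -> max_label N (Node l y r) ->
  N \in inorder l -> valid_na (Node l y r) N a =
  (a == y) && (smaller_right_to l N == [::]) || valid_na l N a.
Proof.
move=> U m Nl; have [yl yr ul ur lr] := uniq_node U.
have yN : y != N by apply: contraNneq yl => ->.
have [hl hr] := node_lt (proj1 (andP m)).
have LS := left_ancestors_l a U yN Nl.
rewrite {1}/valid_na smaller_right_to_l //.
case e : (smaller_right_to l N) => [|w s] /=; last first.
  rewrite andbF /= {1}/valid_na e; apply: (@valid_step _ _ y w a true _ hl Nl (smaller_right_to_mem e) LS).
  by move=> z zl; apply: root_path_node_l.
rewrite /valid_na e andbT -LS.
case er : (inorder r) => [//|w s].
have wr : w \in inorder r by rewrite er mem_head.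
apply/existsP/idP => [[c /and3P[_ _]]|aL]; first by rewrite in_setD => /andP[].
exists y; rewrite in_setI in_setD in_setD1 !path_setE aL.
rewrite (root_path_node_l U Nl) (root_path_node_r U wr) !mem_head /= eqxx andbT.
apply/andP; split; last by rewrite mem_seq1 andNb.
apply/forallP => d; rewrite in_setI !path_setE.
rewrite (root_path_node_l U Nl) (root_path_node_r U wr) !in_cons.
case: (d =P y) => [->|_] /=; first by rewrite leqnn.
apply/implyP => /andP[/root_path_inorder dl /root_path_inorder dr].
by have := lr _ dl; rewrite dr.
Qed.

Lemma valid_na_r l y r a : uniq (inorder (Node l y r)) -> max_label N (Node l y r) ->
  N \in inorder r -> valid_na (Node l y r) N a = valid_na r N a.
Proof.
move=> U m Nr; have [yl yr ul ur lr] := uniq_node U.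
have yN : y != N by apply: contraNneq yr => ->.
have [hl hr] := node_lt (proj1 (andP m)).
have LS := left_ancestors_r a U yN Nr.
rewrite /valid_na smaller_right_to_r //.
case e : (smaller_right_to r N) => [|w s] //=.
apply: (@valid_step _ _ y w a false _ hr Nr (smaller_right_to_mem e) LS).
by move=> z zl; apply: root_path_node_r.
Qed.

(* The node at which N, inserted as a left child, has no label right to it. *)
Fixpoint open_slot d t : T :=
  if t is Node l y r then
    if r is Leaf then open_slot y l else open_slot y r
  else d.

(** The one node under which [N] must hang as a left child for [a] to be an admissible [n_a]. It is
    [a] itself when [a] has no left subtree. *)
Definition slot t a := open_slot a (left_subtree t a).

Lemma open_slotE d l y r : open_slot d (Node l y r) =
  if r == Leaf then open_slot y l else open_slot y r.
Proof. by rewrite /=; case: r. Qed.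

Lemma open_slot_cons d t : open_slot d t \in d :: inorder t.
Proof.
elim: t d => [|l IHl y r IHr] d; first exact: mem_head.
rewrite open_slotE; case: (r =P Leaf) => _; [have := IHl y | have := IHr y];
  by rewrite !in_cons mem_cat in_cons => /orP[->|->]; rewrite ?orbT.
Qed.

Lemma open_slot_mem d t : t != Leaf -> open_slot d t \in inorder t.
Proof.
case: t => [|l y r] // _; rewrite open_slotE.
case: (r =P Leaf) => _; [have := open_slot_cons y l | have := open_slot_cons y r];
  by rewrite in_cons mem_cat in_cons => /orP[->|->]; rewrite ?orbT.
Qed.

Lemma open_slot_free d t : uniq (inorder t) -> t != Leaf ->
  left_subtree t (open_slot d t) = Leaf.
Proof.
elim: t d => // l IHl y r IHr d U _; have [yl yr ul ur lr] := uniq_node U.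
rewrite open_slotE; case: eqP => [e|/eqP re].
  case: (l =P Leaf) => [->|/eqP le]; first exact: (side_subtree_root true Leaf y r).
  rewrite -[left_subtree _ _]/(side_subtree true _ _) side_subtree_l ?open_slot_mem //.
  exact: IHl.
rewrite -[left_subtree _ _]/(side_subtree true _ _) side_subtree_r ?open_slot_mem //.
exact: IHr.
Qed.

Lemma slot_mem t a : a \in inorder t -> slot t a \in inorder t.
Proof.
move=> at_; have := open_slot_cons a (left_subtree t a); rewrite inE -/(slot t a).
by case/orP => [/eqP->//|/(@side_subtree_mem true)].
Qed.

Lemma slot_free t a : uniq (inorder t) -> a \in inorder t ->
  side_subtree true t (slot t a) = Leaf.
Proof.
move=> U at_; rewrite /slot; case: (left_subtree t a =P Leaf) => [e|/eqP e]; first by rewrite /= e.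
have h := open_slot_mem a e; have := subtree_side (b := true) U h.
have uu : uniq (inorder (left_subtree t a)).
  by move: (subtree_uniq a U); rewrite subtree_node // => /uniq_node[].
by have := open_slot_free a uu e; rewrite /side_subtree /left_subtree => + <-.
Qed.

Lemma slot_l l y r a : uniq (inorder (Node l y r)) -> a \in inorder l ->
  slot (Node l y r) a = slot l a.
Proof. by move=> U al; rewrite /slot; have /= -> := side_subtree_l true U al. Qed.

Lemma slot_r l y r a : uniq (inorder (Node l y r)) -> a \in inorder r ->
  slot (Node l y r) a = slot r a.
Proof. by move=> U al; rewrite /slot; have /= -> := side_subtree_r true U al. Qed.

Lemma slot_root l y r : slot (Node l y r) y = open_slot y l.
Proof. by rewrite /slot; have /= -> := side_subtree_root true l y r. Qed.

(** By [valid_na_l] and [valid_na_r], [a] is admissible when [N] is in its left subtree with no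
    smaller label right to it there. Both claims are proved in one induction, because the second at
    the root is the first for the left subtree. *)
Lemma valid_na_slot L q : uniq (inorder L) -> max_label N L -> left_child L q = Some N ->
  (forall d, (smaller_right_to L N == [::]) = (left_child L (open_slot d (del L)) == Some N)) /\
  (forall a, valid_na L N a = (a \in inorder (del L)) && (left_child L (slot (del L) a) == Some N)).
Proof.
elim: L q => // l IHl y r IHr q U m hq.
have [yl yr ul ur lr] := uniq_node U; have [hl hr hy] := max_label_node m.
have /andP[qL NL] := left_child_mem U hq.
have yN : y != N.
  apply/eqP => yN; have [le re] := hy yN; move: hq.
  by rewrite le re /left_child /left_subtree /=; case: (q == y).
have NL' : (N \in inorder l) || (N \in inorder r).
  by move: NL; rewrite /= mem_cat inE eq_sym (negbTE yN).
have dE : del (Node l y r) = Node (del l) y (del r) by rewrite /= (negbTE yN).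
rewrite dE; have Ud : uniq (inorder (Node (del l) y (del r))).
  by rewrite -dE inorder_del // filter_uniq.
case/orP: NL' => Nu.
- have Nr := lr _ Nu; have dr := del_notin Nr; rewrite dr in Ud *.
  have qr z : z \in inorder r -> (left_child (Node l y r) z == Some N) = false.
    move=> zr; rewrite left_child_r //; apply/eqP => h.
    by have /andP[_] := left_child_mem ur h; rewrite (negbTE Nr).
  (* When [N] is the left child of the root, [l] consists of [N] alone, and the root is the only
     admissible node. *)
  case: (root l =P Some N) => [rl|/eqP rl].
    have lE : l = Node Leaf N Leaf.
      by case: (l) rl hl => //= l' z r' [->] /max_label_node[_ _ /(_ erefl)[-> ->]].
    have dl : del l = Leaf by rewrite lE /= eqxx.
    have sl : smaller_right_to l N = [::].
      by rewrite lE /smaller_right_to /= ltnn.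
    have vl a : valid_na l N a = false.
      apply/negP => /valid_na_ancestor; rewrite left_ancestorsE lE /= eqxx inE.
      by case/and3P => /eqP->; rewrite eqxx.
    rewrite dl in Ud *; split=> [d|a].
      rewrite smaller_right_to_l // sl cat0s open_slotE.
      case: (r =P Leaf) => [->|/eqP re]; first by rewrite /= left_child_root rl !eqxx.
      rewrite qr; last exact: open_slot_mem.
      by case: (r) re => //= ? ? ? _; case: (inorder _).
    rewrite valid_na_l // sl eqxx andbT vl orbF /= inE.
    case: (a =P y) => [->|/eqP ay]; first by rewrite slot_root /= left_child_root rl eqxx.
    case: (boolP (a \in inorder r)) => //= ar; rewrite slot_r // qr // slot_mem //.
  have [q' hq'] : exists q', left_child l q' = Some N.
    exists q; move: hq; move: qL; rewrite /= mem_cat inE => /or3P[ql|/eqP->|qr'].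
    - by rewrite left_child_l.
    - by rewrite left_child_root => h; rewrite h eqxx in rl.
    - by move=> h; have := qr _ qr'; rewrite h eqxx.
  have [IH1 IH2] := IHl q' ul hl hq'.
  have dne : del l != Leaf.
    have /andP[q'l _] := left_child_mem ul hq'.
    have q'N : q' != N.
      apply: contra_eq_neq hq' => ->; rewrite /left_child -[left_subtree _ _]/(side_subtree true _ _).
      by rewrite side_subtree_max.
    have : q' \in inorder (del l) by rewrite mem_del // q'N.
    by case: (del l).
  have ql z : z \in inorder (del l) -> left_child (Node l y r) z = left_child l z.
    by move=> zl; rewrite left_child_l //; move: zl; rewrite mem_del // => /andP[].
  split=> [d|a].
    rewrite smaller_right_to_l // open_slotE.
    case: (r =P Leaf) => [re|/eqP re]; first by rewrite {1}re cats0 (IH1 y) ql ?open_slot_mem.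
    rewrite qr; last exact: open_slot_mem.
    by case: (r) re => //= ? ? ? _; case: (inorder _); case: (smaller_right_to _ _).
  rewrite valid_na_l // IH2 (IH1 y) /= mem_cat inE.
  case: (a =P y) => [->|/eqP ay].
    rewrite orbT slot_root ql ?open_slot_mem //= mem_del // (negbTE yl) andbF.
    by rewrite orbF.
  rewrite /=; case: (boolP (a \in inorder (del l))) => al /=; first by rewrite slot_l // ql ?slot_mem.
  by case: (boolP (a \in inorder r)) => //= ar; rewrite slot_r // qr ?slot_mem.
have Nl : N \notin inorder l by apply/negP => /lr; rewrite Nu.
have dl := del_notin Nl; rewrite dl in Ud *.
have ql z : z \in inorder l -> (left_child (Node l y r) z == Some N) = false.
  move=> zl; rewrite left_child_l //; apply/eqP => h.
  by have /andP[_] := left_child_mem ul h; rewrite (negbTE Nl).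
have qy : (left_child (Node l y r) y == Some N) = false.
  by rewrite left_child_root; apply/eqP => /root_in; rewrite (negbTE Nl).
have hq' : left_child r q = Some N.
  move: (hq); move: qL; rewrite /= mem_cat inE => /or3P[ql'|/eqP->|qr'].
  - by move=> h; have := ql _ ql'; rewrite h eqxx.
  - by move=> h; rewrite h eqxx in qy.
  - by rewrite left_child_r.
have [IH1 IH2] := IHr q ur hr hq'.
have dne : del r != Leaf.
  have /andP[q'l _] := left_child_mem ur hq'.
  have q'N : q != N.
    apply: contra_eq_neq hq' => ->; rewrite /left_child -[left_subtree _ _]/(side_subtree true _ _).
    by rewrite side_subtree_max.
  have : q \in inorder (del r) by rewrite mem_del // q'N.
  by case: (del r).
have qr z : z \in inorder (del r) -> left_child (Node l y r) z = left_child r z.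
  by move=> zl; rewrite left_child_r //; move: zl; rewrite mem_del // => /andP[].
split=> [d|a].
  by rewrite smaller_right_to_r // open_slotE (negbTE dne) (IH1 y) qr ?open_slot_mem.
rewrite valid_na_r // IH2 /= mem_cat inE.
case: (boolP (a \in inorder (del r))) => ar /=; first by rewrite !orbT slot_r // qr ?slot_mem.
rewrite orbF; case: (boolP (a \in inorder l)) => /= al; first by rewrite slot_l // ql ?slot_mem.
case: (a =P y) => //= ->; rewrite slot_root.
have := open_slot_cons y l; rewrite inE => /orP[/eqP->|zl]; first by rewrite qy.
by rewrite ql.
Qed.

(** The node of which [N] becomes the right child in the rotation at [N] with [n_a] equal to [a]. *)
Definition chain_end t a := last a (right_chain t a).

Lemma chain_end_cons t a : chain_end t a \in a :: inorder (right_subtree t a).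
Proof.
rewrite /chain_end /right_chain; case: (boolP (a \in inorder t)) => at_.
  rewrite subtree_node //=; have := mem_last a (right_spine (right_subtree t a)).
  by rewrite !inE => /orP[->//|/(@spine_inorder _ false)->]; rewrite orbT.
by rewrite subtree_notin //= mem_head.
Qed.

Lemma chain_end_mem t a : a \in inorder t -> chain_end t a \in inorder t.
Proof.
move=> at_; have := chain_end_cons t a; rewrite inE.
by case/orP => [/eqP->//|/(@side_subtree_mem false)].
Qed.

Lemma chain_end_l l y r a : uniq (inorder (Node l y r)) -> a \in inorder l ->
  chain_end (Node l y r) a = chain_end l a.
Proof.
move=> U al; have at_ : a \in inorder (Node l y r) by rewrite /= mem_cat al.
rewrite /chain_end /right_chain !subtree_node //=.
by have /= -> := side_subtree_l false U al.
Qed.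

Lemma chain_end_r l y r a : uniq (inorder (Node l y r)) -> a \in inorder r ->
  chain_end (Node l y r) a = chain_end r a.
Proof.
move=> U al; have at_ : a \in inorder (Node l y r) by rewrite /= mem_cat inE al !orbT.
rewrite /chain_end /right_chain !subtree_node //=.
by have /= -> := side_subtree_r false U al.
Qed.

(** The slot is [a] or lies in its left subtree; the chain end is [a] or lies in its right subtree.
    Two nodes separated by a common ancestor have different slots. If one is an ancestor of the
    other, the chain ends differ when the descendant is on the left, and the slots differ when it is
    on the right. *)
Lemma slot_end_inj t a a' : uniq (inorder t) -> a \in inorder t -> a' \in inorder t ->
  slot t a = slot t a' -> chain_end t a = chain_end t a' -> a = a'.
Proof.
elim: t => // l IHl y r IHr U; have [yl yr ul ur lr] := uniq_node U.
have sy : slot (Node l y r) y \in y :: inorder l by rewrite slot_root open_slot_cons.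
have ey : chain_end (Node l y r) y \in y :: inorder r.
  have := chain_end_cons (Node l y r) y.
  by have /= -> := side_subtree_root false l y r.
have A z : z \in inorder l -> chain_end (Node l y r) y <> chain_end (Node l y r) z.
  move=> zl e; rewrite e chain_end_l // in ey; have := chain_end_mem zl.
  move: ey; rewrite inE => /orP[/eqP->|h1 h2]; first by rewrite (negbTE yl).
  by have := lr _ h2; rewrite h1.
have B z : z \in inorder r -> slot (Node l y r) y <> slot (Node l y r) z.
  move=> zr e; rewrite e slot_r // in sy; have := slot_mem zr.
  move: sy; rewrite inE => /orP[/eqP->|h1 h2]; first by rewrite (negbTE yr).
  by have := lr _ h1; rewrite h2.
have D z z' : z \in inorder l -> z' \in inorder r -> slot (Node l y r) z <> slot (Node l y r) z'.
  move=> zl zr; rewrite slot_l // slot_r // => e; have := lr _ (slot_mem zl).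
  by rewrite e slot_mem.
rewrite [inorder _]/= !mem_cat !inE => /or3P[al|/eqP->|ar] /or3P[al'|/eqP->|ar'] //.
- by rewrite !slot_l // !chain_end_l //; apply: IHl.
- by move=> _ /esym/A; case.
- by move=> /D; case.
- by move=> _ /A; case.
- by move/B; case.
- by move/esym/D; case.
- by move/esym/B; case.
by rewrite !slot_r // !chain_end_r //; apply: IHr.
Qed.

End Slots.

(** * Counting saturated paths *)

Section Trees.
Variable n : nat.
Notation T := 'I_n.
Implicit Types (t u l r L : btree T) (x y z a q : T) (b : bool) (k : nat).

Definition labels k : seq T := [seq i : T <- enum 'I_n | i < k].
(** Sums over trees need an explicit list, as [btree] is infinite. An increasing tree is the tree of
    its in-order word, so permutations enumerate all of them once. *)
Definition trees k : seq (btree T) := [seq tree_of_word w | w <- permutations (labels k)].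
Definition chain_tree b k : btree T :=
  if b then link_left (fun=> Leaf) (labels k) else link_right (fun=> Leaf) (labels k).

Lemma mem_labels k p : (p \in labels k) = (p < k).
Proof. by rewrite mem_filter mem_enum andbT. Qed.

Lemma labels_uniq k : uniq (labels k).
Proof. by rewrite filter_uniq ?enum_uniq. Qed.

Lemma labels_sorted k : sorted (@lt_lab n) (labels k).
Proof.
apply: sorted_filter; first exact: lt_lab_trans.
by have := iota_ltn_sorted 0 n; rewrite -val_enum_ord sorted_map.
Qed.

Lemma labelsS (N : T) : labels N.+1 = rcons (labels N) N.
Proof.
apply: (irr_sorted_eq (@lt_lab_trans n) (@lt_lab_irr n)); first exact: labels_sorted.
  have := labels_sorted N; have : all (fun z : T => z < N) (labels N).
    by apply/allP => z; rewrite mem_labels.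
  rewrite -cats1; case: (labels N) => //= y s /andP[yN sN] ys; rewrite cat_path ys /= andbT.
  by have := mem_last y s; rewrite inE => /orP[/eqP->|/(allP sN)].
by move=> z; rewrite mem_rcons inE !mem_labels ltnS leq_eqVlt.
Qed.

Lemma good_perm_labels k t : good k t -> perm_eq (inorder t) (labels k).
Proof.
move=> /goodP[_ u h]; apply: uniq_perm; rewrite ?labels_uniq // => z.
by rewrite h mem_labels.
Qed.

Lemma mem_trees k t : (t \in trees k) = good k t.
Proof.
apply/mapP/idP => [[w]|g].
  rewrite mem_permutations => wk ->; have uw : uniq w by rewrite (perm_uniq wk) labels_uniq.
  apply/goodP; rewrite inorder_tree_of_word; split=> //; first exact: increasing_tree_of_word.
  by move=> p; rewrite (perm_mem wk) mem_labels.
exists (inorder t); first by rewrite mem_permutations; apply: good_perm_labels.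
have [i u _] := goodP _ _ g; apply: inorder_inj => //; first exact: increasing_tree_of_word.
by rewrite inorder_tree_of_word.
Qed.

Lemma trees_uniq k : uniq (trees k).
Proof.
rewrite map_inj_uniq ?permutations_uniq //.
exact: (can_inj (@inorder_tree_of_word n)).
Qed.

Lemma edges_chain b k : perm_eq (edges (chain_tree b k)) (links b (labels k)).
Proof.
apply/permP => P; rewrite /chain_tree; case: b.
  by rewrite edges_link_left big1 ?addn0.
by rewrite edges_link_right big1 ?addn0.
Qed.

Lemma inorder_chain b k : perm_eq (inorder (chain_tree b k)) (labels k).
Proof.
rewrite /chain_tree; case: b; elim: (labels k) => //= y s IH; last by rewrite perm_cons.
by rewrite cats1 perm_sym -cats1 perm_sym perm_catC perm_cons.
Qed.

Lemma good_chain b k : good k (chain_tree b k).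
Proof.
apply/goodP; split.
- apply: increasing_edges => e; rewrite (perm_mem (edges_chain b k)).
  by apply: links_sorted; apply: labels_sorted.
- by rewrite (perm_uniq (inorder_chain b k)) labels_uniq.
by move=> p; rewrite (perm_mem (inorder_chain b k)) mem_labels.
Qed.

Section Step.
Variable N : T.
Hypothesis N0 : 0 < N.

Lemma labels_cons : exists z s, labels N = z :: s.
Proof.
have n0 : 0 < n by apply: leq_ltn_trans (ltn_ord N).
have : Ordinal n0 \in labels N by rewrite mem_labels.
by case: (labels N) => // z s _; exists z, s.
Qed.

Lemma att_chain b : exists q, del N (chain_tree b N.+1) = chain_tree b N /\
  attached N (chain_tree b N.+1) q b.
Proof.
have [z [s e]] := labels_cons; exists (last z s).
have h : perm_eq (edges (chain_tree b N.+1)) ((last z s, b, N) :: edges (chain_tree b N)).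
  rewrite (permPl (edges_chain b _)) labelsS e links_rcons -e.
  by rewrite -cats1 perm_catC /= perm_cons perm_sym edges_chain.
by have [] := att_of N0 (good_chain b N.+1) (good_chain b N) h.
Qed.

(** In a chain tree, only the last node has an empty slot on the side of the chain, so [N] hanging
    on that side must prolong the chain. *)
Lemma att_chain_eq L q b : good N.+1 L -> attached N L q b ->
  (L == chain_tree b N.+1) = (del N L == chain_tree b N).
Proof.
move=> g hq; apply/eqP/eqP => [->|dL]; first by have [q' []] := att_chain b.
have [q' [d' h']] := att_chain b.
apply: (att_ext g (good_chain _ _) _ hq); first by rewrite dL d'.
suff -> : q = q' by [].
(* The conditional treats the two parents [q] and [q'] at once: each has an empty slot in the
   smaller chain tree, hence is its last node. *)
have free p : attached N (if p == q then L else chain_tree b N.+1) p b -> p \in labels N ->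
    p = last p (labels N).
  move=> hp pN; have fr w : (p, b, w) \notin links b (labels N).
    rewrite -(perm_mem (edges_chain b N)).
    move: hp; case: (p == q) => hp; first by rewrite -dL; apply: att_free hp.
    by rewrite -d'; apply: att_free hp; apply: good_chain.
  have [z [s e]] := labels_cons; rewrite e in fr pN *.
  have := count_links_parent p b (y := z) (s := s).
  rewrite -e labels_uniq e pN => /(_ isT).
  rewrite (_ : count _ _ = 0) => [h|]; first by apply/eqP; case: (p == _) h.
  apply/eqP; rewrite -leqn0 leqNgt -has_count; apply/hasPn => -[[y c] w] /= h.
  by apply: contraTneq h => -[-> ->].
have qN : q \in labels N.
  by have := att_in g hq; rewrite dL (perm_mem (inorder_chain b N)).
have qN' : q' \in labels N.
  by have := att_in (good_chain b N.+1) h'; rewrite d' (perm_mem (inorder_chain b N)).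
have := free q; rewrite eqxx => /(_ hq qN) e1.
case: (eqVneq q' q) => [//|qq].
have := free q'; rewrite (negbTE qq) => /(_ h' qN') e2; rewrite e1 e2.
by have [z [s ->]] := labels_cons.
Qed.

End Step.

(** * Saturated paths from the all-left to the all-right tree *)

Fixpoint up k j t : nat :=
  if j is j'.+1 then \sum_(s <- trees k | cover s t) up k j' s
  else (t == chain_tree true k).

Fixpoint down k j t : nat :=
  if j is j'.+1 then \sum_(s <- trees k | cover t s) down k j' s
  else (t == chain_tree false k).

(** The length [k.-1] is the number of right edges of the all-right tree, to which each step
    contributes one. *)
Definition paths k := up k k.-1 (chain_tree false k).

(** A path is cut at its tree of index [i]. Exchanging the two sums moves one step from [down] to
    [up], so the total does not depend on the cut. *)
Lemma up_down k i j : \sum_(t <- trees k) up k i t * down k j t =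
  up k (i + j) (chain_tree false k).
Proof.
elim: j i => [|j IH] i.
  rewrite addn0 /= (bigD1_seq (chain_tree false k)) ?mem_trees ?good_chain ?trees_uniq //=.
  by rewrite eqxx muln1 big1 ?addn0 // => t /negbTE->; rewrite muln0.
rewrite -addSnnS -IH /=.
under eq_bigr do rewrite big_distrr /=.
under [RHS]eq_bigr do rewrite big_distrl /=.
by rewrite (exchange_big_dep predT).
Qed.

Section Count.
Variable N : T.
Hypothesis N0 : 0 < N.
Local Notation del := (del N).
Local Notation attached := (attached N).

(** In a lower cover of [L], [N] is again a left leaf, so the induction continues. On lower covers
    [del] is injective by the slot clause of [cover_split] and surjective by [cover_lift_down]. *)
Lemma up_left L q j : good N.+1 L -> attached L q true -> up N.+1 j L = up N j (del L).
Proof.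
elim: j L q => [|j IH] L q g hq /=; first by rewrite (att_chain_eq N0 g hq).
have sp s : s \in trees N.+1 -> cover s L -> exists q', [/\ attached s q' true, cover (del s) (del L) &
    q' = last q (left_spine (subtree (del s) q))].
  rewrite mem_trees => gs c; have [] := cover_split N0 gs c.
    by case=> [q1 [a [_ _ _ h]]]; have [] := att_inj g hq h.
  case=> [b [q1 [q2 [h1 h2 c' e]]]]; have [qq bb] := att_inj g hq h2.
  by subst b q2; exists q1.
rewrite [LHS]big_seq_cond [LHS](eq_bigr (fun s => up N j (del s))); last first.
  move=> s /andP[st c]; have [q' [h _ _]] := sp s st c.
  by apply: IH h; rewrite -mem_trees.
rewrite -big_seq_cond -big_filter -(big_map del predT (up N j)) -[in RHS]big_filter.
apply: perm_big; apply: uniq_perm.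
- rewrite map_inj_in_uniq ?filter_uniq ?trees_uniq // => s s'.
  rewrite !mem_filter => /andP[c st] /andP[c' st'] e.
  have [q1 [h1 _ e1]] := sp s st c; have [q2 [h2 _ e2]] := sp s' st' c'.
  rewrite !mem_trees in st st'; apply: (att_ext st st' e h1).
  by rewrite e1 e -e2.
- by rewrite filter_uniq ?trees_uniq.
move=> t; rewrite mem_filter mem_trees; apply/mapP/andP.
  case=> s; rewrite mem_filter => /andP[c st] ->.
  by have [_ [_ -> _]] := sp s st c; rewrite good_del // -mem_trees.
case=> c gt; have [s [q' [gs hs d cs]]] := cover_lift_down N0 g hq gt c.
by exists s => //; rewrite mem_filter cs mem_trees.
Qed.

(** The dual argument: upper covers of [L] keep [N] as a right leaf, with injectivity from
    [cover_split] and surjectivity from [cover_lift_up]. *)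
Lemma down_right L q j : good N.+1 L -> attached L q false -> down N.+1 j L = down N j (del L).
Proof.
elim: j L q => [|j IH] L q g hq /=; first by rewrite (att_chain_eq N0 g hq).
have sp s : cover L s -> exists q', [/\ attached s q' false, cover (del L) (del s) &
    q' = last q (right_spine (subtree (del s) q))].
  move=> c; have [] := cover_split N0 g c.
    by case=> [q1 [a [h _ _ _]]]; have [] := att_inj g hq h.
  case=> [b [q1 [q2 [h1 h2 c' e]]]]; have [qq bb] := att_inj g hq h1.
  by subst b q1; exists q2.
rewrite [LHS]big_seq_cond [LHS](eq_bigr (fun s => down N j (del s))); last first.
  move=> s /andP[st c]; have [q' [h _ _]] := sp s c.
  by apply: IH h; rewrite -mem_trees.
rewrite -big_seq_cond -big_filter -(big_map del predT (down N j)) -[in RHS]big_filter.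
apply: perm_big; apply: uniq_perm.
- rewrite map_inj_in_uniq ?filter_uniq ?trees_uniq // => s s'.
  rewrite !mem_filter => /andP[c st] /andP[c' st'] e.
  have [q1 [h1 _ e1]] := sp s c; have [q2 [h2 _ e2]] := sp s' c'.
  rewrite !mem_trees in st st'; apply: (att_ext st st' e h1).
  by rewrite e1 e -e2.
- by rewrite filter_uniq ?trees_uniq.
move=> t; rewrite mem_filter mem_trees; apply/mapP/andP.
  case=> s; rewrite mem_filter => /andP[c st] ->.
  by have [_ [_ -> _]] := sp s c; rewrite good_del // -mem_trees.
case=> c gt; have [s [cs d]] := cover_lift_up N0 g hq c.
by exists s => //; rewrite mem_filter cs mem_trees (cover_good g cs).
Qed.

Definition is_left L := [exists q, attached L q true].

Lemma is_leftP L : reflect (exists q, attached L q true) (is_left L).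
Proof. exact: existsP. Qed.

Lemma is_rightP L : good N.+1 L -> reflect (exists q, attached L q false) (~~ is_left L).
Proof.
move=> g; apply: (iffP idP) => [nl|[q h]].
  have [q [b h]] := good_att N0 g; case: b h => h; last by exists q.
  by case/is_leftP: nl; exists q.
by apply/is_leftP => -[q' h']; have [] := att_inj g h h'.
Qed.

(** The crossing step over [t] indexed by [a], given by the trees before and after it. *)
Definition new_pair t a : btree T * btree T :=
  (attach N true (slot t a) t, attach N false (chain_end t a) t).

Lemma chain_end_free t a : good N t -> a \in inorder t ->
  side_subtree false t (chain_end t a) = Leaf.
Proof.
move=> g at_; have := spine_end_free false (good_uniq g) (good_inc g) at_.
by rewrite /chain_end /right_chain.
Qed.

Lemma att_left_child L q : good N.+1 L -> (left_child L q == Some N) = attached L q true.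
Proof.
move=> g; rewrite -[_ == _](edgesE q true N (good_uniq g)); apply/idP/idP => [e|]; last exact: att_mem.
by have [q' [b h]] := good_att N0 g; have [-> ->] := att_edge g h e.
Qed.

Lemma valid_na_att L q a : good N.+1 L -> attached L q true ->
  valid_na L N a = (a \in inorder (del L)) && attached L (slot (del L) a) true.
Proof.
move=> g hq; have h : left_child L q = Some N by apply/eqP; rewrite att_left_child.
have [_ ->] := valid_na_slot (good_uniq g) (good_max g) h.
by rewrite att_left_child.
Qed.

(** For a given [a], [valid_na_att] fixes the tree before the step and [rotate_max] the tree after
    it; conversely, [slot_end_inj] recovers [a] from the two places of [N]. *)
Lemma new_pairs t : good N t ->
  perm_eq [seq p <- [seq (L, L') | L <- trees N.+1, L' <- trees N.+1] |
     [&& is_left p.1, ~~ is_left p.2, cover p.1 p.2 & del p.1 == t]]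
    [seq new_pair t a | a <- inorder t].
Proof.
move=> gt; have u := good_uniq gt; apply: uniq_perm.
- rewrite filter_uniq // allpairs_uniq ?trees_uniq // => -[? ?] [? ?] _ _ /= [-> ->] //.
- rewrite map_inj_in_uniq // => a a' at_ at_' [e1 e2].
  have [g1 _ h1] := attachP N0 gt (slot_mem at_) (slot_free u at_).
  have [_ _ h1'] := attachP N0 gt (slot_mem at_') (slot_free u at_').
  have [g2 _ h2] := attachP N0 gt (chain_end_mem at_) (chain_end_free gt at_).
  have [_ _ h2'] := attachP N0 gt (chain_end_mem at_') (chain_end_free gt at_').
  rewrite -e1 in h1'; rewrite -e2 in h2'.
  have [s1 _] := att_inj g1 h1 h1'; have [s2 _] := att_inj g2 h2 h2'.
  exact: slot_end_inj s1 s2.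
case=> L L'; rewrite mem_filter /=; apply/idP/mapP.
  case/andP => /and4P[/is_leftP[q hq] nl c /eqP dL] /allpairsP[[L1 L2] /= [L1t L2t [e1 e2]]].
  subst L1 L2; rewrite !mem_trees in L1t L2t.
  have [] := cover_split N0 L1t c; last first.
    case=> b [q1 [q2 [h1 h2 _ _]]]; have [_ bb] := att_inj L1t hq h1.
    by case/is_leftP: nl; exists q2; rewrite bb.
  case=> q' [a [_ v d h]]; move: v; rewrite (valid_na_att a L1t hq) => /andP[aL hs].
  rewrite dL in aL hs h d; exists a => //.
  have [g1 d1 h1] := attachP N0 gt (slot_mem aL) (slot_free u aL).
  have [g2 d2 h2] := attachP N0 gt (chain_end_mem aL) (chain_end_free gt aL).
  have h' : attached L' (chain_end t a) false.
    move: h; rewrite /chain_end /right_chain (subtree_node aL) //.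
  congr pair; first by apply: (att_ext L1t g1 _ hs h1); rewrite dL d1.
  by apply: (att_ext L2t g2 _ h' h2); rewrite d d2.
case=> a aL [-> ->].
have [g1 d1 h1] := attachP N0 gt (slot_mem aL) (slot_free u aL).
have [g2 d2 h2] := attachP N0 gt (chain_end_mem aL) (chain_end_free gt aL).
have v : valid_na (attach N true (slot t a) t) N a by rewrite (valid_na_att a g1 h1) d1 aL.
have [L'' [c d h]] := cover_max N0 g1 h1 v.
have g'' := cover_good g1 c.
have -> : attach N false (chain_end t a) t = L''.
  apply: (att_ext g2 g'' _ h2); rewrite ?d2 ?d ?d1 //.
  by move: h; rewrite d1.
rewrite c d1 eqxx !andbT; apply/andP; split; last by rewrite allpairs_f ?mem_trees.
apply/andP; split; first by apply/is_leftP; exists (slot t a).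
by apply/(is_rightP g''); exists (last a (right_chain (del (attach N true (slot t a) t)) a)).
Qed.

Lemma size_good t : good N t -> size (inorder t) = N.
Proof.
move=> g; rewrite (perm_size (good_perm_labels g)) size_filter.
rewrite -(count_map _ (fun i : nat => i < N)) val_enum_ord.
have -> : iota 0 n = iota 0 N ++ iota N (n - N) by rewrite -[X in iota X (_ - _)]add0n -iotaD subnKC // ltnW.
rewrite count_cat.
rewrite (eq_in_count (a2 := predT)) => [|i]; last by rewrite mem_iota => /andP[_ ->].
rewrite count_predT size_iota (eq_in_count (a2 := pred0)) ?count_pred0 ?addn0 // => i.
by rewrite mem_iota /= leqNgt => /andP[/negbTE->].
Qed.

(* The number of saturated paths whose tree of index j has N as a right leaf. *)
Let cross j := \sum_(L <- trees N.+1 | ~~ is_left L) up N.+1 j L * down N.+1 (N - j) L.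

(** If [N] is a right leaf at index [j.+1], then at index [j] it was already one, which gives
    [cross j], or it crosses exactly at this step. The crossing paths project to pairs of a path on
    [N] labels, cut at index [j], and a node of the tree there. *)
Lemma cross_sum j : j < N -> cross j.+1 = cross j + N * paths N.
Proof.
move=> jN; rewrite /cross.
(* [E c] counts the paths by their step from index [j] to [j.+1]: it ends in a tree with [N] on the
   right and starts in one satisfying [c]. *)
pose E c := \sum_(L <- trees N.+1 | c L) \sum_(L' <- trees N.+1 | ~~ is_left L' && cover L L')
   up N.+1 j L * down N.+1 (N - j.+1) L'.
have -> : \sum_(L <- trees N.+1 | ~~ is_left L) up N.+1 j.+1 L * down N.+1 (N - j.+1) L =
    E (fun=> true).
  rewrite /E /=; under eq_bigr do rewrite big_distrl /=.
  by rewrite (exchange_big_dep predT).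
have -> : E (fun=> true) = E (fun L => ~~ is_left L) + E is_left.
  by rewrite /E (bigID is_left) /= addnC.
congr addn.
  rewrite /E [LHS]big_seq_cond [RHS]big_seq_cond; apply: eq_bigr => L /andP[Lt nl].
  rewrite mem_trees in Lt; rewrite -big_distrr /= -(subnSK jN) /=; congr muln.
  apply: eq_bigl => L'; case c : (cover L L'); rewrite ?andbF // andbT.
  have [q hq] := elimT (is_rightP Lt) nl.
  apply/(is_rightP (cover_good Lt c)); have [] := cover_split N0 Lt c.
    by case=> q' [a [h _ _ _]]; have [] := att_inj Lt hq h.
  case=> b [q1 [q2 [h1 h2 _ _]]]; have [_ bb] := att_inj Lt hq h1.
  by exists q2; rewrite bb.
(* [G t] counts the projected paths through [t]: the crossing itself projects to no step, so [t] has
   index [j] and [N - j.+1] steps remain. *)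
pose G t := up N j t * down N (N - j.+1) t.
have -> : E is_left = \sum_(t <- trees N) \sum_(p <- [seq p <- [seq (L, L') | L <- trees N.+1, L' <- trees N.+1] |
     [&& is_left p.1, ~~ is_left p.2, cover p.1 p.2 & del p.1 == t]]) G t.
  rewrite /E.
  under [RHS]eq_bigr do rewrite big_filter big_mkcond big_allpairs_dep /=.
  rewrite [RHS]exchange_big /= [LHS]big_mkcond /=; apply: eq_big_seq => L.
  rewrite mem_trees => Lt.
  rewrite (bigD1_seq (del L)) ?trees_uniq ?mem_trees ?good_del //=.
  rewrite [X in _ = _ + X]big1 ?addn0 => [|t /negbTE td]; last first.
    by apply: big1 => L' _; rewrite eq_sym td !andbF.
  case: (boolP (is_left L)) => lL /=; last by rewrite big1.
  rewrite [LHS]big_mkcond /= [LHS]big_seq [RHS]big_seq; apply: eq_bigr => L'.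
  rewrite mem_trees eqxx andbT => L't; case: ifP => // /andP[nl c].
  have [q' h'] := elimT (is_rightP L't) nl; have [q hq] := elimT (is_leftP L) lL.
  rewrite (up_left j Lt hq) (down_right _ L't h') /G; congr (_ * down _ _ _).
  have [] := cover_split N0 Lt c; first by case=> ? [? [_ _ ->]].
  case=> b [q1 [q2 [h1 h2 _ _]]]; have [_ b1] := att_inj Lt hq h1.
  by have [_] := att_inj L't h' h2; rewrite -b1.
rewrite big_seq (eq_bigr (fun t => N * G t)); last first.
  move=> t; rewrite mem_trees => gt; rewrite (perm_big _ (new_pairs gt)) big_map.
  by rewrite big_const_seq count_predT iter_addn_0 size_good // mulnC.
(* The projected length is [j + (N - j.+1)], that is, [N.-1]. *)
rewrite -big_seq -big_distrr /= /G up_down /paths; congr (_ * up _ _ _); lia.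
Qed.

(** Every path starts at the all-left tree, so [cross 0] is zero; it ends at the all-right tree, so
    [cross N] counts all paths. There are [N] equal increments in between. *)
Lemma paths_step : paths N.+1 = N * (N * paths N).
Proof.
have h j : j <= N -> cross j = j * (N * paths N).
  elim: j => [_|j IH jN]; last by rewrite cross_sum // IH 1?ltnW // mulSn addnC.
  rewrite mul0n /cross big_seq_cond big1 // => L /andP[Lt nl] /=.
  case: (L =P chain_tree true N.+1) => [e|]; rewrite ?mul0n //.
  have [q [_ hq]] := att_chain N0 true.
  by case/is_leftP: nl; exists q; rewrite e.
rewrite -(h N) // /cross subnn /paths /=.
have [q [_ hq]] := att_chain N0 false.
have nl : ~~ is_left (chain_tree false N.+1) by apply/(is_rightP (good_chain false N.+1)); exists q.
rewrite big_mkcond (bigD1_seq (chain_tree false N.+1)) ?mem_trees ?good_chain ?trees_uniq //=.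
rewrite nl eqxx muln1 big1 ?addn0 // => t /negbTE->.
by rewrite muln0 if_same.
Qed.

End Count.
End Trees.

(** * Maximal chains of a graded poset *)

Section Graded.
Variables (X : finType) (e : rel X) (r : X -> nat) (bot top : X).
Hypothesis r_bot : r bot = 0.
Hypothesis r_cover : forall x y, e x y -> r y = (r x).+1.
Hypothesis above : forall x, x != top -> exists y, e x y.
Hypothesis below : forall x, x != bot -> exists y, e y x.

Definition comparable_set (C : {set X}) : bool :=
  [forall x in C, forall y in C, connect e x y || connect e y x].

(** A path from [bot] is recorded by its vertices after [bot], following the convention of
    [path]. *)
Fixpoint saturated_paths j (y : X) : seq (seq X) :=
  if j is j'.+1 then
    [seq rcons p y | x <- [seq x <- enum X | e x y], p <- saturated_paths j' x]
  else if y == bot then [:: [::]] else [::].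

Lemma mem_saturated_paths j y p : (p \in saturated_paths j y) =
  [&& size p == j, path e bot p & last bot p == y].
Proof.
elim: j y p => [|j IH] y p /=.
  case: (y =P bot) => [->|/eqP yb]; first by case: p => //=; rewrite eqxx.
  by case: p => //=; rewrite eq_sym (negbTE yb).
apply/allpairsPdep/idP => [[x [q [+ + ->]]]|].
  rewrite mem_filter => /andP[exy _]; rewrite IH => /and3P[/eqP<- bq /eqP lx].
  by rewrite size_rcons rcons_path last_rcons bq lx exy !eqxx.
case/lastP: p => [|p z] //; rewrite size_rcons rcons_path last_rcons eqSS.
case/and3P => sp /andP[bp ez] /eqP zy; subst z; exists (last bot p), p.
by rewrite mem_filter mem_enum ez IH sp bp eqxx.
Qed.

Lemma saturated_paths_uniq j y : uniq (saturated_paths j y).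
Proof.
elim: j y => [|j IH] y /=; first by case: ifP.
apply: allpairs_uniq_dep => //; first by rewrite filter_uniq ?enum_uniq.
move=> /= u v /allpairsPdep[x [p [_ + ->]]] /allpairsPdep[x' [p' [_ + ->]]] /=.
rewrite !mem_saturated_paths => /and3P[_ _ /eqP lx] /and3P[_ _ /eqP lx'].
by move=> /rcons_inj[pp]; rewrite -lx -lx' pp.
Qed.

Lemma path_rank x p : path e x p -> r (last x p) = r x + size p.
Proof.
elim: p x => [|y p IH] x /=; first by rewrite addn0.
by case/andP => /r_cover h /IH->; rewrite h addSnnS.
Qed.

Lemma connect_bot x : connect e bot x.
Proof.
have [m] := ubnP (r x); elim: m x => // m IH x; rewrite ltnS => xm.
case: (eqVneq x bot) => [->|/below[y eyx]]; first exact: connect0.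
apply: connect_trans (connect1 eyx); apply: IH.
by rewrite -(r_cover eyx).
Qed.

Lemma connect_top x : connect e x top.
Proof.
have [m] := ubnP (\max_z r z - r x); elim: m x => // m IH x; rewrite ltnS => xm.
case: (eqVneq x top) => [->|/above[y exy]]; first exact: connect0.
apply: connect_trans (connect1 exy) _; apply: IH.
have := r_cover exy; have := @leq_bigmax _ r y; lia.
Qed.

Lemma connect_path_refine x s : path (connect e) x s ->
  exists p, [/\ path e x p, last x p = last x s & {subset x :: s <= x :: p}].
Proof.
elim: s x => [|y s IH] x /=; first by exists [::]; split=> // z.
case/andP => /connectP[p1 xp1 yE] /IH[p2 [yp2 l2 sub]]; exists (p1 ++ p2).
rewrite cat_path xp1 last_cat -yE yp2; split=> // z; rewrite inE => /orP[/eqP->|/sub].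
  exact: mem_head.
rewrite -cat_cons mem_cat inE => /orP[/eqP->|->]; last by rewrite orbT.
by rewrite yE mem_last.
Qed.

Lemma path_comparable x p : path e x p -> comparable_set [set z in x :: p].
Proof.
move=> xp; apply/forall_inP => y; rewrite inE => yp; apply/forall_inP => z; rewrite inE => zp.
elim: p x xp yp zp => [|w p IH] x.
  by rewrite !inE => _ /eqP-> /eqP->; rewrite connect0.
move=> xp; have c := path_connect xp; rewrite ![_ \in [:: x, w & p]]in_cons.
case/orP => [/eqP->|yp].
  by case/orP => [/eqP->|zp]; rewrite ?connect0 // c // in_cons zp orbT.
case/orP => [/eqP->|zp]; first by rewrite orbC c // in_cons yp orbT.
by case/andP: xp => _ wp; apply: IH wp yp zp.
Qed.

(** The order is total on [C], so sorting lists [C] as a chain. After adding [bot] in front and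
    [top] at the end, each comparison is refined into a path of covers. *)
Lemma comparable_set_path C : comparable_set C ->
  exists p, [/\ path e bot p, last bot p = top & {subset C <= bot :: p}].
Proof.
move=> cC; pose s := sort (connect e) (enum C).
have ss : sorted (connect e) s.
  apply: (sort_sorted_in (P := mem C)); last by apply/allP => z; rewrite mem_enum.
  by move=> y z yC zC; have /forall_inP/(_ y yC)/forall_inP/(_ z zC) := cC.
have bs : path (connect e) bot (rcons s top).
  rewrite rcons_path connect_top andbT; case: s ss => //= y s ->.
  by rewrite connect_bot.
have [p [bp lp sub]] := connect_path_refine bs; exists p; split=> //.
  by rewrite lp last_rcons.
move=> z zC; apply: sub; rewrite in_cons mem_rcons in_cons mem_sort mem_enum zC.
by rewrite !orbT.
Qed.

Lemma path_sorted_rank x p : path e x p -> sorted (fun y z => r y < r z) (x :: p).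
Proof. by apply: sub_path => y z /r_cover->. Qed.

Lemma rank_trans : transitive (fun y z => r y < r z).
Proof. by move=> y x z; apply: ltn_trans. Qed.

Lemma rank_irr : irreflexive (fun y z => r y < r z).
Proof. by move=> x; apply: ltnn. Qed.

Lemma card_path x p : path e x p -> #|[set z in x :: p]| = (size p).+1.
Proof.
move=> /path_sorted_rank/(sorted_uniq rank_trans rank_irr) u.
by rewrite cardsE (card_uniqP u).
Qed.

(** Each chain lies on the vertex set of a saturated path from [bot] to [top], and all these sets
    have [(r top).+1] elements, so none properly contains another. The strictly increasing rank
    recovers the path from its set. *)
Lemma card_maximal_chains :
  #|[set C : {set X} | maxset comparable_set C]| = size (saturated_paths (r top) top).
Proof.
have sz p : path e bot p -> last bot p = top -> size p = r top.
  by move=> bp <-; rewrite (path_rank bp) r_bot.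
pose f p := [set z in bot :: p].
rewrite -(size_map f); have u : uniq (map f (saturated_paths (r top) top)).
  rewrite map_inj_in_uniq ?saturated_paths_uniq // => p q.
  rewrite !mem_saturated_paths => /and3P[_ bp _] /and3P[_ bq _] fpq.
  have [] // : bot :: p = bot :: q.
  apply: (irr_sorted_eq rank_trans rank_irr); try exact: path_sorted_rank.
  by move=> z; move/setP/(_ z): fpq; rewrite !inE.
rewrite -(card_uniqP u); apply: eq_card => C; rewrite inE; apply/idP/mapP.
  case/maxsetP => cC mC; have [p [bp lp sub]] := comparable_set_path cC.
  exists p; first by rewrite mem_saturated_paths bp lp sz // !eqxx.
  apply/esym/mC; first exact: path_comparable.
  by apply/subsetP => z /sub; rewrite /f in_set.
case=> p; rewrite mem_saturated_paths => /and3P[_ bp /eqP lp] ->.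
apply/maxsetP; split; first exact: path_comparable.
move=> D cD pD; have [q [bq lq sub]] := comparable_set_path cD.
have Dq : D \subset f q by apply/subsetP => z /sub; rewrite /f in_set.
apply/esym/eqP; rewrite eqEcard pD (leq_trans (subset_leq_card Dq)) //.
by rewrite !card_path // !sz.
Qed.

Lemma size_saturated_pathsS j y :
  size (saturated_paths j.+1 y) = \sum_(x | e x y) size (saturated_paths j x).
Proof.
rewrite /= size_allpairs_dep sumnE big_map big_filter.
by rewrite big_enum_cond.
Qed.

End Graded.

(** * Extremal trees and the final count *)

Section Final.
Variable n : nat.
Implicit Types (t : btree 'I_n) (k : nat).

Lemma good1 b t : good 1 t -> t = chain_tree n b 1.
Proof.
have nil t' : good 1 t' -> edges t' = [::].
  move=> g; have [i _ h] := goodP _ _ g; case E : (edges t') => [//|[[y c] z] s].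
  have ez : (y, c, z) \in edges t' by rewrite E mem_head.
  have := edges_increasing i ez; have /andP[_] := edges_mem ez.
  by rewrite h ltnS leqn0 /= => /eqP->.
move=> g; apply: (good_ext g (good_chain n b 1)).
by rewrite !nil // good_chain.
Qed.

(** If [N] hangs on the left of [q], then [q] has no left subtree in [del N t], so its slot is
    itself and it is an admissible [n_a]. If [N] hangs on the right, a cover of [del N t] lifts. *)
Lemma cover_above k t : k < n -> good k.+1 t -> t != chain_tree n false k.+1 ->
  exists t', cover t t'.
Proof.
elim: k t => [|k IH] t kn g; first by rewrite (good1 false g) eqxx.
pose N := Ordinal kn; have N0 : 0 < N by [].
rewrite -[k.+2]/(N.+1) in g *; have [q [b hq]] := good_att N0 g; case: b hq => hq ne.
  have qt := att_in g hq; have gt := good_del g.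
  have lq : left_subtree (del N t) q = Leaf.
    by apply: (free_leaf (b := true) (good_uniq gt)) => w; apply: att_free hq.
  have v : valid_na t N q by rewrite (valid_na_att N0 q g hq) qt /slot lq.
  by have [t' [c _ _]] := cover_max N0 g hq v; exists t'.
have [|s c] := IH (del N t) (ltnW kn) (good_del g).
  by rewrite -(att_chain_eq N0 g hq).
by have [t' [c' _]] := cover_lift_up N0 g hq c; exists t'.
Qed.

(** If [N] hangs on the left, a lower cover of [del N t] lifts. If it hangs on the right of [q],
    then [q] ends its own right chain in [del N t], and the crossing step indexed by [q] leads to
    [t]. *)
Lemma cover_below k t : k < n -> good k.+1 t -> t != chain_tree n true k.+1 ->
  exists s, good k.+1 s /\ cover s t.
Proof.
elim: k t => [|k IH] t kn g; first by rewrite (good1 true g) eqxx.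
pose N := Ordinal kn; have N0 : 0 < N by [].
rewrite -[k.+2]/(N.+1) in g *; have [q [b hq]] := good_att N0 g; case: b hq => hq ne.
  have [|s [gs c]] := IH (del N t) (ltnW kn) (good_del g).
    by rewrite -(att_chain_eq N0 g hq).
  by have [s' [q' [g' _ _ c']]] := cover_lift_down N0 g hq gs c; exists s'.
have qt := att_in g hq; have gt := good_del g; have ut := good_uniq gt.
have [g1 d1 h1] := attachP N0 gt (slot_mem qt) (slot_free ut qt).
have v : valid_na (attach N true (slot (del N t) q) (del N t)) N q.
  by rewrite (valid_na_att N0 q g1 h1) d1 qt.
have [s [c d h]] := cover_max N0 g1 h1 v.
suff -> : t = s by eexists; split; first exact: g1.
have rq : right_subtree (del N t) q = Leaf.
  by apply: (free_leaf (b := false) ut) => w; apply: att_free hq.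
apply: (att_ext g (cover_good g1 c) _ hq); first by rewrite d d1.
by move: h; rewrite d1 /right_chain (subtree_node qt) rq.
Qed.

Lemma paths_fact k : k < n -> paths n k.+1 = (k`!) ^ 2.
Proof.
elim: k => [kn|k IH kn].
  by rewrite /paths (good1 true (good_chain n false 1)) /= eqxx.
have N0 : 0 < Ordinal kn by [].
rewrite -[k.+2]/((Ordinal kn).+1) (paths_step N0) /= IH ?(ltnW kn) //.
rewrite factS; lia.
Qed.

End Final.

Theorem theorem3p86 (n : nat) (hn : 1 <= n) :
  #|[set C : {set NCCP n} | is_maximal_chain C]| = ((n - 1)`!) ^ 2.
Proof.
have nE : n = (n - 1).+1 by rewrite subn1 prednK.
have kn : n - 1 < n by rewrite {2}nE.
have gl (L : ltree n) : good n L.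
  case/andP: (ltreeP L) => c i; apply/goodP; split=> //; first exact: count_mem1_uniq.
  by move=> p; rewrite ltn_ord -has_pred1 has_count (eqP (forallP c p)).
(* Trees on all [n] labels are the values of [phi_inv], which transfers the results on [good n]
   trees to partitions. *)
have lg t : good n t -> exists pi : NCCP n, phi_inv pi = t :> btree _.
  case/goodP => i u h; have tP : is_ltree t.
    by rewrite /is_ltree i andbT; apply/forallP => p; rewrite count_uniq_mem // h ltn_ord.
  by exists (phi (MkLtree tP)); rewrite phiK.
have inj : injective (fun pi : NCCP n => ltree_val (phi_inv pi)).
  by move=> pi pi' /val_inj/(can_inj (@phi_invK n)).
have [bot botE] := lg _ (good_chain n true n).
have [top topE] := lg _ (good_chain n false n).
pose r (pi : NCCP n) := rank (phi_inv pi).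
(* The chain tree on [n] labels has [n - 1] edges, all on side [b], and the rank counts those on the
   right. *)
have rk b : rank (chain_tree n b n) = ~~ b * (n - 1).
  rewrite /rank (permP (edges_chain n b n)).
  have h := count_links_side false b (labels n n).
  rewrite (eq_count (a2 := fun e => e.1.2 == false)) => [|[[? c] ?] /=]; last by case: c.
  rewrite h (_ : size (labels n n) = n) -?subn1; first by case: (b).
  rewrite size_filter -[RHS](size_enum_ord n) -count_predT; apply: eq_count => i.
  by rewrite ltn_ord.
have rc : forall x y, @nccp_cover n x y -> r y = (r x).+1.
  by move=> x y; apply: cover_rank (gl _).
rewrite (card_maximal_chains (r := r) (bot := bot) (top := top)) //.
- rewrite /r topE rk mul1n.
  (* The two recursions agree once the sum over [trees n] is reindexed by partitions along
     [phi_inv]. *)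
  have szE j (pi : NCCP n) : size (saturated_paths (@nccp_cover n) bot j pi) = up n j (phi_inv pi).
    have pe : perm_eq (trees n n) [seq ltree_val (phi_inv x) | x <- index_enum (NCCP n)].
      apply: uniq_perm; rewrite ?trees_uniq ?map_inj_uniq ?index_enum_uniq // => t.
      rewrite mem_trees; apply/idP/mapP => [/lg[x <-]|[x _ ->]]; last exact: gl.
      by exists x; rewrite ?mem_index_enum.
    elim: j pi => [|j IH] pi.
      rewrite -[up n 0 _]/(nat_of_bool (ltree_val (phi_inv pi) == chain_tree n true n)).
      by rewrite -botE (inj_eq inj) /=; case: (pi == bot).
    rewrite size_saturated_pathsS /= (perm_big _ pe) big_map.
    by apply: eq_bigr => x _; apply: IH.
  by rewrite szE topE -(paths_fact kn) -nE /paths subn1.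
- by rewrite /r botE rk.
- move=> x xt; have [||t' c] := cover_above kn (t := phi_inv x).
  + by rewrite -nE.
  + by rewrite -nE -topE (inj_eq inj).
  have [y yE] := lg t' (cover_good (gl _) c); exists y.
  by rewrite /nccp_cover /is_rotation yE.
move=> x xt; have [||s [gs c]] := cover_below kn (t := phi_inv x).
- by rewrite -nE.
- by rewrite -nE -botE (inj_eq inj).
rewrite -nE in gs; have [y yE] := lg s gs; exists y.
by rewrite /nccp_cover /is_rotation yE.
Qed.
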